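(* Every function $f\in\mathcal R^0_{[1]}(\mathbb R^2)$ that is non-negative on $\mathbb R^2$ can be written as $f=\sum_{i=1}^r f_i^2$ with $f_i\in\mathcal R^0_{[1]}(\mathbb R^2)$. Moreover, if $f=p/q$ on $\mathrm{dom}(f)$ where $p,q\in\mathbb R[x,y]$ are sums of squares of polynomials and $q$ is locally positive definite at every point of $\mathbb R^2$, then the $f_i$ can be chosen of the form $f_i=r_i/D$ with $r_i\in\mathbb R[x,y]$ and common denominator $D=q\cdot\prod_{a\in\mathcal Z_f(q)}q_a$, where $\mathcal Z_f(q)=\{a\in\mathbb R^2: q(a)=0,\ f(a)\neq0\}$ and $q_a$ is the homogeneous component of lowest degree of $q$ at $a$ (viewed as a polynomial in $(x-a_1,y-a_2)$).
   Context: For $k\in\mathbb N\cup\{\infty\}$, $\mathcal R^k(\mathbb R^2)$ denotes the ring of functions $f:\mathbb R^2\to\mathbb R$ of class $C^k$ that coincide with $p/q$ ($p,q$ polynomials, $q$ nonvanishing there) on some nonempty Zariski open set; $\mathrm{dom}(f)$ is the largest Zariski open set on which the associated rational function is regular. For $l\in\mathbb N$: consider compositions $\pi:M\to\mathbb R^2$ of successive blowings-up $M_i\to M_{i-1}$ ($M_0=\mathbb R^2$), each centred at points. An infinitely near point of order $j$ is a sequence $a_0\in M_0,\dots,a_j\in M_j$ where $M_i$ is the blowing-up of $M_{i-1}$ at $a_{i-1}$ and $a_i$ maps to $a_{i-1}$; the number of stages of $\pi$ is the maximal order of infinitely near points in $M$. $\mathcal R^k_{[l]}(\mathbb R^2)$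 is the set of $f\in\mathcal R^k(\mathbb R^2)$ for which there is such a $\pi$ with at most $l$ stages such that $f\circ\pi$ is regular on $M$. A polynomial $p\in\mathbb R[x,y]$ is locally positive definite at $a=(a_1,a_2)$ if, writing $p=\sum_{i\ge m}p_i$ with $p_i$ homogeneous of degree $i$ in the variables $(x-a_1,y-a_2)$ and $p_m\neq 0$, the lowest component $p_m$ is positive at every point of $\mathbb R^2$ other than $a$ (when $p(a)\ne 0$ this means $p(a)>0$). *)

(* Defs.v *)
From Stdlib Require Import Reals Lra List.
Import ListNotations.
Open Scope R_scope.

Definition R2 : Type := (R * R)%type.

Definition rsum (n : nat) (g : nat -> R) : R := sum_f_R0 g n.

(** Polynomials in R[x,y]: coefficient array c i j (coefficient of x^i y^j),
    with all (i,j) with i > pdeg or j > pdeg treated as 0. *)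
Record poly2 : Type := Poly2 { pdeg : nat; pcoef : nat -> nat -> R }.

Definition ev (P : poly2) (z : R2) : R :=
  rsum (pdeg P) (fun i => rsum (pdeg P) (fun j =>
    pcoef P i j * (fst z) ^ i * (snd z) ^ j)).

Definition zclosed (Z : R2 -> Prop) : Prop :=
  exists F : poly2 -> Prop, forall z, Z z <-> (forall P, F P -> ev P z = 0).
Definition zopen (U : R2 -> Prop) : Prop := zclosed (fun z => ~ U z).

Definition continuous2 (f : R2 -> R) : Prop :=
  forall z eps, 0 < eps -> exists delta, 0 < delta /\
    forall w, Rabs (fst w - fst z) < delta -> Rabs (snd w - snd z) < delta ->
      Rabs (f w - f z) < eps.

Definition rational_fun (f : R2 -> R) : Prop :=
  exists (P Q : poly2) (U : R2 -> Prop), zopen U /\ (exists z, U z) /\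
    forall z, U z -> ev Q z <> 0 /\ f z = ev P z / ev Q z.

Definition R0 (f : R2 -> R) : Prop := continuous2 f /\ rational_fun f.

Definition regular_at (g : R2 -> R) (w : R2) : Prop :=
  exists (P Q : poly2) (U : R2 -> Prop), zopen U /\ U w /\ ev Q w <> 0 /\
    forall z, U z -> ev Q z <> 0 /\ g z = ev P z / ev Q z.

(** Regularity of f o pi on M, where pi : M -> R^2 is the blowing-up of R^2 at
    the finitely many points of S (a composition of blowings-up with at most
    one stage).  M is covered by R^2 \ S and, for each a in S, by the two
    standard affine charts (u,v) |-> (a1+u, a2+uv) and (u,v) |-> (a1+uv, a2+v)
    around the exceptional divisor over a. *)
Definition regular_after_blowup (S : list R2) (f : R2 -> R) : Prop :=
  (forall z, ~ In z S -> regular_at f z) /\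
  (forall a, In a S ->
     (forall v, regular_at (fun w => f (fst a + fst w, snd a + fst w * snd w)) (0, v)) /\
     (forall u, regular_at (fun w => f (fst a + fst w * snd w, snd a + snd w)) (u, 0))).

Definition R0_1 (f : R2 -> R) : Prop :=
  R0 f /\ exists S : list R2, NoDup S /\ regular_after_blowup S f.

Definition sum_sq_funs (fs : list (R2 -> R)) (z : R2) : R :=
  fold_right (fun g acc => (g z) ^ 2 + acc) 0 fs.

Definition is_sos (P : poly2) : Prop :=
  exists gs : list poly2, forall z,
    ev P z = fold_right (fun g acc => (ev g z) ^ 2 + acc) 0 gs.

(** Coefficients of q as a polynomial in (x - a1, y - a2) (Taylor expansion):
    q = sum_{k,l <= pdeg q} shiftc q a k l (x-a1)^k (y-a2)^l. *)
Definition shiftc (q : poly2) (a : R2) (k l : nat) : R :=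
  rsum (pdeg q) (fun i => rsum (pdeg q) (fun j =>
    if (Nat.leb k i && Nat.leb l j)%bool then
      pcoef q i j * C i k * C j l * (fst a) ^ (i - k) * (snd a) ^ (j - l)
    else 0)).

Definition hcomp (q : poly2) (a : R2) (d : nat) (z : R2) : R :=
  rsum (pdeg q) (fun k => rsum (pdeg q) (fun l =>
    if Nat.eqb (k + l) d then
      shiftc q a k l * (fst z - fst a) ^ k * (snd z - snd a) ^ l
    else 0)).

Definition lowest_deg (q : poly2) (a : R2) (m : nat) : Prop :=
  (exists k l, (k <= pdeg q)%nat /\ (l <= pdeg q)%nat /\ (k + l = m)%nat /\
               shiftc q a k l <> 0) /\
  (forall k l, (k <= pdeg q)%nat -> (l <= pdeg q)%nat -> (k + l < m)%nat ->
               shiftc q a k l = 0).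

Definition loc_pos_def (q : poly2) (a : R2) : Prop :=
  exists m, lowest_deg q a m /\ forall z, z <> a -> 0 < hcomp q a m z.

(* Main.v *)
(** Part 2. From [f = p/q] with [p = sum p_i^2] and [q = sum q_j^2] we get
    [f q^2 = sum (p_i q_j)^2]. Where [f] vanishes the quotients [p_i q_j / q] are automatically
    continuous, being bounded by [sqrt f]. At a zero [a] of [q] with [f a <> 0] one multiplies by
    the square of the leading form of [q] at [a], which up to a constant is the sum of the
    squares of the leading forms of the numerators, and expands by Lagrange's identity: in the
    result one numerator has a leading form proportional to that of the denominator, the others
    have larger order. A quotient of polynomials that is continuous and whose denominator has a
    definite leading form becomes regular after blowing up the point once.

    Part 1. Regularity of [f] after the blowing-up yields a polynomial [q] with [f q] polynomial
    and with definite leading forms, and the non-negative polynomial [f q * q] becomes a sum of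
    squares after multiplication by the square of a polynomial [c] in [x] without real zeros.
    This sharp form of Hilbert's 17th problem in two variables is obtained as follows. By Artin and
    Schreier it suffices that a non-negative [F] in [R[x,y]] is non-negative in every ordering of
    [R(x,y)]. After a change of variable [x] is a positive infinitesimal [t]; if [F] is negative
    at [(t, y)], then the Newton-Puiseux algorithm run along the ordering, passing to
    [t = tau^e] and [y = tau^p (a + y')] with [a] the standard part of [y / tau^p], reaches
    after finitely many steps (the discriminant bounds them) a situation in which [F] is
    visibly negative at a real point. The descent of Cassels then removes [y] from the
    denominator, and real zeros of the denominator cancel. *)

From HB Require structures.
From mathcomp Require all_boot all_order all_algebra all_field ring zify.
From mathcomp Require boolp classical_sets reals polyrcf generic_quotient Rstruct.
From Coquelicot Require Hierarchy Continuity ElemFct.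
Require Import Defs.
From Stdlib Require Import Reals List Lra Lia Classical ClassicalEpsilon.
Import ListNotations.
Open Scope R_scope.

(** Both statements come from one construction: the first applies [corrected_sum_of_squares] to the
    denominator [(q c)^2], where [f q] is polynomial and [q] has definite leading forms at the
    centres. Here [c] must have no real zeros, since it depends on [x] alone and a zero would make
    the denominator vanish on a whole line. The polynomial [q] is built from the multipliers of [f],
    the [Q] with [f Q] polynomial: continuity of [f] makes such an identity global once it holds on
    a non-empty Zariski open set, so that local regularity yields global multipliers. The positivity
    argument uses no real closure: a Newton-Puiseux step only adjoins a positive root of [X^e - t]
    to the current ordered field. Termination is controlled by the order [m] of [G(0, y)] at the
    current point and by the order in [x] of some [c] in the ideal of [G] and its derivative in [y].
    A step lowers [m], or else [e = 1] and the order of [c] drops by [p (m - 1)]. Both charts of a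
    blowing-up are treated at once by [(s, w) -> a + s w]; the value of a continuous function on the
    exceptional divisor is a limit along a ray. *)

Module RealPlane.
Import HB.structures all_boot all_order all_algebra all_field ring zify.
Import boolp classical_sets reals polyrcf generic_quotient.
Import Order.TTheory GRing.Theory Num.Theory.
Set Implicit Arguments.
Unset Strict Implicit.
Unset Printing Implicit Defensive.
Local Open Scope ring_scope.

(** * Orderings of fields *)

Record preordering (K : fieldType) (T : K -> Prop) : Prop := Preordering {
  preD : forall x y, T x -> T y -> T (x + y);
  preM : forall x y, T x -> T y -> T (x * y);
  preX : forall x, T (x ^+ 2);
  preN1 : ~ T (-1) }.

Section Ordering.
Variable K : fieldType.
Implicit Types (T : K -> Prop) (x y : K).

Lemma pre0 T : preordering T -> T 0.
Proof. by move=> hT; have := preX hT 0; rewrite expr0n. Qed.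
Lemma pre1 T : preordering T -> T 1.
Proof. by move=> hT; have := preX hT 1; rewrite expr1n. Qed.

(** Were [-1 = a + x * b], then [b != 0] and [- x = (1 + a) * b * b^-1 ^+ 2] would already lie in
    [T]. *)
Lemma preordering_adjoin T x : preordering T -> ~ T (- x) ->
  preordering (fun z => exists a b, [/\ T a, T b & z = a + x * b]).
Proof.
move=> hT nTx; split.
- move=> _ _ [a [b [Ta Tb ->]]] [c [d [Tc Td ->]]].
  exists (a + c), (b + d); split; [exact: preD|exact: preD|].
  by rewrite mulrDr addrACA.
- move=> _ _ [a [b [Ta Tb ->]]] [c [d [Tc Td ->]]].
  exists (a * c + x ^+ 2 * (b * d)), (a * d + b * c).
  split; [|by apply: preD => //; apply: preM|].
    by apply: preD => //; apply: preM => //; [exact: preX|exact: preM].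
  by ring.
- move=> z; exists (z ^+ 2), 0; split; [exact: preX|exact: pre0|].
  by rewrite mulr0 addr0.
- move=> [a [b [Ta Tb e]]]; case: (eqVneq b 0) => [b0|b0].
    by apply: (preN1 hT); rewrite e b0 mulr0 addr0.
  apply: nTx.
  have -> : - x = (1 + a) * b * b^-1 ^+ 2.
    have -> : 1 + a = - (x * b) by rewrite -[1]opprK e; ring.
    by rewrite expr2 !mulNr mulrA mulfK // mulfK.
  apply: preM => //; [|exact: preX]; apply: preM => //; apply: preD => //; exact: pre1.
Qed.

(** Zorn's lemma runs over the sets whose union with [T] is a preordering, because the empty chain
    must have an admissible union. Maximality forbids adjoining [x] when [- x] is missing. *)
Lemma preordering_maximal T : preordering T ->
  exists M, [/\ preordering M, forall x, T x -> M x & forall x, M x \/ M (- x)].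
Proof.
move=> hT.
have [F FP totF|A [PA maxA]] := @Zorn_bigcup K [set X : set K | preordering (fun x => X x \/ T x)]%classic.
  have chain x y : (\bigcup_(X in F) X)%classic x \/ T x -> (\bigcup_(X in F) X)%classic y \/ T y ->
      (exists2 X, F X & (X x \/ T x) /\ (X y \/ T y)) \/ (T x /\ T y).
    case=> [[X FX Xx]|Tx]; case=> [[Y FY Yy]|Ty]; last by right.
    - left; case: (totF X Y FX FY) => s; first by exists Y => //; split; left=> //; exact: s.
      by exists X => //; split; left=> //; exact: s.
    - by left; exists X => //; split; [left|right].
    - by left; exists Y => //; split; [right|left].
  split.
  - move=> x y hx hy; case: (chain x y hx hy) => [[X FX [hx' hy']]|[Tx Ty]]; last by right; exact: preD.
    by case: (preD (FP X FX) hx' hy'); [left; exists X|right].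
  - move=> x y hx hy; case: (chain x y hx hy) => [[X FX [hx' hy']]|[Tx Ty]]; last by right; exact: preM.
    by case: (preM (FP X FX) hx' hy'); [left; exists X|right].
  - by move=> x; right; exact: preX.
  - by case=> [[X FX XN]|]; [apply: (preN1 (FP X FX)); left|exact: preN1].
exists (fun x => A x \/ T x); split=> //; first by move=> x; right.
move=> x; apply: contrapT => /not_orP[nx nNx].
have hM := preordering_adjoin PA nNx.
apply: (maxA (fun z => exists a b, [/\ A a \/ T a, A b \/ T b & z = a + x * b])).
  split; last first.
    move=> sub; apply: nx; left; apply: sub; exists 0, 1.
    by split; [exact: pre0 PA|exact: pre1 PA|rewrite add0r mulr1].
  move=> z Az; exists z, 0; split; [by left|exact: pre0 PA|by rewrite mulr0 addr0].
suff e : (fun z => (exists a b, [/\ A a \/ T a, A b \/ T b & z = a + x * b]) \/ T z)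
  = (fun z => exists a b, [/\ A a \/ T a, A b \/ T b & z = a + x * b]).
  by rewrite /mkset /= e.
apply: funext => z; apply: propext; split; [|by left].
case=> // Tz; exists z, 0; split; [by right|exact: pre0 PA|by rewrite mulr0 addr0].
Qed.

Section Structure.
Variable M : K -> Prop.
Hypothesis hM : preordering M.
Hypothesis totM : forall x, M x \/ M (- x).

Let le (x y : K) := `[< M (y - x) >].
Let lt (x y : K) := (y != x) && le x y.
Let norm x := if le 0 x then x else - x.

Let le0P x : reflect (M x) (le 0 x).
Proof. by rewrite /le subr0; exact: asboolP. Qed.
Let lex0P x : reflect (M (- x)) (le x 0).
Proof. by rewrite /le sub0r; exact: asboolP. Qed.
Let anti x : le 0 x -> le x 0 -> x = 0.
Proof.
move=> /le0P Mx /lex0P MNx; apply/eqP/negP => /negP x0; apply: (preN1 hM).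
have -> : -1 = x * - x * x^-1 ^+ 2 :> K by rewrite mulrN -expr2 mulNr -exprMn divff // expr1n.
by apply: (preM hM); [exact: (preM hM)|exact: (preX hM)].
Qed.
Fact ordK_add x y : le 0 x -> le 0 y -> le 0 (x + y).
Proof. by move=> /le0P ? /le0P ?; apply/le0P; exact: (preD hM). Qed.
Fact ordK_mul x y : le 0 x -> le 0 y -> le 0 (x * y).
Proof. by move=> /le0P ? /le0P ?; apply/le0P; exact: (preM hM). Qed.
Fact ordK_sub x y : le 0 (y - x) = le x y. Proof. by rewrite /le subr0. Qed.
Fact ordK_tot x : le 0 x || le x 0.
Proof. by apply/orP; case: (totM x) => h; [left; apply/le0P|right; apply/lex0P]. Qed.
Fact ordK_normN x : norm (- x) = norm x.
Proof.
rewrite /norm; case: (boolP (le 0 x)) => h1; case: (boolP (le 0 (- x))) => h2 //.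
- have -> : x = 0 by apply: anti => //; apply/lex0P/le0P.
  by rewrite oppr0.
- by rewrite opprK.
- case/orP: (ordK_tot x) => h; first by rewrite h in h1.
  by move: h2; move/lex0P/le0P: h => ->.
Qed.
Fact ordK_norm x : le 0 x -> norm x = x. Proof. by rewrite /norm => ->. Qed.
Fact ordK_lt x y : lt x y = (y != x) && le x y. Proof. by []. Qed.

(** The proofs are arguments of this copy of [K] so that the order structure declared on it can
    refer to them. *)
Definition orderedField of preordering M & (forall x, M x \/ M (- x)) : Type := K.
HB.instance Definition _ := GRing.Field.copy (orderedField hM totM) K.
HB.instance Definition _ := @Num.IntegralDomain_isLeReal.Build (orderedField hM totM) le lt norm
  ordK_add ordK_mul anti ordK_sub ordK_tot ordK_normN ordK_norm ordK_lt.

Lemma orderedField_ge0 (x : K) : M x -> 0 <= (x : orderedField hM totM).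
Proof. by move=> Mx; apply/le0P. Qed.
End Structure.

(* The order is carried by a new type, with [psi] the identity. *)
Lemma ordering_exists T : preordering T ->
  exists (L : realFieldType) (psi : {rmorphism K -> L}), forall x, T x -> 0 <= psi x.
Proof.
move=> /preordering_maximal[M [hM TM totM]].
exists (orderedField hM totM), (idfun : {rmorphism K -> orderedField hM totM}).
by move=> x /TM Mx; apply: orderedField_ge0.
Qed.
End Ordering.

(** * Roots of sign-changing polynomials over an ordered field *)

Section RootAdjunction.
Variable L : realFieldType.
Implicit Types (G : {poly L}) (s : seq (L * {poly L})).

(** Weights are kept because a non-negative element of [L] need not be a square, and it has to stay
    non-negative in the extension. *)
Definition wsq s := \sum_(u <- s) u.1 *: u.2 ^+ 2.

Lemma wsq_horner_ge0 s x : all (fun u => 0 <= u.1) s -> 0 <= (wsq s).[x].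
Proof.
move=> /allP s0; rewrite /wsq horner_sum big_seq sumr_ge0 // => u us.
by rewrite hornerZ mulr_ge0 ?s0 // horner_exp sqr_ge0.
Qed.

Lemma size_wsq s k : all (fun u : L * {poly L} => (size u.2 <= k.+1)%N) s -> (size (wsq s) <= k.*2.+1)%N.
Proof.
move=> /allP sk; rewrite /wsq big_seq.
apply: (big_ind (fun p : {poly L} => size p <= k.*2.+1)%N) => [|p q hp hq|u us]; first by rewrite size_poly0.
  by apply: leq_trans (size_polyD _ _) _; rewrite geq_max hp.
apply: leq_trans (size_scale_leq _ _) _; apply: leq_trans (size_polyMleq _ _) _.
by have := sk u us; rewrite /=; lia.
Qed.

(* Reducing the squares modulo [G], the quotient of [1 + wsq s] by [G] changes
   sign as well and has smaller degree. *)
Lemma sign_change_not_dvd G s a b : G.[a] * G.[b] < 0 ->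
  all (fun u => 0 <= u.1) s -> ~~ (G %| 1 + wsq s).
Proof.
have [n] := ubnP (size G); elim: n => // n IHn in G s * => lGn Gab s0.
apply/negP => Gs.
have G0 : G != 0 by apply: contraTneq Gab => ->; rewrite !horner0 mul0r ltxx.
pose s' := [seq (u.1, u.2 %% G) | u <- s].
have s'0 : all (fun u => 0 <= u.1) s' by rewrite all_map.
have : G %| 1 + wsq s'.
  have -> : 1 + wsq s' = 1 + wsq s + (wsq s' - wsq s) by ring.
  rewrite dvdp_add // /wsq big_map -sumrB; apply: (big_ind (fun p => G %| p)) => [|p q|u _]; first exact: dvdp0.
    exact: dvdp_add.
  rewrite /= -scalerBr -mul_polyC dvdp_mull // subr_sqr dvdp_mulr //.
  by rewrite {2}[u.2](divp_eq _ G) opprD addrCA subrr addr0 dvdpNr dvdp_mull.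
case/dvdpP => h eh.
have Gsz : (1 < size G)%N.
  rewrite ltnNge; apply/negP => /size1_polyC eG.
  by move: Gab; rewrite eG !hornerC -expr2 ltNge sqr_ge0.
have pos x : 0 < h.[x] * G.[x].
  by rewrite -hornerM -eh hornerD hornerC ltr_pwDl // wsq_horner_ge0.
have hab : h.[a] * h.[b] < 0.
  have : 0 < (h.[a] * h.[b]) * (G.[a] * G.[b]) by rewrite mulrACA mulr_gt0 ?pos.
  by rewrite nmulr_lgt0.
have h0 : h != 0 by apply: contraTneq hab => ->; rewrite !horner0 mul0r ltxx.
have szs : all (fun u : L * {poly L} => (size u.2 <= (size G).-2.+1)%N) s'.
  rewrite all_map; apply/allP => u _ /=.
  have lt : (size (u.2 %% G)%R < size G)%N by rewrite ltn_modp.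
  by case: (size G) Gsz lt => [|[|k]].
have szh : (size h < n)%N.
  have := size_wsq szs; have := size_polyD 1 (wsq s').
  rewrite eh size_mul // size_poly1; move: lGn Gsz.
  move: (size h) (size G) (size (wsq s')) => x y w; clear; lia.
by have /negP := IHn h s' szh hab s'0; apply; rewrite eh dvdp_mulr.
Qed.

(** If [G = u * q], the product of the values at [a] and [b] factors accordingly, so [u] or [q]
    changes sign as well. *)
Lemma sign_change_irreducible_factor G a b : G.[a] * G.[b] < 0 ->
  exists G1, [/\ irreducible_poly G1, G1 %| G & G1.[a] * G1.[b] < 0].
Proof.
have [n] := ubnP (size G); elim: n => // n IHn in G * => lGn Gab.
have G0 : G != 0 by apply: contraTneq Gab => ->; rewrite !horner0 mul0r ltxx.
have Gsz : (1 < size G)%N.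
  rewrite ltnNge; apply/negP => /size1_polyC eG.
  by move: Gab; rewrite eG !hornerC -expr2 ltNge sqr_ge0.
case: (pselect (irreducible_poly G)) => [irr|nirr]; first by exists G; split.
have [q [q1 qG nqG]] : exists q : {poly L}, [/\ size q != 1%N, q %| G & ~~ (q %= G)].
  apply: contrapT => nex; apply: nirr; split=> // q q1 qG.
  by apply: contrapT => /negP nq; apply: nex; exists q.
case/dvdpP: qG => u eG.
have [u0 q0] : u != 0 /\ q != 0 by apply/andP; rewrite -negb_or -mulf_eq0 -eG.
have szG : size G = (size u + size q).-1 by rewrite eG size_mul.
have usz : (1 < size u)%N.
  rewrite ltnNge; apply: contra nqG => /size1_polyC eu; rewrite eG eu mul_polyC.
  by rewrite eqp_sym eqp_scale // -polyC_eq0 -eu.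
have qsz : (1 < size q)%N by move: q1 q0; rewrite -size_poly_eq0; case: (size q) => [|[]].
case: (ltrP (u.[a] * u.[b]) 0) => [uab|uab].
  have [|G1 [? dv ?]] := IHn u _ uab.
    by move: szG lGn usz qsz; move: (size u) (size q) (size G) => x y w; clear; lia.
  by exists G1; split=> //; rewrite eG dvdp_mulr.
have qab : q.[a] * q.[b] < 0.
  rewrite ltNge; apply/negP => qab; move: Gab.
  by rewrite eG !hornerM mulrACA ltNge mulr_ge0.
have [|G1 [? dv ?]] := IHn q _ qab.
  by move: szG lGn usz qsz; move: (size u) (size q) (size G) => x y w; clear; lia.
by exists G1; split=> //; rewrite eG dvdp_mull.
Qed.

Inductive wcone (E : algType L) : E -> Prop :=
| wcone_sq p a : 0 <= p -> wcone (p *: a ^+ 2)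
| wcone_add x y : wcone x -> wcone y -> wcone (x + y).

(** Artin's extension argument: were -1 a weighted sum of squares in the field [E] generated by a
    root of the irreducible factor [G1], then [G1] would divide some [1 + wsq s]. So the order
    extends to [E]. *)
Lemma sign_change_root G a b : G.[a] * G.[b] < 0 ->
  exists (L' : realFieldType) (psi : {rmorphism L -> L'}) (tau : L'),
    (forall x, 0 <= x -> 0 <= psi x) /\ root (map_poly psi G) tau.
Proof.
move=> /sign_change_irreducible_factor[G1 [irr dG G1ab]].
have [E _ [z rz genz]] := irredp_FAdjoin irr.
have repr (x : E) : exists q : {poly L}, x = (map_poly (in_alg E) q).[z].
  have : x \in <<1; z>>%VS by rewrite genz memvf.
  move/Fadjoin_poly_eq => <-.
  by have /polyOver1P[q ->] := Fadjoin_polyOver 1%AS z x; exists q.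
have wrepr (x : E) : wcone x -> exists2 s, all (fun u => 0 <= u.1) s &
    x = (map_poly (in_alg E) (wsq s)).[z].
  elim=> {x} [p x p0|x y _ [s s0 ->] _ [s' s'0 ->]].
    have [q ->] := repr x; exists [:: (p, q)]; first by rewrite /= p0.
    by rewrite /wsq big_seq1 map_polyZ hornerZ rmorphXn horner_exp /= mulr_algl.
  exists (s ++ s'); first by rewrite all_cat s0.
  by rewrite /wsq big_cat /= rmorphD hornerD.
have pre : preordering (@wcone E).
  split.
  - by move=> x y; exact: wcone_add.
  - move=> x y hx hy; elim: hx => {x} [p x p0|x x' _ IH _ IH']; last first.
      by rewrite mulrDl; exact: wcone_add.
    elim: hy => {y} [q y q0|y y' _ IH _ IH']; last by rewrite mulrDr; exact: wcone_add.
    by rewrite -scalerAl -scalerAr scalerA -exprMn; apply: wcone_sq; rewrite mulr_ge0.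
  - by move=> x; rewrite -[x ^+ 2]scale1r; apply: wcone_sq; rewrite ler01.
  - move=> /wrepr[s s0 es].
    have /negP := sign_change_not_dvd G1ab s0; apply.
    have r : root (map_poly (in_alg E) (1 + wsq s)) z.
      by rewrite /root rmorphD /= rmorph1 hornerD hornerC -es subrr.
    case: irr => G1sz irr.
    (* In the coprime case the Bezout identity evaluates to [0 = 1] at the common root [z]. *)
    have [/Bezout_eq1_coprimepP[[u v] /= uv]|nc] := boolP (coprimep G1 (1 + wsq s)).
      have := congr1 (fun p => (map_poly (in_alg E) p).[z]) uv.
      rewrite rmorphD !rmorphM rmorph1 /= hornerD !hornerM hornerC.
      by rewrite (rootP rz) (rootP r) !mulr0 addr0 => /eqP; rewrite eq_sym oner_eq0.
    have := irr _ nc (dvdp_gcdl _ _) => e.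
    by rewrite -(eqp_dvdl _ e) dvdp_gcdr.
have [L' [psi psi0]] := ordering_exists pre.
exists L', (psi \o in_alg E : {rmorphism L -> L'}), (psi z); split=> [x x0|].
  by rewrite /= psi0 // -[1](expr1n _ 2); apply: wcone_sq.
rewrite map_poly_comp fmorph_root; case/dvdpP: dG => q ->.
by rewrite rmorphM rootM rz orbT.
Qed.

Lemma radical_extension (t : L) e : 0 < t -> (0 < e)%N ->
  exists (L' : realFieldType) (psi : {rmorphism L -> L'}) (tau : L'),
    [/\ forall x, 0 <= x -> 0 <= psi x, 0 < tau & tau ^+ e = psi t].
Proof.
move=> t0 e0; have ab : ('X^e - t%:P).[0] * ('X^e - t%:P).[t + 1] < 0.
  rewrite !hornerE expr0n gtn_eqF // sub0r nmulr_rlt0 ?oppr_lt0 // subr_gt0.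
  apply: (@lt_le_trans _ _ (t + 1)); first by rewrite ltrDl ltr01.
  by apply: ler_eXnr => //; rewrite lerDr ltW.
have [L' [psi [tau [psi0 r]]]] := sign_change_root ab.
have et : tau ^+ e = psi t.
  apply/eqP; rewrite -subr_eq0; move: r.
  by rewrite /root rmorphB /= map_polyXn map_polyC !hornerE.
have pt : 0 < psi t by rewrite lt_neqAle psi0 ?ltW // andbT eq_sym fmorph_eq0 gt_eqF.
(* The root found may be negative; as [psi t > 0], its absolute value is a root too. *)
exists L', psi, `|tau|; split=> //; last by rewrite -normrX et gtr0_norm.
rewrite normr_gt0; apply: contraTneq pt => tau0.
by rewrite -et tau0 expr0n gtn_eqF // ltxx.
Qed.
End RootAdjunction.

(** * Infinitesimals and standard parts *)

Section Evaluation.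
Variables (B A : comNzRingType) (i : {rmorphism B -> A}).

(** Bundled as a ring morphism, so that two evaluations agree as soon as they agree on constants and
    on ['X]. *)
Definition hm (x : A) : {rmorphism {poly B} -> A} :=
  horner_morph (fun b => mulrC x (i b) : GRing.comm x (i b)).

Lemma hmC x b : hm x b%:P = i b. Proof. exact: horner_morphC. Qed.
Lemma hmX x : hm x 'X = x. Proof. exact: horner_morphX. Qed.
Lemma hmXn x n : hm x 'X^n = x ^+ n. Proof. by rewrite rmorphXn /= hmX. Qed.
Lemma hmE x p : hm x p = (map_poly i p).[x]. Proof. by []. Qed.
Lemma hm_sum x (p : {poly B}) n : (size p <= n)%N -> hm x p = \sum_(j < n) i p`_j * x ^+ j.
Proof.
move=> pn; rewrite hmE (@horner_coef_wide _ n); last exact: leq_trans (size_poly _ _) pn.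
by apply: eq_bigr => j _; rewrite coef_map.
Qed.
End Evaluation.

Lemma rmorph_poly_ext (B A : comNzRingType) (f g : {rmorphism {poly B} -> A}) :
  (forall b, f b%:P = g b%:P) -> f 'X = g 'X -> f =1 g.
Proof.
move=> fg fgX p; elim/poly_ind: p => [|p b IHp]; first by rewrite !rmorph0.
by rewrite !rmorphD !rmorphM /= IHp fgX fg.
Qed.

Lemma hm_comp (B A A' : comNzRingType) (i : {rmorphism B -> A}) (i' : {rmorphism B -> A'})
    (f : {rmorphism A -> A'}) x p : (forall b, f (i b) = i' b) ->
  f (hm i x p) = hm i' (f x) p.
Proof.
move=> fi; apply: (rmorph_poly_ext (f := f \o hm i x) (g := hm i' (f x))) => [b|].
  by rewrite /= -!/(hm _ _ _) !hmC.
by rewrite /= -!/(hm _ _ _) !hmX.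
Qed.

Section Evaluation2.
Variables (R A : comNzRingType) (i : {rmorphism R -> A}).
(** [{poly {poly R}}] is read as [R[x][y]]: the inner variable goes to [x], the outer one to [y].
    The target [A] is left free, so that one polynomial can be evaluated at reals, at elements of an
    ordered field and at formal variables. *)
Definition ev2 (x y : A) : {rmorphism {poly {poly R}} -> A} := hm (hm i x) y.
Lemma ev2C x y c : ev2 x y c%:P = hm i x c. Proof. exact: hmC. Qed.
Lemma ev2X x y : ev2 x y 'X = y. Proof. exact: hmX. Qed.
End Evaluation2.

Lemma ev2_comp (R A A' : comNzRingType) (i : {rmorphism R -> A}) (i' : {rmorphism R -> A'})
    (f : {rmorphism A -> A'}) x y G : (forall b, f (i b) = i' b) ->
  f (ev2 i x y G) = ev2 i' (f x) (f y) G.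
Proof. by move=> fi; apply: hm_comp => c; apply: hm_comp. Qed.

Lemma ev2_idfun (R : comNzRingType) (x y : R) G : ev2 idfun x y G = G.[y%:P].[x].
Proof.
rewrite -[RHS]/(horner_eval x (horner_eval y%:P G)).
apply: (rmorph_poly_ext (f := ev2 idfun x y) (g := horner_eval x \o horner_eval y%:P)) => [c|].
  rewrite ev2C /= /horner_eval hornerC.
  by rewrite hmE map_poly_id.
by rewrite ev2X /= /horner_eval hornerX hornerC.
Qed.

Section StandardPart.
Variables (R : realType) (L : realFieldType) (i : {rmorphism R -> L}).

(** Non-negative reals are squares, so any ring morphism from the reals to an ordered field is
    monotone. *)
Lemma emb_ge0 r : 0 <= r -> 0 <= i r.
Proof. by move=> r0; rewrite -[r]sqr_sqrtr // rmorphXn /= sqr_ge0. Qed.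
Lemma emb_gt0 r : 0 < r -> 0 < i r.
Proof. by move=> r0; rewrite lt_neqAle emb_ge0 ?ltW // andbT eq_sym fmorph_eq0 gt_eqF. Qed.
Lemma emb_lt r s : r < s -> i r < i s.
Proof. by move=> rs; rewrite -subr_gt0 -rmorphB emb_gt0 // subr_gt0. Qed.
Lemma emb_norm r : `|i r| = i `|r|.
Proof.
case: (ger0P r) => r0; first by rewrite ger0_norm ?emb_ge0.
by rewrite -normrN -rmorphN ger0_norm // emb_ge0 // oppr_ge0 ltW.
Qed.

Definition finite_elt (z : L) := exists r, `|z| <= i r.
Definition infinitesimal (z : L) := forall r, 0 < r -> `|z| < i r.

Lemma fin_emb r : finite_elt (i r).
Proof. by exists `|r|; rewrite emb_norm. Qed.
Lemma fin_add a b : finite_elt a -> finite_elt b -> finite_elt (a + b).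
Proof.
move=> [r ra] [s sb]; exists (r + s); rewrite rmorphD /=.
by apply: le_trans (ler_normD _ _) _; apply: lerD.
Qed.
Lemma fin_mul a b : finite_elt a -> finite_elt b -> finite_elt (a * b).
Proof. by move=> [r ra] [s sb]; exists (r * s); rewrite rmorphM /= normrM ler_pM. Qed.
Lemma fin_exp a n : finite_elt a -> finite_elt (a ^+ n).
Proof.
move=> fa; elim: n => [|n IHn]; first by rewrite expr0 -(rmorph1 i); apply: fin_emb.
by rewrite exprS; apply: fin_mul.
Qed.
Lemma inf_fin a : infinitesimal a -> finite_elt a.
Proof. by move=> ia; exists 1; rewrite ltW // ia. Qed.
Lemma inf0 : infinitesimal 0.
Proof. by move=> r r0; rewrite normr0 emb_gt0. Qed.
Lemma inf_add a b : infinitesimal a -> infinitesimal b -> infinitesimal (a + b).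
Proof.
move=> ia ib r r0; have r2 : 0 < r / 2 by rewrite divr_gt0.
rewrite [r]splitr rmorphD /=; apply: le_lt_trans (ler_normD _ _) _.
by apply: ltrD; [apply: ia|apply: ib].
Qed.
Lemma inf_mul a b : infinitesimal a -> finite_elt b -> infinitesimal (a * b).
Proof.
move=> ia [s sb] r r0; have s0 : 0 < `|s| + 1 by rewrite ltr_wpDl.
have sb' : `|b| < i (`|s| + 1).
  apply: le_lt_trans sb _; apply: emb_lt; apply: le_lt_trans (ler_norm _) _.
  by rewrite ltrDl.
rewrite normrM -[r](mulfVK (lt0r_neq0 s0)) rmorphM /=.
by apply: ltr_pM => //; apply: ia; rewrite divr_gt0.
Qed.
Lemma inf_opp a : infinitesimal a -> infinitesimal (- a).
Proof. by move=> ia r r0; rewrite normrN ia. Qed.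
Lemma inf_exp a n : (0 < n)%N -> infinitesimal a -> infinitesimal (a ^+ n).
Proof. by case: n => // n _ ia; rewrite exprS; apply: inf_mul => //; apply: fin_exp; apply: inf_fin. Qed.
Lemma inf_root a n : (0 < n)%N -> infinitesimal (a ^+ n) -> infinitesimal a.
Proof.
move=> n0 ia r r0; rewrite ltNge; apply/negP => ra.
have := ia (r ^+ n) (exprn_gt0 _ r0); rewrite rmorphXn /= normrX ltNge => /negP; apply.
by apply: lerXn2r => //; rewrite nnegrE ?emb_ge0 // ltW.
Qed.
Lemma inf_hm t c : infinitesimal t -> infinitesimal (hm i t c - i c.[0]).
Proof.
move=> it; suff [] : finite_elt (hm i t c) /\ infinitesimal (hm i t c - i c.[0]) by [].
elim/poly_ind: c => [|c a [fc _]].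
  by rewrite rmorph0 horner0 rmorph0 subrr; split; [rewrite -(rmorph0 i); exact: fin_emb|exact: inf0].
have ict : infinitesimal (hm i t c * t) by rewrite mulrC; exact: inf_mul.
rewrite rmorphD rmorphM /= hmC hmX hornerD hornerM hornerX hornerC mulr0 add0r addrK; split=> //.
by apply: fin_add; [exact: inf_fin|exact: fin_emb].
Qed.
Lemma near_fin z r : infinitesimal (z - i r) -> finite_elt z.
Proof. by move=> h; rewrite -[z](subrK (i r)); apply: fin_add; [exact: inf_fin|exact: fin_emb]. Qed.
Lemma fin_hm t c : infinitesimal t -> finite_elt (hm i t c).
Proof. by move=> /inf_hm /near_fin. Qed.
Lemma near_gt0 z r : infinitesimal (z - i r) -> 0 < r -> 0 < z.
Proof.
move=> h r0; have := h r r0; rewrite ltr_norml => /andP[+ _].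
by rewrite ltrBrDl subrr.
Qed.

(** The completeness of the reals enters here: [c] is the supremum of the reals below [z]. *)
Lemma standard_part z : finite_elt z -> exists c, infinitesimal (z - i c).
Proof.
move=> [r zr]; pose E : set R := [set s | i s <= z]%classic.
have hsE : has_sup E.
  split; first by exists (- r); rewrite /E /= rmorphN /= lerNl; apply: le_trans zr; rewrite -normrN ler_norm.
  exists r => s /= sz; rewrite leNgt; apply/negP => /emb_lt; apply/negP; rewrite -leNgt.
  by apply: le_trans sz _; apply: le_trans zr; exact: ler_norm.
exists (sup E) => e e0; rewrite ltr_norml; apply/andP; split.
  have [s Es es] := sup_adherent e0 hsE.
  rewrite ltrBrDr addrC -rmorphN -rmorphD /=; apply: lt_le_trans Es; exact: emb_lt.
rewrite ltrBlDr -rmorphD /= ltNge; apply/negP => h.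
have : E (e + sup E) by [].
by move/(ub_le_sup (proj2 hsE)); rewrite leNgt ltrDr e0.
Qed.
End StandardPart.

(** * The Newton-Puiseux algorithm along an ordering *)

Section NewtonStep.
Variable R : fieldType.
Variables (e p m : nat) (G : {poly {poly R}}) (h : nat -> {poly R}).
Hypothesis hE : forall j, (j < m)%N -> G`_j \Po 'X^e = 'X^(p * (m - j)) * h j.

(** Coefficients of [x^(- p m) G(x^e, x^p y)]. By [hE] each point [(j, ord G_j)] with [j < m] lies
    on or above the line of slope [- p / e] through [(m, 0)], which makes the division exact; for
    [j >= m] it is automatic. *)
Definition newton_coef j : {poly R} :=
  if (j < m)%N then h j else (G`_j \Po 'X^e) * 'X^(p * (j - m)).
Definition newton_transform : {poly {poly R}} := \poly_(j < size G) newton_coef j.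
Local Notation G1 := newton_transform.

Lemma hm_comp_Xn (A : comNzRingType) (i : {rmorphism R -> A}) (x : A) c n :
  hm i x (c \Po 'X^n) = hm i (x ^+ n) c.
Proof.
apply: (rmorph_poly_ext (f := hm i x \o comp_poly 'X^n) (g := hm i (x ^+ n))) => [b|].
  by rewrite /= comp_polyC !hmC.
by rewrite /= comp_polyX hmXn hmX.
Qed.

Lemma newton_transformE (A : comNzRingType) (i : {rmorphism R -> A}) (x y : A) :
  ev2 i (x ^+ e) (x ^+ p * y) G = x ^+ (p * m) * ev2 i x y G1.
Proof.
rewrite /ev2 (hm_sum _ _ (leqnn (size G))) (hm_sum _ _ (size_poly _ _)) mulr_sumr.
apply: eq_bigr => j _; rewrite coef_poly ltn_ord -hm_comp_Xn /newton_coef.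
case: ltnP => jm.
  rewrite hE // rmorphM /= hmXn exprMn -exprM.
  have -> : (p * m = p * (m - j) + p * j)%N by rewrite -mulnDr subnK // ltnW.
  by rewrite exprD; ring.
rewrite rmorphM /= hmXn exprMn -exprM.
have -> : (p * j = p * m + p * (j - m))%N by rewrite -mulnDr subnKC.
by rewrite exprD; ring.
Qed.

Let polyCC : {rmorphism R -> {poly {poly R}}} := polyC \o polyC.
(** The substitution performed on formal polynomials, where it can be compared with the derivative
    in [y]. *)
Let S := ev2 polyCC ('X^e)%:P (('X^p)%:P * 'X).

Let hmCC (c : {poly R}) : hm polyCC 'X%:P c = c%:P.
Proof.
apply: (rmorph_poly_ext (f := hm polyCC 'X%:P) (g := polyC)) => [b|]; first by rewrite hmC.
by rewrite hmX.
Qed.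

Let S_E : S G = ('X^(p * m))%:P * G1.
Proof.
rewrite /S !polyC_exp newton_transformE; congr (_ * _).
apply: (rmorph_poly_ext (f := ev2 polyCC 'X%:P 'X) (g := idfun)) => [c|].
  by rewrite ev2C hmCC.
by rewrite ev2X.
Qed.

Let S_C c : S c%:P = (c \Po 'X^e)%:P.
Proof. by rewrite /S ev2C -[RHS]hmCC hm_comp_Xn polyC_exp. Qed.

Let S_deriv (P : {poly {poly R}}) : (S P)^`() = ('X^p)%:P * S P^`().
Proof.
elim/poly_ind: P => [|P c IHP]; first by rewrite deriv0 !rmorph0 deriv0 mulr0.
rewrite !rmorphD !rmorphM /= S_C derivD derivC addr0 derivM IHP derivMXaddC rmorphD rmorphM /=.
have -> : S 'X = ('X^p)%:P * 'X by rewrite /S ev2X.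
by rewrite derivM derivC derivX; ring.
Qed.

Lemma newton_transform_relation A B (c : {poly R}) : (0 < m)%N -> A * G + B * G^`() = c%:P ->
  exists A' B' c', A' * G1 + B' * G1^`() = c'%:P /\ c \Po 'X^e = 'X^(p * m.-1) * c'.
Proof.
move=> m0 /(congr1 S); rewrite rmorphD !rmorphM /= S_C S_E.
have SG' : S G^`() = ('X^(p * m.-1))%:P * G1^`().
  have : ('X^p)%:P * S G^`() = ('X^p)%:P * (('X^(p * m.-1))%:P * G1^`()).
    rewrite -S_deriv S_E derivM derivC mul0r add0r mulrA -rmorphM /= -exprD.
    by rewrite -mulnS prednK.
  by apply: mulfI; rewrite polyC_eq0 expf_neq0 // polyX_eq0.
rewrite SG' => E.
pose W := ('X^p)%:P * S A * G1 + S B * G1^`().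
have EW : ('X^(p * m.-1))%:P * W = (c \Po 'X^e)%:P.
  rewrite -E /W -[in RHS](prednK m0) mulnS exprD rmorphM /=.
  by ring.
(* [W] times a power of the inner variable is constant in [y], hence so is [W]. *)
have WC : W = (W`_0)%:P.
  apply/polyP => j; rewrite coefC; case: j => [|j] //=.
  have := congr1 (fun P : {poly {poly R}} => P`_j.+1) EW.
  rewrite coefCM coefC /= => /eqP; rewrite mulf_eq0 expf_eq0 polyX_eq0 andbF /=.
  by move/eqP.
exists (('X^p)%:P * S A), (S B), W`_0; split; first by rewrite -WC.
by apply: polyC_inj; rewrite -EW rmorphM /= -WC.
Qed.
End NewtonStep.

Section Translation.
Variable R : realFieldType.

Lemma ev2_translate (A : comNzRingType) (i : {rmorphism R -> A}) (x y : A) a (G : {poly {poly R}}) :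
  ev2 i x y (G \Po ('X + a%:P%:P)) = ev2 i x (y + i a) G.
Proof.
apply: (rmorph_poly_ext (f := ev2 i x y \o comp_poly ('X + a%:P%:P)) (g := ev2 i x (y + i a))) => [c|].
  by rewrite /= comp_polyC !ev2C.
by rewrite /= comp_polyX rmorphD /= ev2C hmC !ev2X.
Qed.

Lemma translate_relation a (A B G : {poly {poly R}}) (c : {poly R}) :
  A * G + B * G^`() = c%:P ->
  exists A' B', A' * (G \Po ('X + a%:P%:P)) + B' * (G \Po ('X + a%:P%:P))^`() = c%:P.
Proof.
move=> E; exists (A \Po ('X + a%:P%:P)), (B \Po ('X + a%:P%:P)).
by rewrite deriv_comp derivD derivX derivC addr0 mulr1 -!rmorphM -rmorphD /= E comp_polyC.
Qed.

Definition fiber0 : {rmorphism {poly {poly R}} -> {poly R}} := map_poly (horner_eval 0).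

Lemma coef_fiber0 G j : (fiber0 G)`_j = (G`_j).[0].
Proof. by rewrite coef_map. Qed.

Lemma fiber0_translate a G : fiber0 (G \Po ('X + a%:P%:P)) = fiber0 G \Po ('X + a%:P).
Proof.
by rewrite /fiber0 /= map_comp_poly rmorphD /= map_polyX map_polyC /= /horner_eval hornerC.
Qed.

Lemma order_at0 (b : {poly R}) : b != 0 -> exists m, (forall j, (j < m)%N -> b`_j = 0) /\ b`_m != 0.
Proof.
move=> b0; have ex : exists m, b`_m != 0 by exists (size b).-1; rewrite -lead_coefE lead_coef_eq0.
exists (ex_minn ex); case: ex_minnP => m bm min; split=> // j jm.
by apply/eqP; apply: contraTT jm => /min; rewrite -leqNgt.
Qed.

(** In characteristic zero this coefficient vanishes only for [a = 0]. *)
Lemma coef_XsubC_exp (a : R) m : ((('X - a%:P) ^+ m.+1)`_m) = - (a *+ m.+1).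
Proof.
elim: m => [|m IHm]; first by rewrite expr1 coefB coefX coefC sub0r mulr1n.
rewrite exprSr mulrBr coefB coefMX coefMC /= IHm.
have -> : (('X - a%:P) ^+ m.+1)`_m.+1 = 1.
  have := monicP (monicXsubC a); have := monic_exp m.+1 (monicXsubC a).
  by rewrite monicE /lead_coef size_exp_XsubC /= => /eqP.
by rewrite mul1r [in RHS]mulrS opprD addrC.
Qed.

(* Order of vanishing at [a] of a polynomial of degree [m]: it is [m] only for a
   multiple of ['(X - a)^m], which a missing term of degree [m - 1] excludes. *)
Lemma order_translate (b : {poly R}) a m : (size b <= m.+1)%N -> b`_m != 0 ->
  exists m', [/\ (m' <= m)%N, forall j, (j < m')%N -> (b \Po ('X + a%:P))`_j = 0,
    (b \Po ('X + a%:P))`_m' != 0 &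
    forall j, (j < m)%N -> b`_j != 0 -> b`_m.-1 = 0 -> (m' < m)%N].
Proof.
move=> sb bm.
have szb : size b = m.+1.
  apply/eqP; rewrite eqn_leq sb ltnNge; apply/negP => lt.
  by rewrite nth_default ?eqxx in bm.
have szc : size (b \Po ('X + a%:P)) = m.+1 by rewrite -[a]opprK polyCN size_comp_poly2 ?size_XsubC.
set b' := b \Po _ in szc *.
have b'm : b'`_m != 0.
  by rewrite -[m]/(m.+1.-1) -szc -lead_coefE lead_coef_eq0 -size_poly_eq0 szc.
have [m' [m'0 b'm']] : exists m, (forall j, (j < m)%N -> b'`_j = 0) /\ b'`_m != 0.
  by apply: order_at0; rewrite -size_poly_eq0 szc.
have m'm : (m' <= m)%N by rewrite leqNgt; apply: contra b'm => /m'0 ->.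
exists m'; split=> // j jm bj bm1; rewrite ltn_neqAle m'm andbT; apply: contra bj => /eqP em.
have eb' : b' = b'`_m *: 'X^m.
  apply/polyP => k; rewrite coefZ coefXn; case: ltngtP => km.
  - by rewrite m'0 ?em // mulr0.
  - by rewrite nth_default ?szc // mulr0.
  - by rewrite km mulr1.
have eb : b = b'`_m *: ('X - a%:P) ^+ m.
  have -> : b = b' \Po ('X - a%:P) by rewrite /b' -comp_polyA comp_polyD comp_polyX comp_polyC subrK comp_polyXr.
  by rewrite {1}eb' comp_polyZ rmorphXn /= comp_polyX.
have a0 : a = 0.
  move: bm1; rewrite eb; case: (m) jm b'm => // n _ b'm /=.
  rewrite coefZ coef_XsubC_exp -mulr_natr => /eqP.
  by rewrite mulf_eq0 (negPf b'm) oppr_eq0 mulf_eq0 pnatr_eq0 orbF => /eqP.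
by rewrite eb a0 subr0 coefZ coefXn ltn_eqF // mulr0.
Qed.
End Translation.
Arguments fiber0 {R}.

Section RealPoints.
Variable R : realType.
Implicit Types G : {poly {poly R}}.

(** The condition [0 < t0] is preserved by [(x, y) -> (x^e, x^p y)] and makes the factor [x^(p m)]
    positive, so a negative point of a transform yields one of [G]. *)
Definition negative_point G := exists t0 y0 : R, 0 < t0 /\ ev2 idfun t0 y0 G < 0.

Lemma poly_neg_right (p : {poly R}) x : p.[x] < 0 ->
  exists2 d, 0 < d & forall y, `|y - x| < d -> p.[y] < 0.
Proof.
move=> px; have [|d d0 hd] := @poly_cont _ x p (- p.[x]); first by rewrite oppr_gt0.
by exists d => // y /hd; rewrite ltr_norml => /andP[_]; rewrite ltrBlDr addNr.
Qed.

Lemma fiber0_neg G y : (fiber0 G).[y] < 0 -> negative_point G.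
Proof.
move=> Gy; have Gy' : (G.[y%:P]).[0] < 0.
  by move: Gy; rewrite /fiber0 /= -[(G.[y%:P]).[0]]/(horner_eval 0 G.[y%:P]) -horner_map /= /horner_eval hornerC.
have [d d0 hd] := poly_neg_right Gy'; exists (d / 2), y.
have d2 : 0 < d / 2 by rewrite divr_gt0.
by split=> //; rewrite ev2_idfun; apply: hd; rewrite subr0 gtr0_norm // ltr_pdivrMr // ltr_pMr // ltr1n.
Qed.

Lemma order_ge0 (b : {poly R}) m : (forall y, 0 <= b.[y]) -> (forall j, (j < m)%N -> b`_j = 0) ->
  b`_m != 0 -> 0 < b`_m /\ ~~ odd m.
Proof.
move=> b0 bj bm; pose c := \poly_(j < size b - m) b`_(j + m).
have eb : b = c * 'X^m.
  apply/polyP => j; rewrite coefMXn; case: ltnP => jm; first by rewrite bj.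
  rewrite coef_poly subnK //; case: ltnP => // h.
  by rewrite nth_default //; move: h; rewrite leq_subLR subnKC.
have c0 : c.[0] = b`_m.
  rewrite horner_coef0 coef_poly add0n subn_gt0; case: ltnP => // h.
  by move: bm; rewrite nth_default ?eqxx.
have key s : (s = 1 \/ s = -1) -> 0 <= b`_m * s ^+ m.
  move=> hs; rewrite leNgt; apply/negP => lt.
  have : (c * (s ^+ m)%:P).[0] < 0 by rewrite hornerM hornerC c0.
  move=> /poly_neg_right[d d0 hd].
  have d2 : 0 < d / 2 by rewrite divr_gt0.
  have := b0 (s * (d / 2)); rewrite eb hornerM hornerXn exprMn mulrA leNgt pmulr_llt0 ?exprn_gt0 //.
  have /hd : `|s * (d / 2) - 0| < d.
    have -> : `|s * (d / 2) - 0| = d / 2.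
      by rewrite subr0 normrM (gtr0_norm d2); case: hs => ->; rewrite ?normrN normr1 mul1r.
    by rewrite ltr_pdivrMr // ltr_pMr // ltr1n.
  by rewrite hornerM hornerC => ->.
have h1 : 0 <= b`_m by have := key 1 (or_introl erefl); rewrite expr1n mulr1.
split; first by rewrite lt_neqAle eq_sym bm.
apply/negP => om; have := key (-1) (or_intror erefl).
by rewrite -signr_odd om expr1 mulrN1 oppr_ge0 => h; move/eqP: bm; apply; apply: le_anti; rewrite h h1.
Qed.

Lemma valuation0 (c : {poly R}) : c != 0 -> exists v u, c = u * 'X^v /\ u.[0] != 0.
Proof.
move=> c0; have [v [u ru e]] := multiplicity_XsubC c 0.
by exists v, u; move: ru e; rewrite c0 subr0.
Qed.

Section Extension.
Variables (L L' : realFieldType) (i : {rmorphism R -> L}) (psi : {rmorphism L -> L'}).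
Hypothesis psi0 : forall x, 0 <= x -> 0 <= psi x.

Lemma ext_lt0 x : x < 0 -> psi x < 0.
Proof.
move=> x0; have := psi0 (x := - x); rewrite oppr_ge0 (ltW x0) => /(_ isT).
by rewrite rmorphN oppr_ge0 le_eqVlt fmorph_eq0 lt_eqF.
Qed.

Lemma ext_infinitesimal x : infinitesimal i x -> infinitesimal (psi \o i : {rmorphism R -> L'}) (psi x).
Proof.
move=> ix r r0.
have -> : `|psi x| = psi `|x|.
  case: (ger0P x) => x0; first by rewrite ger0_norm // psi0.
  by rewrite -normrN -rmorphN ger0_norm // psi0 // oppr_ge0 ltW.
by rewrite -subr_lt0 /= -rmorphB ext_lt0 // subr_lt0 ix.
Qed.
End Extension.

(** After division by [y^m] every term but the [m]-th is infinitesimal: those with [j < m] contain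
    [tau^p / y], those with [j > m] contain [y] or do not exist. The sign is then that of the
    coefficient of index [m], because [m] is even. *)
Lemma newton_dominant (L : realFieldType) (i : {rmorphism R -> L}) e p m G h (tau y : L) :
  (forall j, (j < m)%N -> G`_j \Po 'X^e = 'X^(p * (m - j)) * h j) -> (0 < e)%N ->
  infinitesimal i tau -> infinitesimal i y \/ (size G <= m.+1)%N -> 0 < tau -> y != 0 ->
  infinitesimal i (tau ^+ p / y) -> 0 < (G`_m).[0] -> ~~ odd m ->
  0 < ev2 i (tau ^+ e) y G.
Proof.
move=> hE e0 itau iy tau0 y0 iz gm om.
have mG : (m < size G)%N.
  by rewrite ltnNge; apply: contraTN gm => mG; rewrite nth_default // horner0 ltxx.
pose z := tau ^+ p / y.
pose T j := if (j < m)%N then hm i tau (h j) * z ^+ (m - j)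
  else hm i (tau ^+ e) G`_j * y ^+ (j - m).
have -> : ev2 i (tau ^+ e) y G = y ^+ m * \sum_(j < size G) T j.
  rewrite /ev2 (hm_sum _ _ (leqnn (size G))) mulr_sumr; apply: eq_bigr => j _.
  rewrite /T; case: ltnP => jm.
    rewrite -hm_comp_Xn hE // rmorphM /= hmXn exprM -[in LHS](mulfVK y0 (tau ^+ p)) exprMn -/z.
    have -> : y ^+ m = y ^+ j * y ^+ (m - j) by rewrite -exprD subnKC // ltnW.
    ring.
  have -> : y ^+ j = y ^+ m * y ^+ (j - m) by rewrite -exprD subnKC.
  ring.
rewrite pmulr_rgt0; last by rewrite lt_neqAle eq_sym expf_eq0 (negPf y0) andbF exprn_even_ge0.
apply: near_gt0 gm; rewrite (bigD1 (Ordinal mG)) //= /T ltnn subnn expr0 mulr1 addrAC.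
apply: inf_add; first by apply: inf_hm; apply: inf_exp.
apply: big_ind => [|a b ia ib|j jm]; [exact: inf0|exact: inf_add|].
have {}jm : j != m :> nat by apply: contraNneq jm => em; apply/eqP/val_inj.
case: ltnP => lt; rewrite mulrC; apply: inf_mul; try exact: fin_hm; try by apply: fin_hm; apply: inf_exp.
  by apply: inf_exp => //; rewrite subn_gt0.
have mj : (m < j)%N by rewrite ltn_neqAle eq_sym jm.
case: iy => [iy|sG]; first by apply: inf_exp => //; rewrite subn_gt0.
by have := leq_trans (ltn_ord j) sG; rewrite ltnS leqNgt mj.
Qed.

Lemma neg_nonroot (p q : {poly R}) x : p.[x] < 0 -> q != 0 ->
  exists x1, [/\ x < x1, p.[x1] < 0 & q.[x1] != 0].
Proof.
move=> /poly_neg_right[d d0 hd] q0.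
(* With [k.+2] in place of [k.+1] the distance to [x] stays strictly below [d] even for [k = 0]. *)
pose f (k : nat) := x + d / k.+2%:R.
have fd k : x < f k /\ `|f k - x| < d.
  have kd : 0 < d / k.+2%:R by rewrite divr_gt0.
  split; first by rewrite ltrDl.
  by rewrite /f [x + _]addrC addrK gtr0_norm // ltr_pdivrMr // ltr_pMr // ltr1n.
have inj : injective f.
  move=> k l /addrI /(mulfI (lt0r_neq0 d0)) /invr_inj /eqP.
  by rewrite eqr_nat => /eqP[].
have [k nk] : exists k, q.[f k] != 0.
  apply: contrapT => nex.
  have /(max_poly_roots q0) : all (root q) (map f (iota 0 (size q))).
    by apply/allP => _ /mapP[k _ ->]; apply/rootP/eqP; apply: contrapT => /negP h; apply: nex; exists k.
  by rewrite map_inj_uniq // iota_uniq => /(_ isT); rewrite size_map size_iota ltnn.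
by exists (f k); have [? ?] := fd k; split=> //; apply: hd.
Qed.

(** First [t0] is moved off the roots of the leading coefficient of [H], then [y0] off the roots of
    the resulting polynomial in [y]. The move to the right keeps a positive abscissa positive. *)
Lemma neg_nonroot2 G H t0 y0 : ev2 idfun t0 y0 G < 0 -> H != 0 ->
  exists t1 y1, [/\ t0 < t1, ev2 idfun t1 y1 G < 0 & ev2 idfun t1 y1 H != 0].
Proof.
rewrite ev2_idfun => Gt H0.
have lH : lead_coef H != 0 by rewrite lead_coef_eq0.
have [t1 [t01 Gt1 Ht1]] := neg_nonroot Gt lH.
have hor P y : (map_poly (horner_eval t1) P).[y] = ev2 idfun t1 y P.
  by rewrite ev2_idfun -[RHS]/(horner_eval t1 _) -horner_map /= /horner_eval hornerC.
have [||y1 [_ Gy1 Hy1]] := @neg_nonroot (map_poly (horner_eval t1) G) (map_poly (horner_eval t1) H) y0.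
- by rewrite hor ev2_idfun.
- apply: contraNneq Ht1 => /(congr1 (fun p : {poly R} => p`_(size H).-1)).
  by rewrite coef_map coef0 /= /horner_eval lead_coefE => ->.
by exists t1, y1; rewrite -!hor.
Qed.
End RealPoints.

Section NewtonPuiseux.
Variable R : realType.
Implicit Types G A B : {poly {poly R}}.

Lemma inf_ev2 (L : realFieldType) (i : {rmorphism R -> L}) t y G :
  infinitesimal i t -> infinitesimal i y -> infinitesimal i (ev2 i t y G - i (G`_0).[0]).
Proof.
move=> it iy; suff [] : finite_elt i (ev2 i t y G) /\ infinitesimal i (ev2 i t y G - i (G`_0).[0]) by [].
elim/poly_ind: G => [|G c [fG _]].
  rewrite rmorph0 coef0 horner0 rmorph0 subrr.
  by split; [rewrite -(rmorph0 i); exact: fin_emb|exact: inf0].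
have iG : infinitesimal i (ev2 i t y G * y) by rewrite mulrC; exact: inf_mul.
rewrite rmorphD rmorphM /= ev2C ev2X coefD coefMX coefC add0r -addrA; split.
  by apply: fin_add; [exact: inf_fin|exact: fin_hm].
by apply: inf_add => //; exact: inf_hm.
Qed.

Lemma not_fin_inv (L : realFieldType) (i : {rmorphism R -> L}) z :
  ~ finite_elt i z -> z != 0 /\ infinitesimal i z^-1.
Proof.
move=> nz; have z0 : z != 0.
  by apply/eqP => z0; apply: nz; exists 0; rewrite z0 normr0 rmorph0.
split=> // r r0; rewrite normfV invf_plt ?posrE ?normr_gt0 ?emb_gt0 //.
rewrite ltNge -fmorphV; apply/negP => h; apply: nz; by exists r^-1.
Qed.

Definition newton_puiseux_at m k := forall (L : realFieldType) (i : {rmorphism R -> L}) t y G A B c,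
  0 < t -> infinitesimal i t -> infinitesimal i y ->
  A * G + B * G^`() = c%:P -> ~~ ('X^k %| c) ->
  (forall j, (j < m)%N -> (G`_j).[0] = 0) -> (G`_m).[0] != 0 ->
  ev2 i t y G < 0 -> negative_point G.

(** One substitution along the line through [(m, 0)] and [(j0, v j0)], followed by a translation to
    the standard part of [y / tau^p]. The last hypothesis provides for the case where [m] does not
    decrease. *)
Lemma newton_puiseux_step m k (e p : nat) (v : nat -> nat) (u : nat -> {poly R}) j0 :
  (forall m', (m' < m)%N -> forall k', newton_puiseux_at m' k') ->
  newton_puiseux_at m k -> forall (L : realFieldType) (i : {rmorphism R -> L}) t y G A B c,
  0 < t -> infinitesimal i t -> infinitesimal i y ->
  A * G + B * G^`() = c%:P -> ~~ ('X^(k.+1) %| c) ->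
  0 < (G`_m).[0] -> ~~ odd m -> (1 < m)%N -> ev2 i t y G < 0 ->
  (0 < e)%N -> (0 < p)%N ->
  (forall j, G`_j != 0 -> G`_j = u j * 'X^(v j) /\ (u j).[0] != 0) ->
  (forall j, (j < m)%N -> G`_j != 0 -> (p * (m - j) <= v j * e)%N) ->
  (j0 < m)%N -> G`_j0 != 0 -> (p * (m - j0) = v j0 * e)%N ->
  (e = 1%N \/ (G`_m.-1 != 0 -> (p < v m.-1 * e)%N)) ->
  negative_point G.
Proof.
move=> IHm IHk L i t y G A B c t0 it iy rel ndv gm om m1 neg e0 p0 uv vj j0m Gj0 vj0 he.
pose h j := if G`_j == 0 then 0 else (u j \Po 'X^e) * 'X^(v j * e - p * (m - j)).
have hE j : (j < m)%N -> G`_j \Po 'X^e = 'X^(p * (m - j)) * h j.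
  move=> jm; rewrite /h; case: eqP => [->|/eqP Gj]; first by rewrite comp_poly0 mulr0.
  rewrite {1}(proj1 (uv j Gj)) comp_polyM comp_Xn_poly -exprM mulrCA -exprD subnKC ?vj //.
  by rewrite mulnC.
have [L' [psi [tau [psi0 tau0 etau]]]] := radical_extension t0 e0.
pose i' : {rmorphism R -> L'} := psi \o i.
have itau : infinitesimal i' tau by apply: (@inf_root _ _ _ _ e) => //; rewrite etau; exact: ext_infinitesimal.
have iy' : infinitesimal i' (psi y) by exact: ext_infinitesimal.
have neg' : ev2 i' (tau ^+ e) (psi y) G < 0.
  by rewrite etau -(ev2_comp (i := i)) // ext_lt0.
have taup : 0 < tau ^+ p by rewrite exprn_gt0.
(* If the quotient were infinite, the term of index [m] would dominate and [G] would be positive at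
   the point. *)
have [fz|nfz] := pselect (finite_elt i' (psi y / tau ^+ p)); last first.
  have [z0 iz] := not_fin_inv nfz.
  have y0 : psi y != 0 by apply: contraNneq z0 => ->; rewrite mul0r.
  rewrite invfM invrK mulrC in iz.
  by have := newton_dominant hE e0 itau (or_introl iy') tau0 y0 iz gm om; rewrite ltNge ltW.
have [a ia] := standard_part fz.
set eta := _ - _ in ia.
pose G1 := newton_transform e p m G h; pose G2 := G1 \Po ('X + a%:P%:P).
have neg2 : ev2 i' tau eta G2 < 0.
  rewrite /G2 ev2_translate /eta subrK.
  move: neg'; have {1}-> : psi y = tau ^+ p * (psi y / tau ^+ p) by rewrite mulrC divfK ?gt_eqF.
  by rewrite (newton_transformE hE) pmulr_rlt0 // exprn_gt0.
have [A1 [B1 [c1 [rel1 ec1]]]] := newton_transform_relation hE (ltnW m1) rel.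
have [A2 [B2 rel2]] := translate_relation a rel1.
have back : negative_point G2 -> negative_point G.
  move=> [s [x [s0]]]; rewrite /G2 ev2_translate /= => sx.
  exists (s ^+ e), (s ^+ p * (x + a)); split; first exact: exprn_gt0.
  by rewrite (newton_transformE hE) pmulr_rlt0 // exprn_gt0.
have mG : (m < size G)%N.
  by rewrite ltnNge; apply: contraTN gm => mG; rewrite nth_default // horner0 ltxx.
have b_le j : (j <= m)%N -> (fiber0 G1)`_j = if (j < m)%N then (h j).[0] else (G`_m).[0].
  move=> jm; rewrite coef_fiber0 coef_poly (leq_ltn_trans jm mG) /newton_coef.
  case: ltnP => // mj; have -> : j = m by apply/eqP; rewrite eqn_leq jm.
  by rewrite subnn muln0 expr0 mulr1 horner_comp hornerXn expr0n gtn_eqF.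
have sb : (size (fiber0 G1) <= m.+1)%N.
  apply/leq_sizeP => j mj; rewrite coef_fiber0 coef_poly; case: ltnP => // _; last by rewrite horner0.
  rewrite /newton_coef ltnNge (ltnW mj) /= hornerM hornerXn expr0n muln_eq0 subn_eq0 leqNgt mj.
  by rewrite orbF gtn_eqF // mulr0.
have bm : (fiber0 G1)`_m != 0 by rewrite b_le // ltnn gt_eqF.
have [m' [m'm m'0 m'n0 m'lt]] := order_translate a sb bm.
have ord0 j : (j < m')%N -> (G2`_j).[0] = 0.
  by move=> /m'0; rewrite -fiber0_translate coef_fiber0.
have ordm : (G2`_m').[0] != 0 by rewrite -coef_fiber0 fiber0_translate.
have c0 : c != 0 by apply: contraNneq ndv => ->; rewrite dvdp0.
have c10 : c1 != 0.
  by have := c0; rewrite -(@comp_poly_eq0 _ c 'X^e) ?size_polyXn // ec1; apply: contraNneq => ->; rewrite mulr0.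
apply: back; case: (ltnP m' m) => [m'lt'|mm'].
  (* The second measure may restart at any value; ['X^(size c1)] cannot divide the non-zero [c1]. *)
  apply: (IHm _ m'lt' (size c1) L' i' tau eta _ A2 B2 c1) => //.
  by apply/negP => /(dvdp_leq c10); rewrite size_polyXn ltnn.
have em : m' = m by apply/eqP; rewrite eqn_leq m'm.
rewrite em in ord0 ordm.
(* If the order stays [m], then [e = 1]: otherwise the coefficient of index [m - 1] of the fibre
   vanishes while that of index [j0] does not, and [order_translate] lowers the order. *)
have e1 : e = 1%N.
  case: he => // hm1; exfalso.
  have : (m' < m)%N; last by rewrite em ltnn.
  apply: (m'lt j0) => //.
    rewrite b_le ?(ltnW j0m) // j0m /h (negPf Gj0) vj0 subnn expr0 mulr1.
    by rewrite horner_comp hornerXn expr0n gtn_eqF // (proj2 (uv _ Gj0)).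
  rewrite b_le ?leq_pred // prednK ?leqnn ?(ltnW m1) // /h.
  case: eqP => [_|/eqP Gm1]; first by rewrite horner0.
  have -> : (m - m.-1 = 1)%N by case: (m) m1 => // n _ /=; rewrite subSnn.
  by rewrite muln1 hornerM hornerXn expr0n subn_eq0 leqNgt hm1 // mulr0.
(* Now [c] is [c1] times ['X^(p * m.-1)], whose exponent is positive, so the bound drops from [k.+1]
   to [k]. *)
apply: (IHk L' i' tau eta _ A2 B2 c1) => //.
move: ec1; rewrite e1 expr1 comp_polyXr => ec1.
apply: contra ndv => h1; rewrite ec1 exprSr mulrC dvdp_mul //.
by rewrite -{1}['X]expr1 dvdp_exp2l // muln_gt0 p0; case: (m) m1 => [|[]].
Qed.

Lemma low_coef_neq0 G A B c m : A * G + B * G^`() = c%:P -> c != 0 -> (1 < m)%N ->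
  exists2 j, (j < m)%N & G`_j != 0.
Proof.
move=> rel c0 m1; apply: contrapT => nex.
have Gj j : (j < m)%N -> G`_j = 0.
  by move=> jm; apply/eqP; apply: contrapT => /negP h; apply: nex; exists j.
move/(congr1 (fun P : {poly {poly R}} => P`_0)): rel.
rewrite coefD !coef0M coef_deriv !Gj ?(ltnW m1) // mul0rn !mulr0 addr0 coefC /= => c00.
by rewrite -c00 eqxx in c0.
Qed.

Theorem newton_puiseux m k : newton_puiseux_at m k.
Proof.
elim/ltn_ind: m k => m IHm; elim=> [|k IHk] L i t y G A B c t0 it iy rel ndv ord0 ordm neg.
  by rewrite expr0 dvd1p in ndv.
have [[y0 hy0]|nneg] := pselect (exists y0, (fiber0 G).[y0] < 0); first exact: fiber0_neg hy0.
have fib0 y0 : 0 <= (fiber0 G).[y0].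
  by rewrite leNgt; apply/negP => h; apply: nneg; exists y0.
have [||gm om] := @order_ge0 _ (fiber0 G) m fib0.
- by move=> j jm; rewrite coef_fiber0 ord0.
- by rewrite coef_fiber0.
rewrite coef_fiber0 in gm.
(* Parity excludes [m = 1]; for [m = 0] the value of [G] is infinitely near a positive constant. *)
have m1 : (1 < m)%N.
  case: m om ord0 gm {IHm IHk ordm} => [|[|m]] // _ _ g0.
  by have := near_gt0 (inf_ev2 G it iy) g0; rewrite ltNge ltW.
have c0 : c != 0 by apply: contraNneq ndv => ->; rewrite dvdp0.
have [j1 j1m Gj1] := low_coef_neq0 rel c0 m1.
have /choice[vu hvu] : forall j, exists vu : nat * {poly R},
    G`_j != 0 -> G`_j = vu.2 * 'X^(vu.1) /\ vu.2.[0] != 0.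
  move=> j; case: (eqVneq G`_j 0) => [_|/valuation0[v [u [e0 u0]]]]; first by exists (0%N, 0).
  by exists (v, u).
pose v j := (vu j).1; pose u j := (vu j).2.
have vpos j : (j < m)%N -> G`_j != 0 -> (0 < v j)%N.
  move=> jm Gj; have [e0 u0] := hvu j Gj; rewrite lt0n; apply: contra u0 => /eqP v0.
  by have := ord0 j jm; rewrite e0 -/(v j) v0 expr0 mulr1 => ->.
(* The slopes [v j / (m - j)] of the Newton polygon, multiplied by [m!] to become integers. *)
pose w j := (v j * (m`! %/ (m - j)))%N.
have wE j : (j < m)%N -> (w j * (m - j) = v j * m`!)%N.
  move=> jm; rewrite /w -mulnA divnK //; apply: dvdn_fact; rewrite subn_gt0 jm.
  exact: leq_subr.
pose P (j : 'I_m) := G`_j != 0.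
have := @arg_minnP _ (Ordinal j1m) P (fun j => w j) Gj1.
case=> j0 Gj0 minj0.
have w0 : (0 < w j0)%N.
  by move: (wE j0 (ltn_ord j0)); have := vpos j0 (ltn_ord j0) Gj0; have := fact_gt0 m; nia.
have minw j : (j < m)%N -> G`_j != 0 -> (w j0 <= w j)%N.
  by move=> jm Gj; apply: (minj0 (Ordinal jm)).
have mp : (m.-1 < m)%N by rewrite prednK // ltnW.
have mp1 : (m - m.-1 = 1)%N by case: (m) m1 => // n _ /=; rewrite subSnn.
(* If the index [m - 1] attains the least slope, this slope is the integer [v m.-1] and [e = 1]
   suffices. Otherwise [e = m!] is used, and the point of index [m - 1] is absent or strictly above
   the line. *)
have [/andP[Gm1 wm1]|ncase] := boolP ((G`_m.-1 != 0) && (w m.-1 <= w j0)%N).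
- apply: (@newton_puiseux_step m k 1 (v m.-1) v u m.-1 _ IHk L i t y G A B c) => //.
  + exact: vpos.
  + move=> j jm Gj; rewrite muln1.
    have := leq_trans wm1 (minw j jm Gj).
    rewrite -(leq_pmul2r (m := m - j)) ?subn_gt0 // wE // -(leq_pmul2r (fact_gt0 m)).
    have := wE _ mp; rewrite mp1 muln1 => ->; have := fact_gt0 m; nia.
  + by rewrite mp1 !muln1.
  + by left.
- apply: (@newton_puiseux_step m k m`! (w j0) v u j0 _ IHk L i t y G A B c) => //.
  + exact: fact_gt0.
  + by move=> j jm Gj; rewrite -wE // leq_mul2r minw // orbT.
  + by rewrite wE.
  + right=> Gm1; move: ncase; rewrite Gm1 /= -ltnNge.
    by rewrite -wE // mp1 muln1.
Qed.
End NewtonPuiseux.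

(** * Transfer of non-negativity from the reals to ordered fields *)

Section ArtinLang.
Variable R : realType.
Implicit Types F G : {poly {poly R}}.

Lemma natr_poly_neq0 n : n.+1%:R != 0 :> {poly R}.
Proof. by rewrite -polyC_natr polyC_eq0 pnatr_eq0. Qed.

Lemma deriv_neq0 G : (1 < size G)%N -> G^`() != 0.
Proof.
move=> sG; apply/eqP => /(congr1 (fun P : {poly {poly R}} => P`_(size G).-2)).
rewrite coef_deriv coef0 => /eqP; rewrite -mulr_natr mulf_eq0 (negPf (natr_poly_neq0 _)) orbF.
have -> : (size G).-2.+1 = (size G).-1 by case: (size G) sG => [|[]].
by rewrite -lead_coefE lead_coef_eq0 -size_poly_eq0; case: (size G) sG.
Qed.

Lemma separable_relation G : separable_poly G ->
  exists A B c, A * G + B * G^`() = c%:P /\ c != 0.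
Proof.
rewrite unlock => /Bezout_coprimepP[[A B]] /=; rewrite -size_poly_eq1 => /size_poly1P[c c0 e].
by exists A, B, c.
Qed.

(** The multiplier [c] appears because divisibility is that of polynomials in [y] over the fractions
    in [x]. *)
Lemma nonseparable_factor G : G != 0 -> ~~ separable_poly G ->
  exists (c : {poly R}) (q g : {poly {poly R}}),
    [/\ c != 0, q != 0, g != 0 & c *: G = q * g ^+ 2] /\ (size q < size G)%N /\ (size g < size G)%N.
Proof.
move=> G0 /separable_polyP nsep.
have [g [g1 /Pdiv.Idomain.dvdpP[[c q] /= c0 e]]] : exists g : {poly {poly R}}, size g != 1%N /\ dvdp (g ^+ 2) G.
  apply: contrapT => nex; apply: nsep; split=> [|u _]; last exact: deriv_neq0.
  apply/poly_square_freeP => u u1; apply/negP => uG; apply: nex; by exists u.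
have /andP[q0 g20] : (q != 0) && (g ^+ 2 != 0).
  rewrite -negb_or -mulf_eq0 -e -mul_polyC mulf_eq0 polyC_eq0 (negPf c0); exact: G0.
have g0 : g != 0 by apply: contraNneq g20 => ->; rewrite expr0n.
exists c, q, g; split=> //.
have := congr1 (fun P : {poly {poly R}} => size P) e.
rewrite size_scale // size_mul // expr2 size_mul // => ->.
move: g1 (size_poly_gt0 q) (size_poly_gt0 g); rewrite q0 g0.
by move: (size q) (size g) => a b; clear; lia.
Qed.

(** A positive infinitesimal is transcendental over the reals: in [c = u * 'X^v] the value of [u] is
    infinitely near [u.[0] != 0]. *)
Lemma hm_neq0 (L : realFieldType) (i : {rmorphism R -> L}) t (c : {poly R}) :
  0 < t -> infinitesimal i t -> c != 0 -> hm i t c != 0.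
Proof.
move=> t0 it /valuation0[v [u [-> u0]]].
rewrite rmorphM /= hmXn; apply: mulf_neq0; last by rewrite expf_neq0 // gt_eqF.
apply/eqP => e; have := inf_hm u it; rewrite /= e sub0r => /inf_opp h.
have := h `|u.[0]|; rewrite normr_gt0 u0 => /(_ isT).
by rewrite opprK emb_norm ltxx.
Qed.

(** Induction on the degree in [y], after making the leading coefficient a unit at [t = 0]. A
    repeated factor gives [c G = q g^2], and [c q] of lower degree takes over. A separable [G] has a
    Bezout relation with its derivative, so [newton_puiseux] applies at the standard part of [y]; an
    infinite [y] leaves the sign to the leading term. *)
Lemma nonneg_transfer F (L : realFieldType) (i : {rmorphism R -> L}) t eta :
  (forall t0 y0 : R, 0 < t0 -> 0 <= ev2 idfun t0 y0 F) -> 0 < t -> infinitesimal i t ->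
  0 <= ev2 i t eta F.
Proof.
have [n] := ubnP (size F); elim: n => // n IHn in F eta *; rewrite ltnS => sF F0 t0 it.
rewrite leNgt; apply/negP => neg.
have Fn0 : F != 0 by apply: contraTneq neg => ->; rewrite rmorph0 ltxx.
pose d := (size F).-1.
have sFd : size F = d.+1 by rewrite /d prednK // lt0n size_poly_eq0.
have [v [u [eF u0]]] : exists v u, F`_d = u * 'X^v /\ u.[0] != 0.
  by apply: valuation0; rewrite -lead_coefE lead_coef_eq0.
pose r := v.+1.
(* The substitution [y = t ^- r * y'] makes the leading coefficient of [F] a unit at [t = 0]
   and the other coefficients vanish there. *)
pose G := \poly_(j < d.+1) (if (j < d)%N then F`_j * 'X^(r * (d - j) - v) else u).
have GE (A : comNzRingType) (i' : {rmorphism R -> A}) x y :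
    x ^+ v * ev2 i' x (x ^+ r * y) G = x ^+ (r * d) * ev2 i' x y F.
  have sF' : (size F <= d.+1)%N by rewrite sFd.
  rewrite /ev2 (hm_sum _ _ (size_poly _ _)) (hm_sum _ _ sF') !mulr_sumr.
  apply: eq_bigr => j _; rewrite coef_poly ltn_ord exprMn -exprM.
  case: ltnP => jd.
    rewrite rmorphM /= hmXn.
    have -> : x ^+ (r * d) = x ^+ v * x ^+ (r * (d - j) - v) * x ^+ (r * j).
      rewrite -!exprD; congr (x ^+ _).
      have : (v <= r * (d - j))%N by rewrite /r; nia.
      by move=> h; rewrite subnKC // -mulnDr subnK // ltnW.
    by ring.
  have -> : nat_of_ord j = d by apply/eqP; rewrite eqn_leq jd -ltnS ltn_ord.
  by rewrite eF rmorphM /= hmXn; ring.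
have Gpos : ~ negative_point G.
  move=> [x [y [x0]]]; apply/negP; rewrite -leNgt.
  have := GE _ idfun x (y / x ^+ r); rewrite mulrCA divff ?expf_neq0 ?gt_eqF // mulr1 => e.
  have : 0 <= x ^+ v * ev2 idfun x y G by rewrite e mulr_ge0 ?exprn_ge0 ?(ltW x0) ?F0.
  by rewrite pmulr_rge0 // exprn_gt0.
pose y := t ^+ r * eta.
have Gneg : ev2 i t y G < 0.
  by have := GE _ i t eta; rewrite -/y => e; rewrite -(pmulr_rlt0 _ (exprn_gt0 v t0)) e pmulr_rlt0 ?exprn_gt0.
have fib j : (j <= d)%N -> (G`_j).[0] = if (j < d)%N then 0 else u.[0].
  move=> jd; rewrite coef_poly ltnS jd; case: ltnP => // jd'.
  rewrite hornerM hornerXn expr0n.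
  have -> : (r * (d - j) - v == 0)%N = false by apply/negbTE; rewrite /r; nia.
  by rewrite mulr0.
have sG : (size G <= d.+1)%N by apply: size_poly.
have Gd : (fiber0 G)`_d != 0 by rewrite coef_fiber0 fib // ltnn.
have sfG : (size (fiber0 G) <= d.+1)%N by apply: leq_trans (size_poly _ _) sG.
have G0 : G != 0 by apply: contraNneq Gd => ->; rewrite rmorph0 coef0.
have [sep|nsep] := boolP (separable_poly G); last first.
  have [c [q [g [[c0 _ g0 e] [szq _]]]]] := nonseparable_factor G0 nsep.
  have e2 (A : comNzRingType) (f : {rmorphism {poly {poly R}} -> A}) :
      f c%:P ^+ 2 * f G = f (c%:P * q) * f g ^+ 2.
    rewrite [X in _ = X * _]rmorphM /= [f c%:P ^+ 2]expr2 -!mulrA; congr (_ * _).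
    by rewrite -rmorphM mul_polyC e rmorphM rmorphXn.
  have ecq : size (c%:P * q) = size q by rewrite mul_polyC size_scale.
  have : 0 <= ev2 i t y (c%:P * q).
    apply: IHn => //; first by rewrite ecq; apply: leq_trans szq _; apply: leq_trans sG _; rewrite -sFd.
    move=> x1 y1 x10; rewrite leNgt; apply/negP => neg1.
    (* Where [g] vanishes the sign of [G] gives no information, so the point is first moved off that
       curve. *)
    have [x2 [y2 [x12 neg2 g2]]] := neg_nonroot2 neg1 g0.
    have : 0 <= ev2 idfun x2 y2 G.
      by rewrite leNgt; apply/negP => h; apply: Gpos; exists x2, y2; split=> //; apply: lt_trans x12.
    move=> G2.
    have : 0 <= ev2 idfun x2 y2 c%:P ^+ 2 * ev2 idfun x2 y2 G by rewrite mulr_ge0 ?sqr_ge0.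
    by rewrite e2 leNgt nmulr_rlt0 // lt_neqAle eq_sym expf_eq0 (negPf g2) sqr_ge0.
  apply/negP; rewrite -ltNge.
  have : ev2 i t y c%:P ^+ 2 * ev2 i t y G < 0.
    by rewrite pmulr_rlt0 // lt_neqAle sqr_ge0 eq_sym expf_eq0 ev2C (negPf (hm_neq0 _ _ _)).
  by rewrite e2; apply: contraTT; rewrite -!leNgt => h; rewrite mulr_ge0 ?sqr_ge0.
have [A [B [c [rel c0]]]] := separable_relation sep.
have [fy|nfy] := pselect (finite_elt i y).
  have [a ia] := standard_part fy.
  have [m' [_ m'0 m'n0 _]] := order_translate a sfG Gd.
  have [A2 [B2 rel2]] := translate_relation a rel.
  apply: Gpos.
  have [||||x1 [y1 [x10 n1]]] := @newton_puiseux _ m' (size c) L i t (y - i a) (G \Po ('X + a%:P%:P)) A2 B2 c t0 it ia rel2.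
  - by apply/negP => /(dvdp_leq c0); rewrite size_polyXn ltnn.
  - by move=> j /m'0; rewrite -fiber0_translate coef_fiber0.
  - by rewrite -coef_fiber0 fiber0_translate.
  - by rewrite ev2_translate subrK.
  by exists x1, (y1 + a); split=> //; rewrite -ev2_translate.
have [y0 iy] := not_fin_inv nfy.
have [|||gm om] := @order_ge0 _ (fiber0 G) d.
- by move=> y1; rewrite leNgt; apply/negP => /fiber0_neg.
- by move=> j jd; rewrite coef_fiber0 fib ?jd // ltnW.
- exact: Gd.
(* The degenerate choice [e = 1], [p = 0]: for infinite [y] the quotient [t ^+ 0 / y] is
   infinitesimal. *)
have hE j : (j < d)%N -> G`_j \Po 'X^1 = 'X^(0 * (d - j)) * G`_j.
  by rewrite expr1 comp_polyXr mul0n expr0 mul1r.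
have : 0 < ev2 i (t ^+ 1) y G.
  apply: (newton_dominant hE) => //; [by right|by rewrite expr0 mul1r|by rewrite -coef_fiber0].
by rewrite expr1 ltNge ltW.
Qed.
End ArtinLang.

(** * Non-negative polynomials in the plane *)

Section ArtinLang.
Variable R : realType.
Implicit Types F G : {poly {poly R}}.

Definition psd F := forall x y : R, 0 <= F.[y%:P].[x].

Lemma ev2_map_comp (A : comNzRingType) (i : {rmorphism R -> A}) (x y : A) (q : {poly R}) F :
  ev2 i x y (map_poly (comp_poly q) F) = ev2 i (hm i x q) y F.
Proof.
apply: (rmorph_poly_ext (f := ev2 i x y \o map_poly (comp_poly q)) (g := ev2 i (hm i x q) y)) => [c|].
  rewrite /= map_polyC !ev2C.
  apply: (rmorph_poly_ext (f := hm i x \o comp_poly q) (g := hm i (hm i x q))) => [b|].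
    by rewrite /= comp_polyC !hmC.
  by rewrite /= comp_polyX hmX.
by rewrite /= map_polyX !ev2X.
Qed.

Lemma ev2_reverse F : exists N G, forall (A : fieldType) (i : {rmorphism R -> A}) (x y : A),
  x != 0 -> ev2 i x y G = x ^+ N * ev2 i x^-1 y F.
Proof.
pose N := (\max_(j < size F) size (F`_j)%R)%N.
pose G := \poly_(j < size F) \sum_(k < N.+1) F`_j`_k *: 'X^(N - k).
exists N, G => A i x y x0.
rewrite /ev2 (hm_sum _ _ (leqnn (size F))) (hm_sum _ _ (size_poly _ _)) mulr_sumr.
apply: eq_bigr => j _; rewrite coef_poly ltn_ord mulrA; congr (_ * _).
have sN : (size (F`_j)%R <= N.+1)%N by apply: leqW; apply: (leq_bigmax j).
rewrite (hm_sum _ _ sN) mulr_sumr rmorph_sum /=; apply: eq_bigr => k _.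
rewrite -mul_polyC rmorphM /= -!/(hm _ _ _) hmC hmXn mulrCA; congr (_ * _).
have -> : x ^+ N = x ^+ (N - k) * x ^+ k by rewrite -exprD subnK // -ltnS.
by rewrite exprVn mulfK // expf_neq0.
Qed.

(** A non-real [x] lies infinitely near a real [a], on one side of it, or is infinite. The
    substitutions ['X + a], [a - 'X], [- 'X] and the reversal [x -> x^-1] reduce every case to a
    positive infinitesimal. *)
Theorem psd_ordered_field F (L : realFieldType) (i : {rmorphism R -> L}) x y :
  psd F -> (forall r, x != i r) -> 0 <= ev2 i x y F.
Proof.
move=> F0 nx; have [fx|nfx] := pselect (finite_elt i x).
  have [a ia] := standard_part fx.
  have s0 : x - i a != 0 by rewrite subr_eq0.
  have [sp|sn] := ltP 0 (x - i a).
    have -> : x = hm i (x - i a) ('X + a%:P) by rewrite rmorphD /= hmX hmC subrK.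
    rewrite -ev2_map_comp; apply: nonneg_transfer => // t0 y0 _.
    by rewrite ev2_map_comp ev2_idfun.
  have sn' : 0 < - (x - i a) by rewrite oppr_gt0 lt_neqAle s0.
  have -> : x = hm i (- (x - i a)) (a%:P - 'X) by rewrite rmorphB /= hmX hmC opprK addrC subrK.
  rewrite -ev2_map_comp; apply: nonneg_transfer => //; last exact: inf_opp.
  by move=> t0 y0 _; rewrite ev2_map_comp ev2_idfun.
have [x0 ix] := not_fin_inv nfx.
wlog xp : x F F0 {nx nfx} x0 ix / 0 < x.
  move=> W; have [|xn] := ltP 0 x; first exact: W.
  have -> : x = hm i (- x) (- 'X) by rewrite rmorphN /= hmX opprK.
  rewrite -ev2_map_comp; apply: W; rewrite ?oppr_eq0 //.
  - by move=> u v; rewrite -ev2_idfun ev2_map_comp ev2_idfun.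
  - by rewrite invrN; apply: inf_opp.
  - by rewrite oppr_gt0 lt_neqAle x0.
have [N [G GE]] := ev2_reverse F.
have : 0 <= ev2 i x^-1 y G.
  apply: nonneg_transfer => //; last by rewrite invr_gt0.
  by move=> t0 y0 tp; rewrite GE ?gt_eqF // mulr_ge0 ?exprn_ge0 ?(ltW tp) // ev2_idfun.
by rewrite GE ?invr_eq0 // invrK pmulr_rge0 // exprn_gt0 // invr_gt0.
Qed.
End ArtinLang.

Lemma fraction_repr (D : idomainType) (z : {fraction D}) :
  exists n d : D, d != 0 /\ z * tofrac d = tofrac n.
Proof.
elim/quotW: z => x; exists (frac x).1, (frac x).2; split; first exact: denom_ratioP.
rewrite [_ * _]/(FracField.mul _ _) !piE.
have := FracField.pi_mul x (Ratio (frac x).2 1) => /= h.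
etransitivity; first by symmetry; exact: h.
apply/eqmodP; rewrite /= FracField.equivfE /FracField.mulf.
rewrite ?numden_Ratio ?mulf_neq0 ?denom_ratioP // ?mulr1 1?mulrC //; exact: oner_neq0.
Qed.

(** * Sums of squares and Hilbert's 17th problem in the plane *)

Inductive sum_of_squares (K : nzRingType) : K -> Prop :=
| sos_0 : sum_of_squares 0
| sos_add a x : sum_of_squares x -> sum_of_squares (a ^+ 2 + x).

Section SumsOfSquares.
Variable K : fieldType.

Lemma sos_D (x y : K) : sum_of_squares x -> sum_of_squares y -> sum_of_squares (x + y).
Proof. by move=> hx hy; elim: hx => [|a z _ IH]; [rewrite add0r|rewrite -addrA; apply: sos_add]. Qed.

Lemma sos_sqr (a : K) : sum_of_squares (a ^+ 2).
Proof. by rewrite -[a ^+ 2]addr0; apply: sos_add; apply: sos_0. Qed.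

Lemma sos_M (x y : K) : sum_of_squares x -> sum_of_squares y -> sum_of_squares (x * y).
Proof.
move=> hx hy; elim: hx => [|a z _ IH]; first by rewrite mul0r; apply: sos_0.
rewrite mulrDl; apply: sos_D => //; elim: hy => [|b w _ IHw]; first by rewrite mulr0; apply: sos_0.
by rewrite mulrDr; apply: sos_D => //; rewrite -exprMn; apply: sos_sqr.
Qed.

(** If -1 were a sum of squares, every element would be one, as a difference of two squares. *)
Lemma preordering_sos (x : K) : 2%:R != 0 :> K -> ~ sum_of_squares x -> preordering (@sum_of_squares K).
Proof.
move=> n2 nx; split; [exact: sos_D|exact: sos_M|exact: sos_sqr|] => hN; apply: nx.
have -> : x = ((x + 1) / 2%:R) ^+ 2 + -1 * ((x - 1) / 2%:R) ^+ 2 by field.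
by apply: sos_D; [exact: sos_sqr|apply: sos_M => //; exact: sos_sqr].
Qed.
End SumsOfSquares.

Section Hilbert17.
Variable R : realType.
Local Notation RXY := {poly {poly R}}.
Implicit Types F G : RXY.

(** Otherwise [- F] can be adjoined to the sums of squares. In an ordering extending this
    preordering [F <= 0], while transfer gives [F >= 0]; hence [F = 0], a sum of squares after
    all. *)
Lemma psd_sos_fraction F : psd F -> sum_of_squares (tofrac F).
Proof.
move=> F0; apply: contrapT => nF.
pose j : {rmorphism R -> {fraction RXY}} := @tofrac RXY \o (polyC \o polyC).
have n2 : 2%:R != 0 :> {fraction RXY}.
  by rewrite -(rmorph_nat (@tofrac RXY)) tofrac_eq0 -polyC_natr polyC_eq0 -polyC_natr polyC_eq0 pnatr_eq0.
have T0 := preordering_sos n2 nF.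
have nF' : ~ sum_of_squares (- - tofrac F) by rewrite opprK.
have [L [psi psi0]] := ordering_exists (preordering_adjoin T0 nF').
have : psi (tofrac F) = ev2 (psi \o j : {rmorphism R -> L}) (psi (tofrac 'X%:P)) (psi (tofrac 'X)) F.
  apply: (rmorph_poly_ext (f := psi \o @tofrac RXY) (g := ev2 _ _ _)) => [c|]; last by rewrite ev2X.
  rewrite ev2C; apply: (rmorph_poly_ext (f := psi \o @tofrac RXY \o polyC) (g := hm _ _)) => [b|].
    by rewrite hmC.
  by rewrite hmX.
have : 0 <= ev2 (psi \o j : {rmorphism R -> L}) (psi (tofrac 'X%:P)) (psi (tofrac 'X)) F.
  apply: psd_ordered_field => // r; rewrite /= (inj_eq (fmorph_inj psi)) tofrac_eq.
  rewrite (inj_eq polyC_inj); apply/eqP => /(congr1 (fun p : {poly R} => size p)) /eqP.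
  by rewrite size_polyX size_polyC; case: (r == 0).
move=> ge0 e; rewrite -e in ge0.
have le0 : psi (tofrac F) <= 0.
  rewrite -oppr_ge0 -rmorphN; apply: psi0; exists 0, 1; split; [exact: sos_0| |].
    by rewrite -(expr1n _ 2); apply: sos_sqr.
  by rewrite add0r mulr1.
have : psi (tofrac F) == 0 by rewrite eq_le le0.
by rewrite fmorph_eq0 => /eqP F00; apply: nF; rewrite F00; apply: sos_0.
Qed.

Lemma sos_clear_denominators F : sum_of_squares (tofrac F) ->
  exists (D : RXY) (s : seq RXY), D != 0 /\ D ^+ 2 * F = \sum_(g <- s) g ^+ 2.
Proof.
suff key z : sum_of_squares z -> exists (D : RXY) (s : seq RXY),
    D != 0 /\ tofrac D ^+ 2 * z = tofrac (\sum_(g <- s) g ^+ 2).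
  move=> /key[D [s [D0 e]]]; exists D, s; split=> //.
  by apply/eqP; rewrite -tofrac_eq rmorphM rmorphXn /= e.
elim=> {z} [|a x _ [D [s [D0 e]]]]; first by exists 1, [::]; rewrite oner_neq0 mulr0 big_nil rmorph0.
have [n [d [d0 ea]]] := fraction_repr a.
exists (D * d), (n * D :: [seq d * g | g <- s]); split; first by rewrite mulf_neq0.
have -> : \sum_(g <- (n * D :: [seq d * g | g <- s])) g ^+ 2 = (n * D) ^+ 2 + d ^+ 2 * \sum_(g <- s) g ^+ 2.
  by rewrite big_cons big_map mulr_sumr; congr (_ + _); apply: eq_bigr => g _; rewrite exprMn.
by rewrite !(rmorphD, rmorphM, rmorphXn) /= -e -ea; ring.
Qed.

Lemma sum_sqr_eq0 (s : seq RXY) : \sum_(g <- s) g ^+ 2 = 0 -> forall g, g \in s -> g = 0.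
Proof.
move=> e g gs; apply/eqP; apply: contrapT => /negP g0.
(* The constant -1 serves to obtain from [neg_nonroot2] a real point where [g] does not vanish. *)
have n1 : ev2 idfun (0 : R) 0 (-1) < 0 by rewrite rmorphN rmorph1 oppr_lt0 ltr01.
have [x [y [_ _ gxy]]] := neg_nonroot2 n1 g0.
have : ev2 idfun x y (\sum_(g <- s) g ^+ 2) = 0 by rewrite e rmorph0.
rewrite rmorph_sum /= (big_rem g gs) /= rmorphXn /=; apply/eqP; rewrite gt_eqF //.
rewrite ltr_wpDr ?sumr_ge0 // => [h _|]; first by rewrite rmorphXn sqr_ge0.
by rewrite lt_neqAle eq_sym expf_eq0 (negPf gxy) sqr_ge0.
Qed.

Lemma sum_sqr_eq0_uni (s : seq {poly R}) : \sum_(g <- s) g ^+ 2 = 0 -> forall g, g \in s -> g = 0.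
Proof.
move=> e g gs; apply: polyC_inj; apply: (@sum_sqr_eq0 [seq h%:P | h <- s]); last exact: map_f.
by rewrite big_map -[RHS]polyC0 -e rmorph_sum; apply: eq_bigr => h _; rewrite rmorphXn.
Qed.

(** One multiplier [l] must serve all numerators, since the descent divides them as a vector. *)
Lemma pseudo_division_seq (D : RXY) (s : seq RXY) : D != 0 ->
  exists (l : {poly R}) (qr : seq (RXY * RXY)), [/\ l != 0,
    [seq l%:P * u | u <- s] = [seq w.1 * D + w.2 | w <- qr] &
    all (fun w : RXY * RXY => size w.2 < size D)%N qr].
Proof.
move=> D0; elim: s => [|u s [l [qr [l0 e szs]]]]; first by exists 1, [::]; split=> //; exact: oner_neq0.
have := Pdiv.Idomain.divp_eq u D.
set k := lead_coef D ^+ _ => eu.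
have k0 : k != 0 by rewrite expf_neq0 // lead_coef_eq0.
exists (l * k), ((l%:P * divp u D, l%:P * modp u D) :: [seq (k%:P * w.1, k%:P * w.2) | w <- qr]).
split; first by rewrite mulf_neq0.
  rewrite /=; congr (_ :: _).
    by rewrite rmorphM /= -mulrA [k%:P * u]mul_polyC eu mulrDr mulrA.
  rewrite -map_comp; have := congr1 (map (fun g => k%:P * g)) e; rewrite -!map_comp => e'.
  transitivity (map ((fun g => k%:P * g) \o (fun u => l%:P * u)) s).
    by apply: eq_map => g /=; rewrite rmorphM /=; ring.
  by rewrite e'; apply: eq_map => w /=; ring.
rewrite /= !mul_polyC size_scale // Pdiv.Idomain.ltn_modp D0 all_map.
by apply: sub_all szs => w /=; rewrite mul_polyC size_scale.
Qed.

Lemma sum_reflection (a b D : RXY) (qr : seq (RXY * RXY)) :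
  \sum_(w <- qr) (a * (w.1 * D + w.2) + b * w.1) ^+ 2 =
  a ^+ 2 * ((\sum_(w <- qr) w.1 ^+ 2) * D ^+ 2 + 2%:R * (\sum_(w <- qr) w.1 * w.2) * D
            + \sum_(w <- qr) w.2 ^+ 2)
  + 2%:R * a * b * ((\sum_(w <- qr) w.1 ^+ 2) * D + \sum_(w <- qr) w.1 * w.2)
  + b ^+ 2 * \sum_(w <- qr) w.1 ^+ 2.
Proof.
elim: qr => [|w qr IH]; first by rewrite !big_nil; ring.
by rewrite !big_cons IH; ring.
Qed.

(* Cassels' descent: with [l u_i = q_i D + r_i], reflecting the vector [u] in [q] gives
   a representation with the denominator [(sum r_i^2) / D] in place of [D]. *)
Lemma cassels F (D : RXY) (s : seq RXY) : D != 0 -> D ^+ 2 * F = \sum_(g <- s) g ^+ 2 ->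
  exists (c : {poly R}) (s' : seq RXY), c != 0 /\ c%:P ^+ 2 * F = \sum_(g <- s') g ^+ 2.
Proof.
have [n] := ubnP (size D); elim: n => // n IHn in D s *; rewrite ltnS => sD D0 e.
have [l [qr [l0 es szr]]] := pseudo_division_seq s D0.
pose q2 := \sum_(w <- qr) w.1 ^+ 2; pose r2 := \sum_(w <- qr) w.2 ^+ 2.
pose qr2 := \sum_(w <- qr) w.1 * w.2.
have eU : l%:P ^+ 2 * (D ^+ 2 * F) = q2 * D ^+ 2 + 2%:R * qr2 * D + r2.
  have -> : l%:P ^+ 2 * (D ^+ 2 * F) = \sum_(g <- [seq l%:P * u | u <- s]) g ^+ 2.
    by rewrite e big_map mulr_sumr; apply: eq_bigr => g _; rewrite exprMn.
  rewrite es big_map /q2 /qr2 /r2 mulr_suml mulr_sumr mulr_suml -!big_split /=.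
  by apply: eq_bigr => w _; ring.
(* Vanishing remainders end the descent: the quotients represent [l^2 F]. *)
case: (eqVneq r2 0) => [r20|r2n].
  exists l, [seq w.1 | w <- qr]; split=> //; rewrite big_map -/q2.
  have r0 w : w \in qr -> w.2 = 0.
    move=> wqr; apply: (@sum_sqr_eq0 [seq w.2 | w <- qr]); first by rewrite big_map.
    exact: map_f.
  have qr0 : qr2 = 0.
    by rewrite /qr2 big_seq big1 // => w /r0 ->; rewrite mulr0.
  have D20 : D ^+ 2 != 0 by rewrite expf_neq0.
  by apply: (mulfI D20); rewrite mulrCA eU r20 qr0; ring.
pose a := q2 - l%:P ^+ 2 * F.
(* [b = 2 (l^2 F D - u.q)] where [u.q = q2 D + qr2] *)
pose b := 2%:R * (l%:P ^+ 2 * F * D - (q2 * D + qr2)).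
pose d := a * D + b.
have ed : d * D = r2.
  have : d * D = a * D ^+ 2 + b * D by rewrite /d; ring.
  move=> ->; have -> : r2 = l%:P ^+ 2 * (D ^+ 2 * F) - (q2 * D ^+ 2 + 2%:R * qr2 * D) by rewrite eU; ring.
  by rewrite /a /b; ring.
have d0 : d != 0 by apply: contraNneq r2n => d0; rewrite -ed d0 mul0r.
apply: (IHn (l%:P * d) [seq a * (w.1 * D + w.2) + b * w.1 | w <- qr]).
- rewrite mul_polyC size_scale //; apply: leq_trans sD.
  (* The remainders have degree at most [deg D - 1] in [y], so [d = r2 / D] has degree at most
     [deg D - 2]. *)
  have szr2 : (size r2 <= (size D).-2.*2.+1)%N.
    rewrite /r2 big_seq; apply: (big_ind (fun p : RXY => size p <= (size D).-2.*2.+1)%N).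
    + by rewrite size_poly0.
    + by move=> x y hx hy; apply: leq_trans (size_polyD _ _) _; rewrite geq_max hx.
    + move=> w wqr; apply: leq_trans (size_polyMleq _ _) _.
      have := allP szr w wqr => /=; move: (size w.2) (size D) => x y; clear; lia.
  have := size_mul d0 D0; rewrite ed => esz; rewrite esz in szr2.
  have : (0 < size d)%N by rewrite size_poly_gt0.
  have : (0 < size D)%N by rewrite size_poly_gt0.
  have : (size D != 1)%N.
    apply: contraNneq r2n => sD1; apply/eqP; rewrite /r2 big_seq big1 // => w wqr.
    have := allP szr w wqr; rewrite /= sD1 ltnS leqn0 size_poly_eq0 => /eqP ->.
    by rewrite expr0n.
  by move: szr2; move: (size d) (size D) => x y; clear; lia.
- by rewrite mulf_neq0 // polyC_eq0.
rewrite big_map.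
have -> : \sum_(w <- qr) (a * (w.1 * D + w.2) + b * w.1) ^+ 2 =
    a ^+ 2 * (l%:P ^+ 2 * (D ^+ 2 * F)) + 2%:R * a * b * (q2 * D + qr2) + b ^+ 2 * q2.
  by rewrite eU sum_reflection.
have -> : q2 = a + l%:P ^+ 2 * F by rewrite /a subrK.
have -> : 2%:R * a * b * ((a + l%:P ^+ 2 * F) * D + qr2) = a * b * (2%:R * (l%:P ^+ 2 * F * D) - b).
  by rewrite /b /a; ring.
by rewrite /d; ring.
Qed.

Lemma fiber_eq0_factor x0 F : map_poly (horner_eval x0) F = 0 ->
  exists G, F = ('X - x0%:P)%:P * G.
Proof.
move=> F0; have hj j : exists h, F`_j = h * ('X - x0%:P).
  by apply/factor_theorem/rootP; have := congr1 (fun p : {poly R} => p`_j) F0; rewrite coef_map coef0.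
have /choice[h hE] := hj; exists (\poly_(j < size F) h j).
apply/polyP => j; rewrite coefCM coef_poly hE mulrC; case: ltnP => // sj.
by rewrite mulrC -hE nth_default // mulr0.
Qed.

(** At a real zero [x0] of [c] the squares of the restrictions to [x = x0] sum to zero, so [x - x0]
    divides every numerator and cancels. *)
Lemma cancel_roots F (c : {poly R}) (s : seq RXY) : c != 0 -> c%:P ^+ 2 * F = \sum_(g <- s) g ^+ 2 ->
  exists (c' : {poly R}) (s' : seq RXY),
    (forall x, c'.[x] != 0) /\ c'%:P ^+ 2 * F = \sum_(g <- s') g ^+ 2.
Proof.
have [n] := ubnP (size c); elim: n => // n IHn in c s *; rewrite ltnS => sc c0 e.
have [[x0 cx0]|nr] := pselect (exists x, c.[x] = 0); last first.
  by exists c, s; split=> // x; apply/eqP => cx; apply: nr; exists x.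
have [c1 ec] : exists c1, c = c1 * ('X - x0%:P) by apply/factor_theorem/rootP.
have lin0 : 'X - x0%:P != 0 :> {poly R} by rewrite polyXsubC_eq0.
have c10 : c1 != 0 by apply: contraNneq c0 => c10; rewrite ec c10 mul0r.
have div g : g \in s -> exists g1, g = ('X - x0%:P)%:P * g1.
  move=> gs; have g0 : map_poly (horner_eval x0) g = 0.
    apply: (@sum_sqr_eq0_uni [seq map_poly (horner_eval x0) g | g <- s]); last exact: map_f.
    rewrite big_map.
    transitivity (map_poly (horner_eval x0) (\sum_(g <- s) g ^+ 2)).
      by rewrite rmorph_sum; apply: eq_bigr => h _; rewrite rmorphXn.
    by rewrite -e rmorphM rmorphXn /= map_polyC /= /horner_eval cx0 expr0n mul0r.
  exact: fiber_eq0_factor.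
have [s1 es] : exists s1, s = [seq ('X - x0%:P)%:P * g | g <- s1].
  elim: (s) div => [|g t IH] div; first by exists [::].
  have [|t1 ->] := IH; first by move=> h ht; apply: div; rewrite inE ht orbT.
  have [|g1 ->] := div g; first by rewrite inE eqxx.
  by exists (g1 :: t1).
apply: (IHn c1 s1) => //.
  apply: leq_trans sc; rewrite ec size_mul // size_XsubC addn2 /=.
  exact: leqnn.
have lin2 : ('X - x0%:P)%:P ^+ 2 != 0 :> RXY by rewrite expf_neq0 // polyC_eq0.
apply: (mulfI lin2); rewrite mulr_sumr.
move: e; rewrite es big_map ec rmorphM exprMn => e.
rewrite mulrA [_ * c1%:P ^+ 2]mulrC e.
by apply: eq_bigr => g _; rewrite exprMn.
Qed.

Theorem hilbert17_plane F : psd F -> exists (c : {poly R}) (s : seq RXY),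
  (forall x, c.[x] != 0) /\ c%:P ^+ 2 * F = \sum_(g <- s) g ^+ 2.
Proof.
move=> /psd_sos_fraction /sos_clear_denominators[D [s [D0 e]]].
have [c [s' [c0 e']]] := cassels D0 e; exact: cancel_roots c0 e'.
Qed.
End Hilbert17.

(** * Zeros of plane polynomials *)

Section PlaneCurves.
Variable R : realType.
Local Notation RXY := {poly {poly R}}.
Implicit Types F G Q : RXY.

Definition isolated_zero G (x y : R) := ev2 idfun x y G = 0 /\
  exists2 e, 0 < e & forall x' y', `|x' - x| < e -> `|y' - y| < e ->
    ev2 idfun x' y' G = 0 -> x' = x /\ y' = y.

Lemma ev2_fiber G (x y : R) : (map_poly (horner_eval x) G).[y] = ev2 idfun x y G.
Proof. by rewrite ev2_idfun -[RHS]/(horner_eval x _) -horner_map /= /horner_eval hornerC. Qed.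

Lemma poly_nonroot_near (p : {poly R}) x : p.[x] != 0 ->
  exists2 d, 0 < d & forall y, `|y - x| < d -> 0 < p.[y] * p.[x].
Proof.
move=> px; have [|d d0 hd] := @poly_neg_right R (- (p.[x] *: p)) x.
  by rewrite hornerN hornerZ oppr_lt0 -expr2 lt_neqAle eq_sym expf_eq0 px sqr_ge0.
by exists d => // y /hd; rewrite hornerN hornerZ oppr_lt0 mulrC.
Qed.

(* A sign change across an isolated zero would propagate, by the intermediate value
   theorem, to zeros on the neighbouring vertical lines. *)
Lemma isolated_zero_deriv G x y : isolated_zero G x y -> ev2 idfun x y G^`() = 0.
Proof.
move=> [Gxy [e e0 iso]]; apply/eqP; apply: contrapT => /negP G'0.
pose p := map_poly (horner_eval x) G.
have py : p.[y] = 0 by rewrite ev2_fiber.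
have [q eq] : exists q, p = q * ('X - y%:P) by apply/factor_theorem/rootP.
have qy : q.[y] != 0.
  have : p^`().[y] != 0 by rewrite deriv_map ev2_fiber.
  by rewrite eq derivM derivXsubC hornerD !hornerM hornerXsubC subrr mulr0 add0r hornerC mulr1.
have [d d0 hd] := poly_nonroot_near qy.
pose r := Num.min d e / 2.
have r0 : 0 < r by rewrite divr_gt0 // lt_min d0.
have rlt : r < Num.min d e by rewrite ltr_pdivrMr ?ltr_pMr ?ltr1n // lt_min d0.
have [rd re] : r < d /\ r < e by apply/andP; rewrite -lt_min.
have sgn s : `|s| = r -> 0 < q.[y + s] * q.[y] by move=> sr; apply: hd; rewrite addrC addKr sr.
have q1 := sgn r (gtr0_norm r0).
have q2 : 0 < q.[y - r] * q.[y] by apply: sgn; rewrite normrN gtr0_norm.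
have pr : p.[y + r] * p.[y - r] < 0.
  rewrite eq !hornerM !hornerXsubC [y + r]addrC addrK [r + y]addrC.
  have -> : y - r - y = - r by ring.
  have -> : q.[y + r] * r * (q.[y - r] * - r) = - (q.[y + r] * q.[y - r] * r ^+ 2) by ring.
  rewrite oppr_lt0 mulr_gt0 ?exprn_gt0 //.
  have : 0 < (q.[y + r] * q.[y]) * (q.[y - r] * q.[y]) by rewrite mulr_gt0.
  have -> : (q.[y + r] * q.[y]) * (q.[y - r] * q.[y]) = (q.[y + r] * q.[y - r]) * q.[y] ^+ 2 by ring.
  by rewrite pmulr_lgt0 // lt_neqAle eq_sym expf_eq0 qy sqr_ge0.
pose P := G.[(y + r)%:P] * G.[(y - r)%:P].
have Px : P.[x] < 0 by rewrite hornerM -!ev2_idfun -!ev2_fiber.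
have [d' d'0 hd'] := poly_neg_right Px.
pose s := Num.min d' e / 2.
have s0 : 0 < s by rewrite divr_gt0 // lt_min d'0.
have slt : s < Num.min d' e by rewrite ltr_pdivrMr ?ltr_pMr ?ltr1n // lt_min d'0.
have [sd se] : s < d' /\ s < e by apply/andP; rewrite -lt_min.
have xs : `|x + s - x| = s by rewrite addrC addKr gtr0_norm.
have : P.[x + s] < 0 by apply: hd'; rewrite xs.
rewrite hornerM -!ev2_idfun -!ev2_fiber => sg.
have le : y - r <= y + r by rewrite lerD2l ge0_cp // ltW.
have [|z] := @poly_ivtoo _ (map_poly (horner_eval (x + s)) G) _ _ le; first by rewrite mulrC.
rewrite in_itv /= => /andP[z1 z2] /rootP; rewrite ev2_fiber => /iso h.
have [||e1 _] := h; first by rewrite xs.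
  by apply: lt_trans re; rewrite ltr_norml; apply/andP; split; [rewrite ltrBrDl|rewrite ltrBlDl].
by move: s0; rewrite -[s](addKr x) e1 addNr ltxx.
Qed.

(** For separable [G], both [G] and its derivative vanish at an isolated zero, hence so does [c].
    For [c G = q g^2], an isolated zero with [c.[x] != 0] is an isolated zero of [q] or of [g]. *)
Lemma isolated_zeros_abscissas G : G != 0 ->
  exists2 c : {poly R}, c != 0 & forall x y, isolated_zero G x y -> c.[x] = 0.
Proof.
have [n] := ubnP (size G); elim: n => // n IHn in G *; rewrite ltnS => sG G0.
have [sep|nsep] := boolP (separable_poly G).
  have [A [B [c [rel c0]]]] := separable_relation sep.
  exists c => // x y iz; have := congr1 (ev2 idfun x y) rel.
  rewrite rmorphD !rmorphM /= isolated_zero_deriv // (proj1 iz) !mulr0 addr0 ev2C hmE.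
  by rewrite map_poly_id.
have [c [q [g [[c0 q0 g0 e] [szq szg]]]]] := nonseparable_factor G0 nsep.
have [cq cq0 hq] := IHn q (leq_trans szq sG) q0.
have [cg cg0 hg] := IHn g (leq_trans szg sG) g0.
exists (c * cq * cg); first by rewrite !mulf_neq0.
move=> x y [Gxy [d d0 iso]]; rewrite !hornerM.
have [->|cx] := eqVneq c.[x] 0; first by rewrite !mul0r.
have ev x' y' : c.[x'] * ev2 idfun x' y' G = ev2 idfun x' y' q * ev2 idfun x' y' g ^+ 2.
  rewrite -rmorphXn -rmorphM -e -mul_polyC rmorphM /= ev2C; congr (_ * _).
  by rewrite hmE map_poly_id.
have [d' d'0 hd'] := poly_nonroot_near cx.
have iso' h : (forall x' y', ev2 idfun x' y' h = 0 -> c.[x'] * ev2 idfun x' y' G = 0) ->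
    ev2 idfun x y h = 0 -> isolated_zero h x y.
  move=> hG hxy; split=> //; exists (Num.min d d'); first by rewrite lt_min d0.
  move=> x' y'; rewrite lt_min => /andP[x1 x2] y1 /hG /eqP.
  have cx' : c.[x'] != 0 by apply: contraTneq (hd' _ x2) => ->; rewrite mul0r ltxx.
  rewrite mulf_eq0 (negPf cx') /= => /eqP; apply: iso => //.
  by apply: lt_le_trans y1 _; rewrite ge_min lexx.
have /eqP := ev x y; rewrite Gxy mulr0 eq_sym mulf_eq0 expf_eq0 /= => /orP[/eqP qz|/eqP gz].
  by rewrite (hq x y) ?mulr0 ?mul0r //; apply: iso' => // x' y' h; rewrite ev h mul0r.
by rewrite (hg x y) ?mulr0 //; apply: iso' => // x' y' h; rewrite ev h expr0n mulr0.
Qed.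

Lemma poly_roots_seq (p : {poly R}) : p != 0 -> exists s : seq R, forall x, p.[x] = 0 -> x \in s.
Proof.
have [n] := ubnP (size p); elim: n => // n IHn in p *; rewrite ltnS => sp p0.
have [[x px]|nr] := pselect (exists x, p.[x] = 0); last first.
  by exists [::] => x px; case: nr; exists x.
have [q eq] : exists q, p = q * ('X - x%:P) by apply/factor_theorem/rootP.
have q0 : q != 0 by apply: contraNneq p0 => q0; rewrite eq q0 mul0r.
have [|s hs] := IHn q _ q0.
  apply: leq_trans sp; rewrite eq size_mul ?polyXsubC_eq0 // size_XsubC addn2 /=.
  exact: leqnn.
exists (x :: s) => y; rewrite eq hornerM hornerXsubC => /eqP.
by rewrite mulf_eq0 subr_eq0 inE => /orP[/eqP /hs ->|->]; rewrite ?orbT.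
Qed.

Theorem isolated_zeros_finite G : (forall x y, ev2 idfun x y G = 0 -> isolated_zero G x y) ->
  exists s : seq (R * R), forall x y, ev2 idfun x y G = 0 -> (x, y) \in s.
Proof.
move=> iso; have fib0 x : map_poly (horner_eval x) G != 0.
  apply/eqP => G0; have z y : ev2 idfun x y G = 0 by rewrite -ev2_fiber G0 horner0.
  have [_ [e e0 he]] := iso x 0 (z 0).
  have e2 : 0 < e / 2 by rewrite divr_gt0.
  have [|||_] := he x (e / 2).
  - by rewrite subrr normr0.
  - by rewrite subr0 gtr0_norm // ltr_pdivrMr // ltr_pMr // ltr1n.
  - exact: z.
  by move/eqP; rewrite gt_eqF.
have [c c0 hc] : exists2 c : {poly R}, c != 0 & forall x y, isolated_zero G x y -> c.[x] = 0.
  by apply: isolated_zeros_abscissas; apply: contraNneq (fib0 0) => ->; rewrite map_poly0.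
have [s hs] := poly_roots_seq c0.
have /choice[ys hys] x := poly_roots_seq (fib0 x).
exists [seq (x, y) | x <- s, y <- ys x] => x y Gxy.
apply/allpairsPdep; exists x, y; split=> //; first by apply: hs; apply: (hc x y); apply: iso.
by apply: hys; rewrite ev2_fiber.
Qed.

(** [Q] is taken of least degree in [y], then with leading coefficient of least degree. By
    saturation its zero set contains no vertical line. Pseudo-division gives [c P = A Q]; while [c]
    vanishes at [x], so does [A] on that line, and a factor [X - x] cancels. In the end [c.[x] != 0]
    and [P] vanishes with [Q]. *)
Theorem saturated_ideal_zeros (I : RXY -> Prop) :
  (forall P Q, I P -> I Q -> I (P + Q)) -> (forall A P, I P -> I (A * P)) ->
  (forall a Q, I (('X - a%:P)%:P * Q) -> I Q) -> (exists2 Q, Q != 0 & I Q) ->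
  exists2 Q, I Q & forall x y, ev2 idfun x y Q = 0 -> forall P, I P -> ev2 idfun x y P = 0.
Proof.
move=> ID IM Isat [Q0 Q0n IQ0].
pose S n := `[< exists Q, [/\ Q != 0, I Q & size Q = n] >].
have exS : exists n, S n by exists (size Q0); apply/asboolP; exists Q0.
case: (ex_minnP exS) => n /asboolP[Q1 [Q1n IQ1 sQ1]] minn.
pose T k := `[< exists Q, [/\ Q != 0, I Q, size Q = n & size (lead_coef Q) = k] >].
have exT : exists k, T k by exists (size (lead_coef Q1)); apply/asboolP; exists Q1.
case: (ex_minnP exT) => k /asboolP[Q [Qn IQ sQ lQ]] mink.
exists Q => // x y Qxy P IP.
have Qx : map_poly (horner_eval x) Q != 0.
  apply/eqP => /fiber_eq0_factor[Q2 eQ2].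
  have Q2n : Q2 != 0 by apply: contraNneq Qn => e; rewrite eQ2 e mulr0.
  have lin0 : 'X - x%:P != 0 :> {poly R} by rewrite polyXsubC_eq0.
  have : (k <= size (lead_coef Q2))%N.
    apply: mink; apply/asboolP; exists Q2; split=> //; first by apply: (Isat x); rewrite -eQ2.
    by rewrite -sQ eQ2 mul_polyC size_scale.
  rewrite -lQ eQ2 lead_coefM lead_coefC size_mul ?lead_coef_eq0 // size_XsubC add2n /=.
  by rewrite ltnn.
have [c [A [c0 e]]] : exists (c : {poly R}) A, c != 0 /\ c%:P * P = A * Q.
  have eP := Pdiv.Idomain.divp_eq P Q.
  exists (lead_coef Q ^+ scalp P Q), (divp P Q); split; first by rewrite expf_neq0 // lead_coef_eq0.
  rewrite mul_polyC eP; suff -> : modp P Q = 0 by rewrite addr0.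
  apply/eqP; apply: contrapT => /negP m0.
  have : S (size (modp P Q)).
    apply/asboolP; exists (modp P Q); split=> //.
    have -> : modp P Q = (lead_coef Q ^+ scalp P Q)%:P * P + (- divp P Q) * Q.
      by rewrite mul_polyC eP mulNr addrAC subrr add0r.
    by apply: ID; apply: IM.
  by move/minn; rewrite -sQ leqNgt Pdiv.Idomain.ltn_modp Qn.
have [m] := ubnP (size c); elim: m => // m IHm in c A c0 e *; rewrite ltnS => sc.
have [cx|cx] := eqVneq c.[x] 0; last first.
  have := congr1 (ev2 idfun x y) e; rewrite !rmorphM /= Qxy mulr0 ev2C hmE map_poly_id // => /eqP.
  by rewrite mulf_eq0 (negPf cx) => /eqP.
have [c1 ec] : exists c1, c = c1 * ('X - x%:P) by apply/factor_theorem/rootP.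
have c10 : c1 != 0 by apply: contraNneq c0 => c10; rewrite ec c10 mul0r.
have /fiber_eq0_factor[A1 eA] : map_poly (horner_eval x) A = 0.
  have /eqP := congr1 (map_poly (horner_eval x)) e.
  rewrite !rmorphM /= map_polyC /= /horner_eval cx mul0r eq_sym mulf_eq0 (negPf Qx) orbF.
  by move/eqP.
apply: (IHm c1 A1) => //.
  have lin2 : ('X - x%:P)%:P != 0 :> RXY by rewrite polyC_eq0 polyXsubC_eq0.
  by apply: (mulfI lin2); rewrite mulrA -rmorphM /= mulrC [_ * c1]mulrC -ec mulrC e eA mulrA.
apply: leq_trans sc; rewrite ec size_mul ?polyXsubC_eq0 // size_XsubC addn2 /=.
exact: leqnn.
Qed.
End PlaneCurves.

End RealPlane.

(** * Polynomial functions and blowing-up *)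

(** Polynomiality is stated as a closure, so that composites with charts and translations need no
    coefficients; [pol2_is_poly2] restores a coefficient array. *)
Inductive polyfun {X : Type} (V : (X -> R) -> Prop) : (X -> R) -> Prop :=
| pf_const c : polyfun V (fun _ => c)
| pf_var v : V v -> polyfun V v
| pf_add f g : polyfun V f -> polyfun V g -> polyfun V (fun x => f x + g x)
| pf_mul f g : polyfun V f -> polyfun V g -> polyfun V (fun x => f x * g x)
| pf_ext f g : polyfun V f -> (forall x, f x = g x) -> polyfun V g.

Definition pol1 : (R -> R) -> Prop := polyfun (fun v => v = fun x => x).
Definition pol2 : (R2 -> R) -> Prop := polyfun (fun v => v = fst \/ v = snd).
Definition pol3 : (R * R2 -> R) -> Prop :=
  polyfun (fun v => v = fst \/ v = (fun p => fst (snd p)) \/ v = (fun p => snd (snd p))).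

Lemma pf_opp {X} (V : (X -> R) -> Prop) f : polyfun V f -> polyfun V (fun x => - f x).
Proof.
  intros H. apply pf_ext with (fun x => (-1) * f x); [|intros; ring].
  apply pf_mul; [apply pf_const|exact H].
Qed.

Lemma pf_sub {X} (V : (X -> R) -> Prop) f g :
  polyfun V f -> polyfun V g -> polyfun V (fun x => f x - g x).
Proof. intros Hf Hg. apply (pf_add V f (fun x => - g x)); [exact Hf|now apply pf_opp]. Qed.

Lemma pf_pow {X} (V : (X -> R) -> Prop) f n : polyfun V f -> polyfun V (fun x => f x ^ n).
Proof.
  intros H. induction n as [|n IH]; simpl; [apply pf_const|now apply (pf_mul V f)].
Qed.

Lemma pf_comp {X Y} (V : (X -> R) -> Prop) (W : (Y -> R) -> Prop) (h : Y -> X) f :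
  (forall v, V v -> polyfun W (fun y => v (h y))) -> polyfun V f -> polyfun W (fun y => f (h y)).
Proof.
  intros HV H. induction H as [c|v Hv|f g _ IHf _ IHg|f g _ IHf _ IHg|f g _ IHf E].
  - apply pf_const.
  - now apply HV.
  - now apply (pf_add W (fun y => f (h y)) (fun y => g (h y))).
  - now apply (pf_mul W (fun y => f (h y)) (fun y => g (h y))).
  - apply pf_ext with (fun y => f (h y)); [exact IHf|]. intros y; apply E.
Qed.

Lemma pol2_fst : pol2 fst. Proof. apply pf_var; auto. Qed.
Lemma pol2_snd : pol2 snd. Proof. apply pf_var; auto. Qed.

Ltac polyfun_tac :=
  repeat first
    [ assumption
    | apply pf_const | apply pf_opp | apply pf_sub | apply pf_add | apply pf_mul | apply pf_pow
    | apply pf_var; tauto ].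

Lemma pol2_pair f {X} (V : (X -> R) -> Prop) g h :
  pol2 f -> polyfun V g -> polyfun V h -> polyfun V (fun x => f (g x, h x)).
Proof.
  intros Hf Hg Hh. refine (pf_comp _ V (fun x => (g x, h x)) f _ Hf).
  intros v [-> | ->]; assumption.
Qed.

Lemma pol3_triple f {X} (V : (X -> R) -> Prop) g h k :
  pol3 f -> polyfun V g -> polyfun V h -> polyfun V k ->
  polyfun V (fun x => f (g x, (h x, k x))).
Proof.
  intros Hf Hg Hh Hk. refine (pf_comp _ V (fun x => (g x, (h x, k x))) f _ Hf).
  intros v [-> |[-> | ->]]; assumption.
Qed.

Lemma polyfun_bounded {X} (V : (X -> R) -> Prop) f M : polyfun V f ->
  exists B, 0 <= B /\ forall x, (forall v, V v -> Rabs (v x) <= M) -> Rabs (f x) <= B.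
Proof.
  intros H. induction H as [c|v Hv|f g _ [B [B0 HB]] _ [C [C0 HC]]|f g _ [B [B0 HB]] _ [C [C0 HC]]|f g _ [B [B0 HB]] E].
  - exists (Rabs c). split; [apply Rabs_pos|intros; lra].
  - exists (Rabs M). split; [apply Rabs_pos|]. intros x Hx.
    apply Rle_trans with M; [now apply Hx|apply Rle_abs].
  - exists (B + C). split; [lra|]. intros x Hx.
    apply Rle_trans with (1 := Rabs_triang _ _). specialize (HB x Hx). specialize (HC x Hx). lra.
  - exists (B * C). split; [nra|]. intros x Hx. rewrite Rabs_mult.
    apply Rmult_le_compat; auto using Rabs_pos.
  - exists B. split; [exact B0|]. intros x Hx. rewrite <- E. auto.
Qed.

Definition cont_at (f : R2 -> R) (z : R2) : Prop :=
  forall eps, 0 < eps -> exists delta, 0 < delta /\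
    forall w, Rabs (fst w - fst z) < delta -> Rabs (snd w - snd z) < delta ->
      Rabs (f w - f z) < eps.

Section ContinuityRules.
Import Hierarchy Continuity ElemFct.

Lemma cont_at_continuous (f : R2 -> R) z : cont_at f z <->
  continuous (U := R_UniformSpace) (f : prod_UniformSpace R_UniformSpace R_UniformSpace -> R) z.
Proof.
  split.
  - intros H P [eps HP]. destruct (H eps (cond_pos eps)) as [d [d0 Hd]].
    exists (mkposreal d d0). intros w [h1 h2]. apply HP. now apply Hd.
  - intros H eps He. destruct (H (fun y => Rabs (y - f z) < eps)) as [d Hd].
    + exists (mkposreal eps He). intros y Hy. exact Hy.
    + exists d. split; [apply cond_pos|]. intros w h1 h2. apply Hd. now split.
Qed.

Lemma cont_at_add f g z : cont_at f z -> cont_at g z -> cont_at (fun w => f w + g w) z.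
Proof. rewrite !cont_at_continuous. apply (continuous_plus (V := R_NormedModule)). Qed.

Lemma cont_at_sub f g z : cont_at f z -> cont_at g z -> cont_at (fun w => f w - g w) z.
Proof. rewrite !cont_at_continuous. apply (continuous_minus (V := R_NormedModule)). Qed.

Lemma cont_at_mult f g z : cont_at f z -> cont_at g z -> cont_at (fun w => f w * g w) z.
Proof. rewrite !cont_at_continuous. apply (continuous_mult (K := R_AbsRing)). Qed.

Lemma cont_at_div f g z : cont_at f z -> cont_at g z -> g z <> 0 -> cont_at (fun w => f w / g w) z.
Proof.
  rewrite !cont_at_continuous. intros Cf Cg Hg.
  apply (continuous_mult (K := R_AbsRing)); [exact Cf|].
  apply (continuous_comp g Rinv); [exact Cg|now apply continuous_Rinv].
Qed.
End ContinuityRules.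

Lemma pol2_continuous f : pol2 f -> continuous2 f.
Proof.
  intros H z. change (cont_at f z). induction H as [c|v [-> | ->]|f g _ IHf _ IHg|f g _ IHf _ IHg|f g _ IHf E].
  - intros eps He. exists 1. split; [lra|]. intros w _ _. rewrite Rminus_diag, Rabs_R0. exact He.
  - intros eps He. exists eps. now split.
  - intros eps He. exists eps. now split.
  - now apply cont_at_add.
  - now apply cont_at_mult.
  - intros eps He. destruct (IHf eps He) as [d [d0 Hd]]. exists d. split; [exact d0|].
    intros w h1 h2. rewrite <- !E. now apply Hd.
Qed.

Lemma pol1_continuity f : pol1 f -> continuity f.
Proof.
  intros H x. induction H as [c|v ->|f g _ IHf _ IHg|f g _ IHf _ IHg|f g _ IHf E].
  - apply continuity_pt_const. intros ? ?; reflexivity.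
  - apply derivable_continuous_pt, derivable_pt_id.
  - now apply (continuity_pt_plus f g).
  - now apply (continuity_pt_mult f g).
  - intros eps He. destruct (IHf eps He) as [d [d0 Hd]]. exists d. split; [exact d0|].
    intros y Hy. rewrite <- !E. now apply Hd.
Qed.

(** [w = (1, v)] and [w = (u, 1)] give the two charts of the blowing-up at [a], with exceptional
    divisor [s = 0]. *)
Definition ray (a : R2) (s : R) (w : R2) : R2 := (fst a + s * fst w, snd a + s * snd w).

Lemma continuity_ray f a w s : cont_at f (ray a s w) -> continuity_pt (fun s => f (ray a s w)) s.
Proof.
  intros Hf eps He. destruct (Hf eps He) as [d [d0 Hd]].
  set (N := Rabs (fst w) + Rabs (snd w) + 1).
  assert (N0 : 0 < N) by (unfold N; pose proof (Rabs_pos (fst w)); pose proof (Rabs_pos (snd w)); lra).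
  exists (d / N). split; [now apply Rdiv_lt_0_compat|].
  intros t [_ Ht]. simpl in *. unfold Rdist in *.
  assert (K : Rabs (t - s) * N < d).
  { apply Rlt_le_trans with (d / N * N); [apply Rmult_lt_compat_r; lra|].
    apply Req_le. field. lra. }
  apply Hd; simpl.
  - replace (fst a + t * fst w - (fst a + s * fst w)) with ((t - s) * fst w) by ring.
    rewrite Rabs_mult. apply Rle_lt_trans with (2 := K).
    apply Rmult_le_compat_l; [apply Rabs_pos|]. unfold N. pose proof (Rabs_pos (snd w)). lra.
  - replace (snd a + t * snd w - (snd a + s * snd w)) with ((t - s) * snd w) by ring.
    rewrite Rabs_mult. apply Rle_lt_trans with (2 := K).
    apply Rmult_le_compat_l; [apply Rabs_pos|]. unfold N. pose proof (Rabs_pos (fst w)). lra.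
Qed.

Lemma continuity_ge0 g d : continuity_pt g 0 -> 0 < d ->
  (forall s, 0 < Rabs s < d -> 0 <= g s) -> 0 <= g 0.
Proof.
  intros Hg d0 H. destruct (Rle_lt_dec 0 (g 0)) as [E|E]; [exact E|exfalso].
  destruct (Hg (- g 0)) as [e [e0 He]]; [lra|]. simpl in He. unfold Rdist in He.
  assert (m0 : 0 < Rmin d e) by now apply Rmin_glb_lt.
  assert (ml := Rmin_l d e). assert (mr := Rmin_r d e).
  assert (Es : Rabs (Rmin d e / 2) = Rmin d e / 2) by (apply Rabs_right; lra).
  specialize (H (Rmin d e / 2)). specialize (He (Rmin d e / 2)).
  rewrite Es in H. rewrite Rminus_0_r, Es in He.
  specialize (H ltac:(lra)). specialize (He ltac:(split; [split; [exact I|lra]|lra])).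
  apply Rabs_def2 in He. lra.
Qed.

Lemma continuity_eq0 h d : continuity_pt h 0 -> 0 < d ->
  (forall s, 0 < Rabs s < d -> h s = 0) -> h 0 = 0.
Proof.
  intros Hh d0 H.
  assert (A := continuity_ge0 h d Hh d0 ltac:(intros s Hs; cbv beta; rewrite H by exact Hs; lra)).
  assert (B := continuity_ge0 (fun s => - h s) d (continuity_pt_opp h 0 Hh) d0
    ltac:(intros s Hs; cbv beta; rewrite H by exact Hs; lra)).
  lra.
Qed.

Lemma pol3_slice K w : pol3 K -> pol1 (fun s => K (s, w)).
Proof.
  intros H. destruct w as [x y].
  apply (pol3_triple K _ (fun s => s) (fun _ => x) (fun _ => y) H).
  - now apply pf_var.
  - apply pf_const.
  - apply pf_const.
Qed.

Lemma pol3_slice_continuity K w s : pol3 K -> continuity_pt (fun s => K (s, w)) s.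
Proof. intros H. apply (pol1_continuity _ (pol3_slice K w H)). Qed.

Lemma pol3_init K : pol3 K -> pol3 (fun p => K (0, snd p)).
Proof.
  intros H.
  apply pf_ext with (fun p : R * R2 => K (0, (fst (snd p), snd (snd p)))).
  - apply (pol3_triple K _ (fun _ => 0) (fun p => fst (snd p)) (fun p => snd (snd p)) H); polyfun_tac.
  - now intros [s [x y]].
Qed.

Lemma pol3_div K : pol3 K ->
  exists K', pol3 K' /\ forall s w, K (s, w) = K (0, w) + s * K' (s, w).
Proof.
  intros H. induction H as [c|v Hv|f g Hf [f' [Pf Ef]] Hg [g' [Pg Eg]]|f g Hf [f' [Pf Ef]] Hg [g' [Pg Eg]]|f g _ [f' [Pf Ef]] E].
  - exists (fun _ => 0). split; [apply pf_const|intros; ring].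
  - destruct Hv as [-> |[-> | ->]]; simpl.
    + exists (fun _ => 1). split; [apply pf_const|intros; ring].
    + exists (fun _ => 0). split; [apply pf_const|intros; ring].
    + exists (fun _ => 0). split; [apply pf_const|intros; ring].
  - exists (fun p => f' p + g' p). split; [now apply pf_add|].
    intros s w. rewrite Ef, Eg. ring.
  - exists (fun p => f' p * g p + f (0, snd p) * g' p). split.
    + apply pf_add; apply pf_mul; auto. now apply pol3_init.
    + intros s w. simpl. rewrite (Ef s w). 
      replace (f (0, w) * g (0, w)) with (f (0, w) * (g (s, w) - s * g' (s, w))) by (rewrite (Eg s w); ring).
      ring.
  - exists f'. split; [exact Pf|]. intros s w. rewrite <- !E. apply Ef.
Qed.

(** [blow g a m K]: on the blowing-up of the plane at [a] the pull-back of [g] is [s ^ m * K];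
    the leading form of [g] at [a] is [w |-> K (0, w)]. *)
Definition blow (g : R2 -> R) (a : R2) (m : nat) (K : R * R2 -> R) : Prop :=
  pol3 K /\ forall s w, g (ray a s w) = s ^ m * K (s, w).

Definition lpd (g : R2 -> R) (a : R2) (m : nat) (K : R * R2 -> R) : Prop :=
  blow g a m K /\ forall w, w <> (0, 0) -> 0 < K (0, w).

Lemma ray_0 a w : ray a 0 w = a.
Proof. unfold ray. rewrite !Rmult_0_l, !Rplus_0_r. symmetry; apply surjective_pairing. Qed.

Lemma pol3_ray g a : pol2 g -> pol3 (fun p => g (ray a (fst p) (snd p))).
Proof.
  intros H.
  apply (pol2_pair g _ (fun p : R * R2 => fst a + fst p * fst (snd p)) (fun p => snd a + fst p * snd (snd p)) H);
    polyfun_tac.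
Qed.

Lemma blow_0 g a : pol2 g -> blow g a 0 (fun p => g (ray a (fst p) (snd p))).
Proof. intros H. split; [now apply pol3_ray|]. intros s w. simpl. ring. Qed.

Lemma lpd_0 g a : pol2 g -> 0 < g a -> lpd g a 0 (fun p => g (ray a (fst p) (snd p))).
Proof.
  intros H Ha. split; [now apply blow_0|]. intros w _. simpl. now rewrite ray_0.
Qed.

Lemma blow_S g a m K : blow g a m K -> (forall w, K (0, w) = 0) -> exists K', blow g a (S m) K'.
Proof.
  intros [PK EK] K0. destruct (pol3_div K PK) as [K' [PK' EK']].
  exists K'. split; [exact PK'|]. intros s w. rewrite EK, EK', K0. simpl. ring.
Qed.

Lemma blow_lower g a m k K : blow g a (m + S k) K ->
  exists K', blow g a m K' /\ forall w, K' (0, w) = 0.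
Proof.
  intros [PK EK]. exists (fun p => fst p ^ S k * K p). split.
  - split; [polyfun_tac|]. intros s w. rewrite EK, pow_add. simpl. ring.
  - intros w. simpl. ring.
Qed.

Lemma blow_mul g h a m n K K' : blow g a m K -> blow h a n K' ->
  blow (fun z => g z * h z) a (m + n) (fun p => K p * K' p).
Proof.
  intros [PK EK] [PK' EK']. split; [now apply pf_mul|].
  intros s w. rewrite EK, EK', pow_add. ring.
Qed.

Lemma blow_add g h a m K K' : blow g a m K -> blow h a m K' ->
  blow (fun z => g z + h z) a m (fun p => K p + K' p).
Proof.
  intros [PK EK] [PK' EK']. split; [now apply pf_add|].
  intros s w. rewrite EK, EK'. ring.
Qed.

Lemma blow_scal g a m K c : blow g a m K -> blow (fun z => c * g z) a m (fun p => c * K p).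
Proof.
  intros [PK EK]. split; [apply pf_mul; [apply pf_const|exact PK]|].
  intros s w. rewrite EK. ring.
Qed.

Lemma blow_ext g h a m K : blow g a m K -> (forall z, g z = h z) -> blow h a m K.
Proof. intros [PK EK] E. split; [exact PK|]. intros s w. rewrite <- E. apply EK. Qed.

Lemma lpd_mul g h a m n K K' : lpd g a m K -> lpd h a n K' ->
  lpd (fun z => g z * h z) a (m + n) (fun p => K p * K' p).
Proof.
  intros [B P] [B' P']. split; [now apply blow_mul|].
  intros w Hw. apply Rmult_lt_0_compat; auto.
Qed.

(** For [s <> 0], [s^m K(s, c w)] and [(c s)^m K(c s, w)] are both the value of [g] at [a + s c w];
    divide by [s^m] and let [s] tend to 0. *)
Lemma blow_homogeneous g a m K : blow g a m K ->
  forall c w, K (0, (c * fst w, c * snd w)) = c ^ m * K (0, w).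
Proof.
  intros [PK EK] c w.
  set (h := fun s => K (s, (c * fst w, c * snd w)) - c ^ m * K (c * s, w)).
  assert (H : h 0 = 0).
  { apply continuity_eq0 with 1; [|lra|].
    - unfold h. apply continuity_pt_minus; [now apply pol3_slice_continuity|].
      apply continuity_pt_mult; [apply continuity_pt_const; intros ? ?; reflexivity|].
      apply (continuity_pt_comp (fun s => c * s) (fun s => K (s, w))).
      + apply derivable_continuous_pt. apply derivable_pt_scal, derivable_pt_id.
      + now apply pol3_slice_continuity.
    - intros s [Hs _]. unfold h.
      assert (s0 : s <> 0) by (intros ->; rewrite Rabs_R0 in Hs; lra).
      assert (E : s ^ m * K (s, (c * fst w, c * snd w)) = (c * s) ^ m * K (c * s, w)).
      { rewrite <- !EK. f_equal. unfold ray. simpl. f_equal; ring. }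
      rewrite Rpow_mult_distr in E.
      assert (s ^ m <> 0) by now apply pow_nonzero.
      apply Rmult_eq_reg_l with (s ^ m); [|assumption].
      rewrite Rmult_0_r, Rmult_minus_distr_l, E. ring. }
  unfold h in H. rewrite Rmult_0_r in H. lra.
Qed.

(** The constants may depend on the ray: splitting off one more factor [s] only takes the vanishing
    of [K (0, w)] for each [w] separately. *)
Lemma blow_order g a m : pol2 g ->
  (forall w, exists B d, 0 < d /\ forall s, Rabs s < d -> Rabs (g (ray a s w)) <= B * Rabs s ^ m) ->
  exists K, blow g a m K.
Proof.
  intros Pg Hg.
  assert (H : forall j, (j <= m)%nat -> exists K, blow g a j K); [|now apply (H m)].
  induction j as [|j IH]; intros Hj; [eexists; now apply blow_0|].
  destruct IH as [K HK]; [lia|]. apply blow_S with K; [exact HK|].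
  intros w. destruct HK as [PK EK]. destruct (Hg w) as [B [d [d0 Hd]]].
  assert (G : 0 <= Rabs B * Rabs 0 - Rabs (K (0, w))).
  { apply (continuity_ge0 (fun s => Rabs B * Rabs s - Rabs (K (s, w))) (Rmin d 1)); [|apply Rmin_glb_lt; lra|].
    - apply (continuity_pt_minus (fun s => Rabs B * Rabs s) (fun s => Rabs (K (s, w)))).
      + apply (continuity_pt_scal Rabs). apply Rcontinuity_abs.
      + apply (continuity_pt_comp (fun s => K (s, w)) Rabs); [now apply pol3_slice_continuity|].
        apply Rcontinuity_abs.
    - intros s [s1 s2].
      assert (s3 : Rabs s < d) by (apply Rlt_le_trans with (1 := s2); apply Rmin_l).
      assert (s4 : Rabs s < 1) by (apply Rlt_le_trans with (1 := s2); apply Rmin_r).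
      specialize (Hd s s3). rewrite EK, Rabs_mult, <- RPow_abs in Hd.
      assert (p0 : 0 < Rabs s ^ j) by now apply pow_lt.
      replace m with (j + S (m - S j))%nat in Hd by lia. rewrite pow_add in Hd. simpl in Hd.
      assert (q1 : Rabs s ^ (m - S j) <= 1) by (rewrite <- (pow1 (m - S j)); apply pow_incr; lra).
      assert (q0 : 0 <= Rabs s ^ (m - S j)) by (apply pow_le; lra).
      assert (b1 := Rle_abs B). assert (b2 := Rabs_pos B).
      cut (Rabs (K (s, w)) <= Rabs B * Rabs s); [lra|].
      apply Rmult_le_reg_l with (Rabs s ^ j); [exact p0|]. apply Rle_trans with (1 := Hd).
      apply Rle_trans with (Rabs B * (Rabs s ^ j * (Rabs s * Rabs s ^ (m - S j)))).
      + apply Rmult_le_compat_r; [repeat apply Rmult_le_pos; lra|exact b1].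
      + replace (Rabs s ^ j * (Rabs B * Rabs s)) with (Rabs B * (Rabs s ^ j * (Rabs s * 1))) by ring.
        repeat (apply Rmult_le_compat_l; [lra|]). exact q1. }
  rewrite Rabs_R0, Rmult_0_r in G.
  apply NNPP. intros N. apply Rabs_pos_lt in N. lra.
Qed.

(** A compact set of directions whose rays reach every point. *)
Definition unit_dir (w : R2) : Prop :=
  (fst w = 1 /\ Rabs (snd w) <= 1) \/ (snd w = 1 /\ Rabs (fst w) <= 1).

Lemma unit_dir_bound w : unit_dir w -> Rabs (fst w) <= 1 /\ Rabs (snd w) <= 1.
Proof. intros [[-> H]|[-> H]]; rewrite Rabs_R1; split; lra. Qed.

Lemma ray_unit_dir a z d : z <> a -> Rabs (fst z - fst a) < d -> Rabs (snd z - snd a) < d ->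
  exists s w, unit_dir w /\ z = ray a s w /\ 0 < Rabs s < d.
Proof.
  intros Hz H1 H2. destruct z as [z1 z2], a as [a1 a2]. simpl in *.
  set (x := z1 - a1) in *. set (y := z2 - a2) in *.
  destruct (Rle_dec (Rabs y) (Rabs x)) as [L|L].
  - assert (x0 : x <> 0).
    { intros E. rewrite E, Rabs_R0 in L. apply Hz.
      assert (y = 0) by (destruct (Req_dec y 0); [assumption|pose proof (Rabs_pos_lt _ H); lra]).
      unfold x, y in *. f_equal; lra. }
    assert (px := Rabs_pos_lt _ x0).
    exists x, (1, y / x). repeat split; auto.
    + left. simpl. split; [reflexivity|]. unfold Rdiv. rewrite Rabs_mult, Rabs_inv.
      apply Rmult_le_reg_r with (Rabs x); [exact px|].
      rewrite Rmult_assoc, Rinv_l by lra. lra.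
    + unfold ray. simpl. f_equal; unfold x, y; field; exact x0.
  - assert (L' : Rabs x < Rabs y) by lra.
    assert (y0 : y <> 0) by (intros E; rewrite E, Rabs_R0 in L'; pose proof (Rabs_pos x); lra).
    assert (py := Rabs_pos_lt _ y0).
    exists y, (x / y, 1). repeat split; auto.
    + right. simpl. split; [reflexivity|]. unfold Rdiv. rewrite Rabs_mult, Rabs_inv.
      apply Rmult_le_reg_r with (Rabs y); [exact py|].
      rewrite Rmult_assoc, Rinv_l by lra. lra.
    + unfold ray. simpl. f_equal; unfold x, y; field; exact y0.
Qed.

Lemma Rabs_le_inv x y : Rabs x <= y -> - y <= x <= y.
Proof. unfold Rabs; destruct (Rcase_abs x); lra. Qed.

Lemma pol3_lower_bound K : pol3 K -> (forall w, w <> (0, 0) -> 0 < K (0, w)) ->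
  exists c d, 0 < c /\ 0 < d <= 1 /\ forall s w, Rabs s < d -> unit_dir w -> c <= K (s, w).
Proof.
  intros PK K0.
  assert (P1 : pol1 (fun v => K (0, (1, v)))).
  { apply (pol3_triple K _ (fun _ => 0) (fun _ => 1) (fun v => v) PK);
      [apply pf_const|apply pf_const|now apply pf_var]. }
  assert (P2 : pol1 (fun v => K (0, (v, 1)))).
  { apply (pol3_triple K _ (fun _ => 0) (fun v => v) (fun _ => 1) PK);
      [apply pf_const|now apply pf_var|apply pf_const]. }
  destruct (continuity_ab_min (fun v => K (0, (1, v))) (-1) 1) as [v1 [M1 _]];
    [lra|intros; now apply pol1_continuity|].
  destruct (continuity_ab_min (fun v => K (0, (v, 1))) (-1) 1) as [v2 [M2 _]];
    [lra|intros; now apply pol1_continuity|].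
  set (c := Rmin (K (0, (1, v1))) (K (0, (v2, 1)))).
  assert (c0 : 0 < c).
  { apply Rmin_glb_lt; apply K0; intros E; injection E; lra. }
  destruct (pol3_div K PK) as [K' [PK' EK']].
  destruct (polyfun_bounded _ K' 1 PK') as [B [B0 HB]].
  (* The bound 1 keeps [(s, w)] in the box where [K'] is at most [B]; the other makes [s * K'] at
     most [c / 2], with [B + 1] to avoid a zero denominator. *)
  exists (c / 2), (Rmin 1 (c / (2 * (B + 1)))).
  assert (x1 : 0 < c / (2 * (B + 1))) by (apply Rdiv_lt_0_compat; lra).
  split; [lra|]. split; [split; [apply Rmin_glb_lt; lra|apply Rmin_l]|].
  intros s w Hs Hw.
  assert (s1 : Rabs s < 1) by (apply Rlt_le_trans with (1 := Hs); apply Rmin_l).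
  assert (s2 : Rabs s < c / (2 * (B + 1))) by (apply Rlt_le_trans with (1 := Hs); apply Rmin_r).
  assert (h1 : c <= K (0, w)).
  { destruct w as [x y]. destruct Hw as [[Hx Hy]|[Hx Hy]]; simpl in *; subst.
    - apply Rle_trans with (1 := Rmin_l _ _). apply M1. now apply Rabs_le_inv.
    - apply Rle_trans with (1 := Rmin_r _ _). apply M2. now apply Rabs_le_inv. }
  assert (h2 : Rabs (K' (s, w)) <= B).
  { destruct (unit_dir_bound w Hw). apply HB. intros v [-> |[-> | ->]]; simpl; lra. }
  rewrite EK'.
  assert (h3 : Rabs (s * K' (s, w)) <= c / 2).
  { rewrite Rabs_mult. apply Rle_trans with (c / (2 * (B + 1)) * B).
    - apply Rmult_le_compat; auto using Rabs_pos; lra.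
    - apply Rle_trans with (c / (2 * (B + 1)) * (B + 1)); [nra|]. apply Req_le. field. lra. }
  apply Rabs_le_inv in h3. lra.
Qed.

Lemma lpd_nonzero_near g a m K : lpd g a m K ->
  exists d, 0 < d /\ forall z, z <> a -> Rabs (fst z - fst a) < d -> Rabs (snd z - snd a) < d -> g z <> 0.
Proof.
  intros [[PK EK] K0]. destruct (pol3_lower_bound K PK K0) as [c [d [c0 [[d0 _] H]]]].
  exists d. split; [exact d0|]. intros z Hz H1 H2.
  destruct (ray_unit_dir a z d Hz H1 H2) as [s [w [Hw [-> [s0 s1]]]]].
  rewrite EK. apply Rmult_integral_contrapositive_currified.
  - apply pow_nonzero. intros ->. rewrite Rabs_R0 in s0. lra.
  - specialize (H s w s1 Hw). lra.
Qed.

Lemma lpd_ray_nonzero g a m K w : lpd g a m K -> w <> (0, 0) ->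
  exists d, 0 < d /\ forall s, 0 < Rabs s < d -> K (s, w) <> 0 /\ g (ray a s w) <> 0.
Proof.
  intros [[PK EK] K0] Hw. specialize (K0 w Hw).
  destruct (pol3_slice_continuity K w 0 PK (K (0, w)) K0) as [d [d0 Hd]].
  simpl in Hd. unfold Rdist in Hd. exists d. split; [exact d0|]. intros s [s0 s1].
  assert (sn : s <> 0) by (intros ->; rewrite Rabs_R0 in s0; lra).
  assert (h : Rabs (K (s, w) - K (0, w)) < K (0, w)).
  { apply Hd. split; [split; [exact I|lra]|now rewrite Rminus_0_r]. }
  assert (k : K (s, w) <> 0) by (apply Rabs_def2 in h; lra).
  split; [exact k|]. rewrite EK. apply Rmult_integral_contrapositive_currified; [|exact k].
  now apply pow_nonzero.
Qed.

(** * Passage between polynomial functions and formal polynomials *)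

Module Bridge.
Import HB.structures all_boot all_order all_algebra all_field.
Import boolp classical_sets reals Rstruct.
Import Order.TTheory GRing.Theory Num.Theory.
Import RealPlane.
Set Implicit Arguments.
Unset Strict Implicit.
Unset Printing Implicit Defensive.
Local Open Scope ring_scope.

Local Notation RR := (Rdefinitions.R : realType).
Local Notation RXY := {poly {poly Rdefinitions.R}}.

Definition represents (g : R2 -> Rdefinitions.R) (G : RXY) := forall z : R2, ev2 idfun z.1 z.2 G = g z.

Lemma pol2_represented g : pol2 g -> exists G, represents g G.
Proof.
elim=> {g} [c|v [->|->]|f g _ [F hF] _ [G hG]|f g _ [F hF] _ [G hG]|f g _ [F hF] e].
- by exists c%:P%:P => z; rewrite ev2C hmC.
- by exists ('X%:P) => z; rewrite ev2C hmX.
- by exists 'X => z; rewrite ev2X.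
- by exists (F + G) => z; rewrite rmorphD /= hF hG.
- by exists (F * G) => z; rewrite rmorphM /= hF hG.
- by exists F => z; rewrite hF e.
Qed.

Lemma represented_pol2 g G : represents g G -> pol2 g.
Proof.
move=> hG; apply: (@pf_ext _ _ (fun z : R2 => ev2 idfun z.1 z.2 G)) => // {g hG}.
elim/poly_ind: G => [|G c IH].
  by apply: (@pf_ext _ _ (fun _ => 0)); [exact: pf_const|move=> z; rewrite rmorph0].
apply: (@pf_ext _ _ (fun z : R2 => (ev2 idfun z.1 z.2 G * z.2) + hm idfun z.1 c)).
  apply: pf_add; first by apply: pf_mul => //; exact: pol2_snd.
  elim/poly_ind: c => [|c b IHc].
    by apply: (@pf_ext _ _ (fun _ => 0)); [exact: pf_const|move=> z; rewrite rmorph0].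
  apply: (@pf_ext _ _ (fun z : R2 => (hm idfun z.1 c * z.1) + b)).
    by apply: pf_add; [apply: pf_mul => //; exact: pol2_fst|exact: pf_const].
  by move=> z; rewrite rmorphD rmorphM /= hmC hmX.
by move=> z; rewrite rmorphD rmorphM /= ev2C ev2X.
Qed.

Lemma rsum_bigE n (f : nat -> Rdefinitions.R) : rsum n f = \sum_(i < n.+1) f i.
Proof.
rewrite /rsum; elim: n => [|n IHn] /=; first by rewrite big_ord1.
rewrite RplusE IHn [RHS]big_ord_recr /=; reflexivity.
Qed.

Lemma pol2_is_poly2 g : pol2 g -> exists P : poly2, forall z, ev P z = g z.
Proof.
move=> /pol2_represented[G hG].
pose N := (size G + \max_(j < size G) size (G`_j)%R)%N.
exists (Poly2 N (fun i j => G`_j`_i)) => z; rewrite -hG /ev /=.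
have sG : (size G <= N.+1)%N by rewrite leqW // leq_addr.
rewrite rsum_bigE /ev2 (hm_sum _ _ sG).
transitivity (\sum_(j < N.+1) \sum_(i < N.+1) (G`_j`_i * z.1 ^+ i) * z.2 ^+ j).
  rewrite exchange_big; apply: eq_bigr => i _; rewrite rsum_bigE; apply: eq_bigr => j _.
  by rewrite -!RpowE.
apply: eq_bigr => j _; rewrite -mulr_suml; congr (_ * _).
rewrite (@hm_sum _ _ idfun z.1 G`_j N.+1) //.
have [jG|jG] := ltnP j (size G); last by rewrite nth_default // size_poly0.
apply: leqW; apply: leq_trans (leq_addl _ _).
exact: (leq_bigmax (Ordinal jG)).
Qed.

Lemma sum_sq_funs_bigE (s : seq RXY) z :
  sum_sq_funs [seq (fun z : R2 => ev2 idfun z.1 z.2 g) | g <- s] z = ev2 idfun z.1 z.2 (\sum_(g <- s) g ^+ 2).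
Proof.
rewrite rmorph_sum /=; elim: s => [|g s IH]; first by rewrite big_nil.
by rewrite big_cons -IH /= rmorphXn /= expr2 Rmult_1_r.
Qed.

Lemma psd_pol2_sum_sq F : pol2 F -> (forall z, Rle 0 (F z)) ->
  exists (c : R2 -> Rdefinitions.R) (rs : list (R2 -> Rdefinitions.R)),
    [/\ pol2 c, forall z, c z <> 0, Forall pol2 rs &
    forall z, Rmult (Rmult (c z) (c z)) (F z) = sum_sq_funs rs z].
Proof.
move=> /pol2_represented[G hG] F0.
have [|c [s [c0 e]]] := @hilbert17_plane _ G.
  by move=> x y; rewrite -ev2_idfun (hG (x, y)); apply/RleP.
exists (fun z => ev2 idfun z.1 z.2 c%:P), [seq (fun z : R2 => ev2 idfun z.1 z.2 g) | g <- s].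
split.
- by apply: (@represented_pol2 _ c%:P).
- by move=> z; rewrite ev2C hmE map_poly_id //; apply/eqP.
- by elim: s {e} => [|g s IH] /=; constructor => //; apply: (@represented_pol2 _ g).
- by move=> z; rewrite sum_sq_funs_bigE -e rmorphM rmorphXn /= hG expr2.
Qed.

Lemma In_mem (T : eqType) (x : T) (s : seq T) : x \in s -> List.In x s.
Proof. by elim: s => //= y s IH; rewrite inE => /orP[/eqP ->|/IH]; auto. Qed.

Lemma isolated_zeros_list q : pol2 q ->
  (forall a, q a = 0 -> exists d, Rlt 0 d /\ forall z, z <> a ->
     Rlt (Rabs (Rminus (fst z) (fst a))) d -> Rlt (Rabs (Rminus (snd z) (snd a))) d -> q z <> 0) ->
  exists Z, NoDup Z /\ forall z, q z = 0 -> List.In z Z.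
Proof.
move=> /pol2_represented[G hG] iso.
have [|s hs] := @isolated_zeros_finite _ G.
  move=> x y /=; rewrite (hG (x, y)) => qxy; split; first by rewrite (hG (x, y)).
  have [d [/RltP d0 hd]] := iso _ qxy; exists d => // x' y' h1 h2; rewrite (hG (x', y')) => q'.
  have [[-> ->] //|ne] := pselect ((x', y') = (x, y)).
  by case: (hd (x', y') ne _ _ q'); apply/RltP.
exists (nodup (fun x y => pselect (x = y)) s); split; first exact: NoDup_nodup.
by move=> [x y] qz; apply/nodup_In/In_mem/hs; rewrite (hG (x, y)).
Qed.

Lemma pol1_represented g : pol1 g -> exists p : {poly Rdefinitions.R}, forall x, p.[x] = g x.
Proof.
elim=> {g} [c|v ->|f g _ [F hF] _ [G hG]|f g _ [F hF] _ [G hG]|f g _ [F hF] e].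
- by exists c%:P => z; rewrite hornerC.
- by exists 'X => z; rewrite hornerX.
- by exists (F + G) => z; rewrite hornerD hF hG.
- by exists (F * G) => z; rewrite hornerM hF hG.
- by exists F => z; rewrite hF e.
Qed.

Lemma pol1_zeros_list g : pol1 g -> (exists x, g x <> 0) -> exists s, forall x, g x = 0 -> List.In x s.
Proof.
move=> /pol1_represented[p hp] [x gx].
have [|s hs] := @poly_roots_seq RR p; last by exists s => y gy; apply/In_mem/hs; rewrite hp.
by apply/eqP => p0; apply: gx; rewrite -hp p0 horner0.
Qed.

Lemma poly_nonroot_right (R : realType) (q : {poly R}) x e : q != 0 -> 0 < e ->
  exists x1, [/\ x < x1, x1 < x + e & q.[x1] != 0].
Proof.
move=> q0 e0; have [|x1 [x01 x1e qx1]] := @neg_nonroot R ('X - (x + e)%:P) q x _ q0.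
  by rewrite hornerXsubC opprD addrA subrr sub0r oppr_lt0.
by exists x1; split=> //; move: x1e; rewrite hornerXsubC subr_lt0.
Qed.

Lemma pol2_nonzero_dense E : pol2 E -> (exists w, E w <> 0) -> forall z d, Rlt 0 d ->
  exists z', [/\ Rlt (Rabs (Rminus (fst z') (fst z))) d, Rlt (Rabs (Rminus (snd z') (snd z))) d & E z' <> 0].
Proof.
move=> /pol2_represented[G hG] [w Ew] [x y] d /RltP d0.
have G0 : lead_coef G != 0.
  by rewrite lead_coef_eq0; apply/eqP => G0; apply: Ew; rewrite -hG G0 rmorph0.
have [x1 [xx1 x1d Gx1]] := @poly_nonroot_right RR _ x d G0 d0.
have Gx0 : map_poly (horner_eval x1) G != 0.
  apply: contraNneq Gx1 => /(congr1 (fun p : {poly Rdefinitions.R} => p`_(size G).-1)).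
  by rewrite coef_map coef0 /= /horner_eval lead_coefE => ->.
have [y1 [yy1 y1d Gy1]] := @poly_nonroot_right RR _ y d Gx0 d0.
have near (u v : RR) : u < v -> v < u + d -> Rlt (Rabs (Rminus v u)) d.
  move=> uv vd; apply/RltP; rewrite /GRing.add.
  change (`|v - u| < d); rewrite gtr0_norm ?subr_gt0 // ltrBlDl //.
exists (x1, y1); split; [exact: near|exact: near|].
by rewrite -hG /= -ev2_fiber; apply/eqP.
Qed.

Lemma saturated_ideal_common_zeros (I : (R2 -> Rdefinitions.R) -> Prop) :
  (forall P, I P -> pol2 P) -> (forall P Q, I P -> (forall z, P z = Q z) -> I Q) ->
  (forall P Q, I P -> I Q -> I (fun z => Rplus (P z) (Q z))) ->
  (forall A P, pol2 A -> I P -> I (fun z => Rmult (A z) (P z))) ->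
  (forall a Q, pol2 Q -> I (fun z => Rmult (Rminus (fst z) a) (Q z)) -> I Q) ->
  (exists2 Q, I Q & exists z, Q z <> 0) ->
  exists2 Q, I Q & forall z, Q z = 0 -> forall P, I P -> P z = 0.
Proof.
move=> Ipol Iext ID IM Isat [Q0 IQ0 [z0 Q0z]].
pose evf (G : RXY) (z : R2) := ev2 idfun z.1 z.2 G.
have evp G : pol2 (evf G) by apply: (@represented_pol2 _ G).
have [|||| Q IQ hQ] := @saturated_ideal_zeros RR (fun G => I (evf G)).
- by move=> P Q IP IQ; apply: Iext (ID _ _ IP IQ) _ => z; rewrite /evf rmorphD.
- by move=> A P IP; apply: Iext (IM _ _ (evp A) IP) _ => z; rewrite /evf rmorphM.
- move=> a Q IQ; apply: (Isat a) => //; apply: Iext IQ _ => z.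
  by rewrite /evf rmorphM /= ev2C rmorphB /= hmX hmC.
- have [G hG] := pol2_represented (Ipol _ IQ0); exists G.
    by apply/eqP => G0; apply: Q0z; rewrite -hG G0 rmorph0.
  by apply: Iext IQ0 _ => z; rewrite /evf hG.
exists (evf Q) => // -[x y] Qz P IP.
have [G hG] := pol2_represented (Ipol _ IP).
rewrite -(hG (x, y)); apply: hQ => //; apply: Iext IP _ => z; by rewrite /evf hG.
Qed.

End Bridge.

(** * Correction of the denominators *)

Lemma sum_sq_nonneg fs z : 0 <= sum_sq_funs fs z.
Proof.
  induction fs as [|g fs IH]; simpl; [lra|]. pose proof (pow2_ge_0 (g z)). simpl in *. lra.
Qed.

Lemma sum_sq_app fs gs z : sum_sq_funs (fs ++ gs) z = sum_sq_funs fs z + sum_sq_funs gs z.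
Proof. induction fs as [|g fs IH]; simpl; [ring|]. rewrite IH. ring. Qed.

Lemma sum_sq_member fs g z : In g fs -> g z ^ 2 <= sum_sq_funs fs z.
Proof.
  induction fs as [|h fs IH]; intros []; simpl.
  - subst. pose proof (sum_sq_nonneg fs z). simpl. lra.
  - specialize (IH H). pose proof (pow2_ge_0 (h z)). simpl in *. lra.
Qed.

Lemma sum_sq_map_scal (h : R2 -> R) fs z :
  sum_sq_funs (map (fun g z => h z * g z) fs) z = h z ^ 2 * sum_sq_funs fs z.
Proof. induction fs as [|g fs IH]; simpl; [ring|]. rewrite IH. ring. Qed.

Definition prod_funs (ps qs : list (R2 -> R)) : list (R2 -> R) :=
  flat_map (fun p => map (fun q z => p z * q z) qs) ps.

Lemma sum_sq_prod ps qs z : sum_sq_funs (prod_funs ps qs) z = sum_sq_funs ps z * sum_sq_funs qs z.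
Proof.
  induction ps as [|p ps IH]; simpl; [ring|]. 
  rewrite sum_sq_app, IH, (sum_sq_map_scal p). ring.
Qed.

Lemma prod_funs_pol2 ps qs : Forall pol2 ps -> Forall pol2 qs -> Forall pol2 (prod_funs ps qs).
Proof.
  intros Hp Hq. apply Forall_forall. intros g Hg. apply in_flat_map in Hg.
  destruct Hg as [p [Ip Hg]]. apply in_map_iff in Hg. destruct Hg as [q [<- Iq]].
  apply pf_mul; [now apply (proj1 (Forall_forall _ _) Hp)|now apply (proj1 (Forall_forall _ _) Hq)].
Qed.

Section Lagrange.
Variable T : Type.
Variables r b : T -> R.
Fixpoint sum_list (F : T -> R) (l : list T) : R :=
  match l with [] => 0 | x :: l => F x + sum_list F l end.

Lemma sum_list_cross_row x l :
  sum_list (fun y => (r x * b y - r y * b x) ^ 2) l =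
  r x ^ 2 * sum_list (fun y => b y ^ 2) l - 2 * (r x * b x) * sum_list (fun y => r y * b y) l
  + b x ^ 2 * sum_list (fun y => r y ^ 2) l.
Proof. induction l as [|y l IH]; simpl; [ring|]. simpl in IH. rewrite IH. ring. Qed.

(** Two lists are used so that the induction runs on one of them. For [l = l'] each unordered pair
    is counted twice. *)
Lemma sum_list_lagrange l l' :
  sum_list (fun x => sum_list (fun y => (r x * b y - r y * b x) ^ 2) l') l =
  sum_list (fun y => r y ^ 2) l * sum_list (fun y => b y ^ 2) l'
  + sum_list (fun y => b y ^ 2) l * sum_list (fun y => r y ^ 2) l'
  - 2 * sum_list (fun y => r y * b y) l * sum_list (fun y => r y * b y) l'.
Proof.
  induction l as [|x l IH]; [simpl; ring|].
  cbn [sum_list]. rewrite IH, sum_list_cross_row. ring.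
Qed.
End Lagrange.
Arguments sum_list {T}.

Lemma sum_sq_map {T} (F : T -> R2 -> R) l z : sum_sq_funs (map F l) z = sum_list (fun x => F x z ^ 2) l.
Proof. induction l as [|x l IH]; simpl; [reflexivity|]. rewrite IH. reflexivity. Qed.

Lemma sum_sq_flat_map {T U} (F : T -> U -> R2 -> R) l l' z :
  sum_sq_funs (flat_map (fun x => map (F x) l') l) z =
  sum_list (fun x => sum_list (fun y => F x y z ^ 2) l') l.
Proof.
  induction l as [|x l IH]; simpl; [reflexivity|]. now rewrite sum_sq_app, IH, sum_sq_map.
Qed.

Lemma sum_list_ext {T} (F G : T -> R) l : (forall x, In x l -> F x = G x) -> sum_list F l = sum_list G l.
Proof.
  induction l as [|x l IH]; intros H; simpl; [reflexivity|].
  rewrite (H x), IH; auto with datatypes.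
Qed.

Lemma sum_list_scal {T} (F : T -> R) c l : sum_list (fun x => c * F x) l = c * sum_list F l.
Proof. induction l as [|x l IH]; simpl; [ring|]. rewrite IH. ring. Qed.

(** [good r a M KD]: the quotient of [r] by a [D] with [lpd D a M KD] extends continuously to [a]. *)
Definition good (r : R2 -> R) (a : R2) (M : nat) (KD : R * R2 -> R) : Prop :=
  exists K c, blow r a M K /\ forall w, K (0, w) = c * KD (0, w).

Lemma good_add r r' a M KD : good r a M KD -> good r' a M KD -> good (fun z => r z + r' z) a M KD.
Proof.
  intros [K [c [B E]]] [K' [c' [B' E']]]. exists (fun p => K p + K' p), (c + c').
  split; [now apply blow_add|]. intros w. rewrite E, E'. ring.
Qed.

Lemma good_scal r a M KD k : good r a M KD -> good (fun z => k * r z) a M KD.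
Proof.
  intros [K [c [B E]]]. exists (fun p => k * K p), (k * c).
  split; [now apply blow_scal|]. intros w. rewrite E. ring.
Qed.

Lemma good_ext r r' a M KD : good r a M KD -> (forall z, r z = r' z) -> good r' a M KD.
Proof. intros [K [c [B E]]] H. exists K, c. split; [now apply blow_ext with r|exact E]. Qed.

Lemma good_mul_unit r a M KD g h : good r a M KD -> pol2 g -> pol2 h -> h a <> 0 ->
  good (fun z => r z * g z) a (M + 0) (fun p => KD p * h (ray a (fst p) (snd p))).
Proof.
  intros [K [c [B E]]] Pg Ph Ha.
  exists (fun p => K p * g (ray a (fst p) (snd p))), (c * g a / h a). split.
  - apply blow_mul; [exact B|now apply blow_0].
  - intros w. simpl. rewrite ray_0, E. field. exact Ha.
Qed.

Lemma sq_le_abs x y : x ^ 2 <= y ^ 2 -> Rabs x <= Rabs y.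
Proof.
  intros H. apply Rsqr_le_abs_0. unfold Rsqr. simpl in H. lra.
Qed.

(** [f] is bounded near [a], so [r] is of order [s^M] along each ray, and [blow_order] applies. *)
Lemma blow_of_sq_le f r D a M KD : cont_at f a -> (forall z, 0 <= f z) -> pol2 r -> blow D a M KD ->
  (forall z, r z ^ 2 <= f z * D z ^ 2) -> exists K, blow r a M K.
Proof.
  intros Cf f0 Pr [PK EK] H. apply blow_order; [exact Pr|].
  intros w.
  assert (C1 : continuity_pt (fun s => f (ray a s w)) 0) by (apply continuity_ray; now rewrite ray_0).
  assert (C2 := pol3_slice_continuity KD w 0 PK).
  destruct (C1 1 Rlt_0_1) as [d1 [d10 H1]]. destruct (C2 1 Rlt_0_1) as [d2 [d20 H2]].
  simpl in H1, H2. unfold Rdist in H1, H2.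
  set (A := f a + 1). set (B := Rabs (KD (0, w)) + 1).
  assert (A0 : 0 <= A) by (unfold A; specialize (f0 a); lra).
  exists (sqrt A * B), (Rmin d1 d2). split; [now apply Rmin_glb_lt|].
  intros s Hs.
  assert (s1 : Rabs s < d1) by (apply Rlt_le_trans with (1 := Hs); apply Rmin_l).
  assert (s2 : Rabs s < d2) by (apply Rlt_le_trans with (1 := Hs); apply Rmin_r).
  assert (h1 : f (ray a s w) <= A).
  { destruct (Req_dec s 0) as [->|sn]; [rewrite ray_0; unfold A; lra|].
    assert (h : Rabs (f (ray a s w) - f (ray a 0 w)) < 1).
    { apply H1. split; [split; [exact I|lra]|now rewrite Rminus_0_r]. }
    rewrite ray_0 in h. apply Rabs_def2 in h. unfold A. lra. }
  assert (h2 : Rabs (KD (s, w)) <= B).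
  { destruct (Req_dec s 0) as [->|sn]; [unfold B; lra|].
    assert (h : Rabs (KD (s, w) - KD (0, w)) < 1).
    { apply H2. split; [split; [exact I|lra]|now rewrite Rminus_0_r]. }
    pose proof (Rabs_triang_inv (KD (s, w)) (KD (0, w))). unfold B. lra. }
  specialize (H (ray a s w)). rewrite EK in H.
  assert (h3 : r (ray a s w) ^ 2 <= (sqrt A * (s ^ M * KD (s, w))) ^ 2).
  { apply Rle_trans with (1 := H). rewrite (Rpow_mult_distr (sqrt A)), pow2_sqrt by exact A0.
    apply Rmult_le_compat_r; [apply pow2_ge_0|exact h1]. }
  apply sq_le_abs in h3. apply Rle_trans with (1 := h3).
  rewrite !Rabs_mult, <- RPow_abs, (Rabs_right (sqrt A)) by (apply Rle_ge, sqrt_pos).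
  rewrite Rmult_assoc. apply Rmult_le_compat_l; [apply sqrt_pos|].
  rewrite Rmult_comm. apply Rmult_le_compat_r; [apply pow_le, Rabs_pos|exact h2].
Qed.

(** The identity is divided by [s^(2 M)] on a ray, and [s] tends to 0; this uses the continuity of
    [f]. *)
Lemma leading_forms f D a M KD (l : list ((R2 -> R) * (R * R2 -> R))) :
  cont_at f a -> blow D a M KD -> (forall x, In x l -> blow (fst x) a M (snd x)) ->
  (forall z, f z * D z ^ 2 = sum_list (fun x => fst x z ^ 2) l) ->
  forall w, f a * KD (0, w) ^ 2 = sum_list (fun x => snd x (0, w) ^ 2) l.
Proof.
  intros Cf [PK EK] Hl H w.
  set (h := fun s => f (ray a s w) * KD (s, w) ^ 2 - sum_list (fun x => snd x (s, w) ^ 2) l).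
  assert (E : h 0 = 0); [|unfold h in E; rewrite ray_0 in E; lra].
  apply continuity_eq0 with 1; [|lra|].
  - unfold h. apply continuity_pt_minus.
    + apply continuity_pt_mult; [apply continuity_ray; now rewrite ray_0|].
      apply (pol1_continuity (fun s => KD (s, w) ^ 2)). apply pf_pow. now apply pol3_slice.
    + clear h H. induction l as [|x l IH]; simpl.
      * apply continuity_pt_const. intros ? ?; reflexivity.
      * apply (continuity_pt_plus (fun s => snd x (s, w) ^ 2)).
        { apply (pol1_continuity (fun s => snd x (s, w) ^ 2)). apply pf_pow, pol3_slice.
          destruct (Hl x); auto with datatypes. }
        { apply IH. intros y Hy. apply Hl. now right. }
  - intros s [s0 _].
    assert (sn : s <> 0) by (intros ->; rewrite Rabs_R0 in s0; lra).
    assert (p0 : (s ^ M) ^ 2 <> 0) by (now apply pow_nonzero, pow_nonzero).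
    apply Rmult_eq_reg_l with ((s ^ M) ^ 2); [|exact p0].
    unfold h. rewrite Rmult_0_r, Rmult_minus_distr_l, <- sum_list_scal.
    rewrite (sum_list_ext _ (fun x => fst x (ray a s w) ^ 2)).
    + rewrite <- H, EK. ring.
    + intros x Hx. destruct (Hl x Hx) as [_ ->]. ring.
Qed.

Lemma blow_list f rs D a M KD : cont_at f a -> (forall z, 0 <= f z) -> Forall pol2 rs -> blow D a M KD ->
  (forall z, f z * D z ^ 2 = sum_sq_funs rs z) ->
  exists l, map fst l = rs /\ forall x, In x l -> blow (fst x) a M (snd x).
Proof.
  intros Cf f0 Pr BD H.
  assert (Hr : forall r, In r rs -> exists K, blow r a M K).
  { intros r Ir. apply (blow_of_sq_le f r D a M KD); auto.
    - now apply (proj1 (Forall_forall _ _) Pr).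
    - intros z. rewrite H. now apply sum_sq_member. }
  clear - Hr. induction rs as [|r rs IH].
  - exists []. split; [reflexivity|intros x []].
  - destruct (Hr r) as [K HK]; [now left|].
    destruct IH as [l [El Hl]]; [intros; apply Hr; now right|].
    exists ((r, K) :: l). split; [simpl; now rewrite El|].
    intros x [<-|Hx]; [exact HK|now apply Hl].
Qed.

(** The correction of a representation [f D ^ 2 = sum r ^ 2] at a point [a] where [f a <> 0]:
    multiply by the leading form [h] of [D] at [a], using that the leading forms [b] of the [r]
    satisfy [sum b ^ 2 = f a * h ^ 2], and rewrite the product by Lagrange's identity. The
    cross terms have order larger than [D * h] at [a]. *)
Lemma correction f D rs a M KD c h Kh :
  continuous2 f -> (forall z, 0 <= f z) -> f a <> 0 -> Forall pol2 rs ->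
  (forall z, f z * D z ^ 2 = sum_sq_funs rs z) -> lpd D a M KD ->
  0 < c -> (forall w, KD (0, w) = c * Kh (0, w)) -> blow h a M Kh -> 
  let ha := fun z => Kh (0, (fst z - fst a, snd z - snd a)) in
  exists rs', Forall pol2 rs' /\ (forall z, f z * (D z * ha z) ^ 2 = sum_sq_funs rs' z) /\
    (exists KD', lpd (fun z => D z * ha z) a (M + M) KD' /\ forall r, In r rs' -> good r a (M + M) KD') /\
    (forall b N KDb, b <> a -> (forall r, In r rs -> good r b N KDb) -> ha b <> 0 ->
       forall r, In r rs' -> good r b (N + 0) (fun p => KDb p * ha (ray b (fst p) (snd p)))).
Proof.
  intros Cf f0 fa Pr H LD c0 Ec Bh ha.
  assert (fa0 : 0 < f a) by (specialize (f0 a); lra).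
  destruct (blow_list f rs D a M KD (Cf a) f0 Pr (proj1 LD) H) as [l [El Hl]].
  set (N := sqrt (f a) * c).
  assert (N0 : 0 < N) by (apply Rmult_lt_0_compat; [now apply sqrt_lt_R0|exact c0]).
  assert (N2 : N ^ 2 = f a * c ^ 2).
  { unfold N. rewrite Rpow_mult_distr, pow2_sqrt; [reflexivity|lra]. }
  assert (Hsum : forall z, f z * D z ^ 2 = sum_list (fun x => fst x z ^ 2) l).
  { intros z. now rewrite H, <- El, sum_sq_map. }
  assert (LF := leading_forms f D a M KD l (Cf a) (proj1 LD) Hl Hsum).
  set (v := fun z : R2 => (fst z - fst a, snd z - snd a)).
  set (bx := fun (x : (R2 -> R) * (R * R2 -> R)) z => snd x (0, v z)).
  assert (Pv : forall K, pol3 K -> pol2 (fun z => K (0, v z))).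
  { intros K PK. apply (pol3_triple K _ (fun _ => 0) (fun z => fst z - fst a) (fun z => snd z - snd a) PK);
      polyfun_tac. }
  assert (Pbx : forall x, In x l -> pol2 (bx x)) by (intros x Hx; apply Pv; apply (Hl x Hx)).
  assert (Prx : forall x, In x l -> pol2 (fst x)).
  { intros x Hx. apply (proj1 (Forall_forall _ _) Pr). rewrite <- El. now apply in_map. }
  assert (Pha : pol2 ha) by (apply Pv; apply Bh).
  assert (vray : forall s w, v (ray a s w) = (s * fst w, s * snd w)).
  { intros s w. unfold v, ray. simpl. f_equal; ring. }
  assert (Bha : blow ha a M (fun p => Kh (0, snd p))).
  { split; [apply pol3_init, Bh|]. intros s w. unfold ha. fold (v (ray a s w)). rewrite vray.
    now rewrite (blow_homogeneous h a M Kh Bh). }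
  assert (Bbx : forall x, In x l -> blow (bx x) a M (fun p => snd x (0, snd p))).
  { intros x Hx. split; [apply pol3_init, (Hl x Hx)|]. intros s w. unfold bx. rewrite vray.
    now rewrite (blow_homogeneous (fst x) a M (snd x) (Hl x Hx)). }
  (* The leading forms satisfy [sum b^2 = N^2 ha^2], so [k] normalises; [1 / sqrt 2] compensates for
     pairs occurring twice among the cross terms. *)
  set (k := / N). set (k2 := k * / sqrt 2).
  assert (k0 : 0 < k) by now apply Rinv_0_lt_compat.
  assert (s2 : 0 < sqrt 2) by (apply sqrt_lt_R0; lra).
  assert (k22 : k2 ^ 2 * 2 = k ^ 2).
  { unfold k2. rewrite Rpow_mult_distr. rewrite pow_inv, pow2_sqrt by lra. field. }
  assert (kN : k ^ 2 * N ^ 2 = 1) by (unfold k; field; lra).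
  set (dot := fun z => k * sum_list (fun x => fst x z * bx x z) l).
  set (cross := fun x y z => k2 * (fst x z * bx y z - fst y z * bx x z)).
  assert (Hcross : forall r, In r (flat_map (fun x => map (cross x) l) l) ->
    exists x y, In x l /\ In y l /\ r = cross x y).
  { intros r Hr. apply in_flat_map in Hr. destruct Hr as [x [Hx Hr]].
    apply in_map_iff in Hr. destruct Hr as [y [<- Hy]]. now exists x, y. }
  exists (dot :: flat_map (fun x => map (cross x) l) l).
  split; [|split; [|split]].
  - constructor.
    + apply pf_mul; [apply pf_const|]. clear - Pbx Prx.
      induction l as [|x l IH]; simpl; [apply pf_const|].
      apply (pf_add _ (fun z => fst x z * bx x z)); [apply pf_mul; [apply Prx|apply Pbx]; now left|].
      apply IH; intros y Hy; [apply Pbx|apply Prx]; now right.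
    + apply Forall_forall. intros r Hr. destruct (Hcross r Hr) as [x [y [Hx [Hy ->]]]].
      apply pf_mul; [apply pf_const|].
      apply pf_sub; apply pf_mul; solve [now apply Prx | now apply Pbx].
  - intros z. change (sum_sq_funs (dot :: flat_map (fun x => map (cross x) l) l) z)
      with (dot z ^ 2 + sum_sq_funs (flat_map (fun x => map (cross x) l) l) z).
    rewrite sum_sq_flat_map. unfold cross.
    rewrite (sum_list_ext _ (fun x => k2 ^ 2 * sum_list (fun y => (fst x z * bx y z - fst y z * bx x z) ^ 2) l)).
    2:{ intros x _. rewrite <- sum_list_scal. apply sum_list_ext. intros y _. ring. }
    assert (EB : sum_list (fun x => bx x z ^ 2) l = f a * (c * ha z) ^ 2).
    { transitivity (f a * KD (0, v z) ^ 2); [symmetry; exact (LF (v z))|now rewrite Ec]. }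
    rewrite sum_list_scal, (sum_list_lagrange _ (fun x => fst x z) (fun x => bx x z)).
    cbv beta. rewrite <- Hsum, EB. unfold dot.
    set (S := sum_list (fun x => fst x z * bx x z) l).
    transitivity (k ^ 2 * (f z * D z ^ 2 * (f a * (c * ha z) ^ 2))); [|rewrite (Rpow_mult_distr k S 2), <- k22; ring].
    replace (k ^ 2 * (f z * D z ^ 2 * (f a * (c * ha z) ^ 2)))
      with (k ^ 2 * (f a * c ^ 2) * (f z * (D z * ha z) ^ 2)) by ring.
    rewrite <- N2, kN. ring.
  - exists (fun p => KD p * Kh (0, snd p)). split.
    + split; [apply blow_mul; [apply LD|exact Bha]|].
      intros w Hw. simpl. apply Rmult_lt_0_compat; [now apply LD|].
      apply Rmult_lt_reg_l with c; [exact c0|]. rewrite Rmult_0_r, <- Ec. now apply LD.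
    + intros r [<-|Hr].
      (* At [s = 0] the sum is [f a * KD ^ 2], and one factor [KD] equals [c * Kh]; hence the
         constant. *)
      * exists (fun p => k * sum_list (fun x => snd x p * snd x (0, snd p)) l), (k * (f a * c)). split.
        { apply blow_scal. clear - Hl Bbx.
          induction l as [|x l IH]; simpl.
          - split; [apply pf_const|intros; ring].
          - apply (blow_add (fun z => fst x z * bx x z)).
            + apply blow_mul; auto with datatypes.
            + apply IH; auto with datatypes. }
        intros w. simpl.
        rewrite (sum_list_ext _ (fun x => snd x (0, w) ^ 2)) by (intros; ring).
        rewrite <- LF, Ec. ring.
      * destruct (Hcross r Hr) as [x [y [Hx [Hy ->]]]].
        exists (fun p => k2 * (snd x p * snd y (0, snd p) + (-1) * (snd y p * snd x (0, snd p)))), 0. split.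
        { apply blow_ext with (fun z => k2 * (fst x z * bx y z + (-1) * (fst y z * bx x z))).
          - apply blow_scal. apply blow_add; [|apply blow_scal]; apply blow_mul; auto.
          - intros z. unfold cross. ring. }
        intros w. simpl. ring.
  - intros b Nb KDb Hb Gb hab.
    assert (Gx : forall x g, In x l -> pol2 g ->
      good (fun z => fst x z * g z) b (Nb + 0) (fun p => KDb p * ha (ray b (fst p) (snd p)))).
    { intros x g Hx Pg. apply good_mul_unit; auto. apply Gb. rewrite <- El. now apply in_map. }
    intros r [<-|Hr].
    + apply good_scal.
      assert (G0 : good (fun _ => 0) b (Nb + 0) (fun p => KDb p * ha (ray b (fst p) (snd p)))).
      { exists (fun _ => 0), 0. split; [split; [apply pf_const|intros; ring]|intros; ring]. }
      clear - Gx Pbx G0. induction l as [|x l IH]; simpl; [exact G0|].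
      apply (good_add (fun z => fst x z * bx x z)); [apply Gx; auto with datatypes|].
      apply IH; auto with datatypes.
    + destruct (Hcross r Hr) as [x [y [Hx [Hy ->]]]].
      apply good_ext with (fun z => k2 * (fst x z * bx y z + (-1) * (fst y z * bx x z))).
      * apply good_scal, good_add; [|apply good_scal]; apply Gx; auto.
      * intros z. unfold cross. ring.
Qed.

Lemma blow_cast g a m n K : m = n -> blow g a m K -> blow g a n K.
Proof. now intros ->. Qed.

Lemma lpd_ext g h a m K : lpd g a m K -> (forall z, g z = h z) -> lpd h a m K.
Proof. intros [B P] E. split; [now apply blow_ext with g|exact P]. Qed.

Section Core.
Variables (q : R2 -> R) (m : R2 -> nat) (K : R2 -> R * R2 -> R).
Hypothesis Pq : pol2 q.

Definition lead a (z : R2) : R := K a (0, (fst z - fst a, snd z - snd a)).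
Definition lead_prod L z : R := fold_right (fun a acc => lead a z * acc) 1 L.
Definition den L z : R := q z * lead_prod L z.

Lemma sub_nonzero (a z : R2) : z <> a -> (fst z - fst a, snd z - snd a) <> (0, 0).
Proof.
  intros H E. injection E as E1 E2. apply H. destruct z, a. simpl in *. f_equal; lra.
Qed.

Lemma lead_pos a z : lpd q a (m a) (K a) -> z <> a -> 0 < lead a z.
Proof. intros [_ H] Hz. apply H. now apply sub_nonzero. Qed.

Lemma lead_pol2 a : lpd q a (m a) (K a) -> pol2 (lead a).
Proof.
  intros [[PK _] _].
  apply (pol3_triple (K a) _ (fun _ => 0) (fun z => fst z - fst a) (fun z => snd z - snd a) PK);
    polyfun_tac.
Qed.

Lemma lead_lpd a : lpd q a (m a) (K a) -> lpd (lead a) a (m a) (fun p => K a (0, snd p)).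
Proof.
  intros [B P]. split; [split; [apply pol3_init, B|]|exact P].
  intros s w. unfold lead, ray. simpl.
  replace (fst a + s * fst w - fst a) with (s * fst w) by ring.
  replace (snd a + s * snd w - snd a) with (s * snd w) by ring.
  apply (blow_homogeneous q a (m a) (K a) B).
Qed.

Lemma lead_prod_pol2 L : (forall a, In a L -> lpd q a (m a) (K a)) -> pol2 (lead_prod L).
Proof.
  induction L as [|a L IH]; intros H; [exact (pf_const _ 1)|].
  apply (pf_mul _ (lead a) (lead_prod L)); [apply lead_pol2, H; now left|apply IH; intros; apply H; now right].
Qed.

Lemma lead_prod_pos L z : (forall a, In a L -> lpd q a (m a) (K a)) -> ~ In z L -> 0 < lead_prod L z.
Proof.
  induction L as [|a L IH]; intros H Hz; simpl; [lra|].
  apply Rmult_lt_0_compat.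
  - apply lead_pos; [apply H; now left|]. intros ->. apply Hz. now left.
  - apply IH; [intros; apply H; now right|]. intros Hz'. apply Hz. now right.
Qed.

Lemma den_pol2 L : (forall a, In a L -> lpd q a (m a) (K a)) -> pol2 (den L).
Proof. intros H. apply pf_mul; [exact Pq|now apply lead_prod_pol2]. Qed.

Lemma den_lpd L : (forall a, In a L -> lpd q a (m a) (K a)) ->
  forall a n Ka, lpd q a n Ka -> exists M KD, lpd (den L) a M KD.
Proof.
  intros H a n Ka Ha.
  assert (HP : exists M KP, lpd (lead_prod L) a M KP).
  { induction L as [|b L IH]; [exists 0%nat; eexists; apply lpd_0; [exact (pf_const _ 1)|unfold lead_prod; simpl; lra]|].
    destruct IH as [M [KP HKP]]; [intros; apply H; now right|].
    assert (Hb : lpd q b (m b) (K b)) by (apply H; now left).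
    assert (HL : exists M KB, lpd (lead b) a M KB).
    { destruct (classic (a = b)) as [->|ne].
      - do 2 eexists. now apply lead_lpd.
      - exists 0%nat. eexists. apply lpd_0; [now apply lead_pol2|now apply lead_pos]. }
    destruct HL as [M' [KB HKB]]. do 2 eexists. exact (lpd_mul _ _ _ _ _ _ _ HKB HKP). }
  destruct HP as [M [KP HKP]]. do 2 eexists. exact (lpd_mul _ _ _ _ _ _ _ Ha HKP).
Qed.

(** When [a] is added to [L], the leading form of [den L] at [a] is that of [q] times the positive
    constant [lead_prod L a]. So the leading form of [q] itself can serve as corrector, which gives
    the stated denominator. Points treated before stay good because [lead a] is positive there. *)
Lemma iterated_correction f rs0 : continuous2 f -> (forall z, 0 <= f z) -> Forall pol2 rs0 ->
  (forall z, f z * q z ^ 2 = sum_sq_funs rs0 z) ->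
  forall L, NoDup L -> (forall a, In a L -> lpd q a (m a) (K a) /\ f a <> 0) ->
  exists rs, Forall pol2 rs /\ (forall z, f z * den L z ^ 2 = sum_sq_funs rs z) /\
    forall a, In a L -> exists M KD, lpd (den L) a M KD /\ forall r, In r rs -> good r a M KD.
Proof.
  intros Cf f0 Pr0 H0. induction L as [|a L IH]; intros ND HL.
  { exists rs0. split; [exact Pr0|]. split; [|intros a []].
    intros z. rewrite <- H0. unfold den. simpl. ring. }
  inversion ND as [|? ? NI ND']; subst.
  destruct IH as [rs [Pr [H G]]]; [exact ND'|intros; apply HL; now right|].
  assert (HL' : forall b, In b L -> lpd q b (m b) (K b)) by (intros b Hb; apply HL; now right).
  destruct (HL a) as [La fa]; [now left|].
  assert (PP := lead_prod_pol2 L HL'). assert (P0 := lead_prod_pos L a HL' NI).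
  assert (LD := lpd_mul _ _ _ _ _ _ _ La (lpd_0 _ a PP P0)).
  rewrite Nat.add_0_r in LD.
  destruct (correction f (den L) rs a (m a) _ (lead_prod L a) q (K a) Cf f0 fa Pr H LD P0)
    as [rs' [Pr' [H' [[KD' [LD' Ga]] Gb]]]].
  { intros w. simpl. rewrite ray_0. ring. }
  { apply La. }
  assert (E : forall z, den L z * lead a z = den (a :: L) z) by (intros z; unfold den; simpl; ring).
  exists rs'. split; [exact Pr'|]. split; [intros z; rewrite <- E; apply H'|].
  intros b [<-|Hb].
  - exists (m a + m a)%nat, KD'. split; [now apply lpd_ext with (2 := E)|exact Ga].
  - assert (nb : b <> a) by (intros ->; contradiction).
    assert (pb : 0 < lead a b) by (now apply lead_pos).
    destruct (G b Hb) as [M [KD [LDb Gr]]].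
    exists (M + 0)%nat, (fun p => KD p * lead a (ray b (fst p) (snd p))). split.
    + apply lpd_ext with (2 := E).
      apply lpd_mul; [exact LDb|]. apply lpd_0; [now apply lead_pol2|exact pb].
    + apply (Gb b M KD nb Gr). fold (lead a b). lra.
Qed.
End Core.

Lemma cont_at_ext_near f g z : cont_at g z -> (exists d, 0 < d /\ forall w,
  Rabs (fst w - fst z) < d -> Rabs (snd w - snd z) < d -> f w = g w) -> cont_at f z.
Proof.
  intros Cg [d [d0 E]] eps He. destruct (Cg eps He) as [e [e0 Hd]].
  exists (Rmin d e). split; [now apply Rmin_glb_lt|]. intros w H1 H2.
  assert (l := Rmin_l d e). assert (r := Rmin_r d e).
  rewrite !E; try lra.
  - apply Hd; lra.
  - rewrite Rminus_diag, Rabs_R0; lra.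
  - rewrite Rminus_diag, Rabs_R0; lra.
Qed.

Lemma cont_at_nonzero f z : cont_at f z -> f z <> 0 -> exists d, 0 < d /\ forall w,
  Rabs (fst w - fst z) < d -> Rabs (snd w - snd z) < d -> f w <> 0.
Proof.
  intros C H. destruct (C (Rabs (f z)) (Rabs_pos_lt _ H)) as [d [d0 Hd]].
  exists d. split; [exact d0|]. intros w H1 H2 E. specialize (Hd w H1 H2).
  rewrite E, Rminus_0_l, Rabs_Ropp in Hd. lra.
Qed.

(** * Continuity of the quotients and regularity after blowing up *)

Section Quotient.
Variables (f D r F : R2 -> R) (a : R2).
Hypotheses (Cf : cont_at f a) (PD : pol2 D) (Pr : pol2 r).
Hypothesis bound : forall z, r z ^ 2 <= f z * D z ^ 2.
Hypothesis FD : forall z, D z <> 0 -> F z = r z / D z.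

Lemma quotient_cont_regular : D a <> 0 -> cont_at F a.
Proof.
  intros Da. apply cont_at_ext_near with (fun w => r w / D w).
  - apply cont_at_div; [exact (pol2_continuous r Pr a)|exact (pol2_continuous D PD a)|exact Da].
  - destruct (cont_at_nonzero D a (pol2_continuous D PD a) Da) as [d [d0 H]].
    exists d. split; [exact d0|]. intros w H1 H2. now apply FD, H.
Qed.

Lemma quotient_cont_zero M KD : lpd D a M KD -> f a = 0 -> F a = 0 -> cont_at F a.
Proof.
  intros LD fa Fa eps He. destruct (lpd_nonzero_near D a M KD LD) as [d [d0 H]].
  destruct (Cf (eps ^ 2)) as [e [e0 H']]; [now apply pow_lt|].
  exists (Rmin d e). split; [now apply Rmin_glb_lt|]. intros w H1 H2.
  assert (l := Rmin_l d e). assert (l' := Rmin_r d e).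
  rewrite Fa, Rminus_0_r.
  destruct (classic (w = a)) as [->|ne]; [rewrite Fa, Rabs_R0; exact He|].
  specialize (H w ne ltac:(lra) ltac:(lra)). specialize (H' w ltac:(lra) ltac:(lra)).
  rewrite fa, Rminus_0_r in H'. apply Rabs_def2 in H'.
  assert (D2 : 0 < D w ^ 2) by (rewrite <- Rsqr_pow2; now apply Rlt_0_sqr).
  assert (F2 : F w ^ 2 < eps ^ 2).
  { rewrite FD by exact H. apply Rle_lt_trans with (f w); [|lra].
    unfold Rdiv. rewrite Rpow_mult_distr, pow_inv.
    apply Rmult_le_reg_r with (D w ^ 2); [exact D2|].
    rewrite Rmult_assoc, Rinv_l by lra. rewrite Rmult_1_r. apply bound. }
  apply Rabs_def1; nra.
Qed.

(** [F - c] is the quotient of [Kr - c * KD], which is divisible by [s], by [KD], which is bounded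
    below over the compact set of directions. *)
Lemma quotient_cont_good M KD Kr c : lpd D a M KD -> blow r a M Kr ->
  (forall w, Kr (0, w) = c * KD (0, w)) -> F a = c -> cont_at F a.
Proof.
  intros [[PKD ED] KD0] [PKr Er] Ec Fa eps He.
  destruct (pol3_lower_bound KD PKD KD0) as [k [d [k0 [[d0 d1] H]]]].
  set (G := fun p => Kr p - c * KD p).
  assert (PG : pol3 G) by (apply pf_sub; [exact PKr|apply pf_mul; [apply pf_const|exact PKD]]).
  destruct (pol3_div G PG) as [G' [PG' EG]].
  destruct (polyfun_bounded _ G' 1 PG') as [B [B0 HB]].
  assert (x1 : 0 < eps * k / (B + 1)) by (apply Rdiv_lt_0_compat; [nra|lra]).
  exists (Rmin d (eps * k / (B + 1))). split; [now apply Rmin_glb_lt|].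
  intros z H1 H2. rewrite Fa.
  destruct (classic (z = a)) as [->|ne].
  { rewrite Fa, Rminus_diag, Rabs_R0. exact He. }
  destruct (ray_unit_dir a z _ ne H1 H2) as [s [w [Hw [-> [s0 s1]]]]].
  assert (l := Rmin_l d (eps * k / (B + 1))). assert (l' := Rmin_r d (eps * k / (B + 1))).
  specialize (H s w ltac:(lra) Hw).
  assert (sn : s <> 0) by (intros ->; rewrite Rabs_R0 in s0; lra).
  assert (sM : s ^ M <> 0) by now apply pow_nonzero.
  assert (Dn : D (ray a s w) <> 0).
  { rewrite ED. apply Rmult_integral_contrapositive_currified; [exact sM|lra]. }
  rewrite FD by exact Dn. rewrite ED, Er.
  replace (s ^ M * Kr (s, w) / (s ^ M * KD (s, w)) - c) with (G (s, w) / KD (s, w))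
    by (unfold G; field; split; [lra|exact sM]).
  rewrite EG. unfold G at 1. rewrite Ec.
  replace (c * KD (0, w) - c * KD (0, w) + s * G' (s, w)) with (s * G' (s, w)) by ring.
  assert (HG : Rabs (G' (s, w)) <= B).
  { destruct (unit_dir_bound w Hw). apply HB. intros v [-> |[-> | ->]]; simpl; lra. }
  unfold Rdiv. rewrite !Rabs_mult, Rabs_inv, (Rabs_right (KD (s, w))) by lra.
  apply Rmult_lt_reg_r with (KD (s, w)); [lra|].
  rewrite Rmult_assoc, Rinv_l, Rmult_1_r by lra.
  apply Rle_lt_trans with (Rabs s * B); [apply Rmult_le_compat_l; lra|].
  apply Rle_lt_trans with (Rabs s * (B + 1)); [nra|].
  apply Rlt_le_trans with (eps * k / (B + 1) * (B + 1)); [apply Rmult_lt_compat_r; lra|].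
  replace (eps * k / (B + 1) * (B + 1)) with (eps * k) by (field; lra).
  apply Rmult_le_compat_l; lra.
Qed.

(** On [s = 0] the formula follows from the continuity of [F]. It makes the pull-back of [F] regular
    along the exceptional divisor, where [KD] is positive. *)
Lemma quotient_blow M KD Kr (w : R2) : lpd D a M KD -> blow r a M Kr -> cont_at F a -> w <> (0, 0) ->
  forall s, KD (s, w) <> 0 -> F (ray a s w) = Kr (s, w) / KD (s, w).
Proof.
  intros LD BR CF Hw s Hs. destruct (Req_dec s 0) as [->|sn].
  - destruct (lpd_ray_nonzero D a M KD w LD Hw) as [d [d0 Hd]].
    assert (E : F (ray a 0 w) * KD (0, w) - Kr (0, w) = 0).
    { apply (continuity_eq0 (fun s => F (ray a s w) * KD (s, w) - Kr (s, w)) d); [|exact d0|].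
      - apply continuity_pt_minus; [|apply pol3_slice_continuity, BR].
        apply continuity_pt_mult; [|apply pol3_slice_continuity, LD].
        apply continuity_ray. now rewrite ray_0.
      - intros t Ht. destruct (Hd t Ht) as [Kt Dt]. rewrite FD by exact Dt.
        destruct LD as [[_ ED] _]. destruct BR as [_ Er]. rewrite ED, Er.
        assert (t ^ M <> 0) by (apply pow_nonzero; intros ->; rewrite Rabs_R0 in Ht; lra).
        field. now split. }
    apply Rmult_eq_reg_r with (KD (0, w)); [|exact Hs].
    unfold Rdiv. rewrite Rmult_assoc, Rinv_l by exact Hs. lra.
  - assert (t : s ^ M <> 0) by now apply pow_nonzero.
    destruct LD as [[_ ED] _]. destruct BR as [_ Er].
    rewrite FD; rewrite ED.
    + rewrite Er. field. now split.
    + now apply Rmult_integral_contrapositive_currified.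
Qed.
End Quotient.

Lemma regular_at_quotient g P Q w : pol2 P -> pol2 Q -> Q w <> 0 ->
  (forall z, Q z <> 0 -> g z = P z / Q z) -> regular_at g w.
Proof.
  intros HP HQ Hw H.
  destruct (Bridge.pol2_is_poly2 HP) as [P' EP]. destruct (Bridge.pol2_is_poly2 HQ) as [Q' EQ].
  exists P', Q', (fun z => Q z <> 0). repeat split.
  - exists (fun T => T = Q'). intros z. split.
    + intros Hz T ->. rewrite EQ. now apply NNPP.
    + intros Hz Hn. apply Hn. rewrite <- EQ. now apply Hz.
  - exact Hw.
  - now rewrite EQ.
  - now rewrite EQ.
  - rewrite EP, EQ. now apply H.
Qed.

Lemma quotient_R0_1 f D r F Z : NoDup Z -> continuous2 f -> (forall z, 0 <= f z) ->
  pol2 D -> pol2 r -> (forall z, r z ^ 2 <= f z * D z ^ 2) -> (forall z, D z <> 0 -> F z = r z / D z) ->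
  (forall z, D z = 0 -> In z Z) -> (forall a, In a Z -> exists M KD, lpd D a M KD) -> (exists z, D z <> 0) ->
  continuous2 F -> R0_1 F.
Proof.
  intros ND Cf f0 PD Pr bound FD DZ HZ [z0 Dz0] CF. split; [split; [exact CF|]|].
  - destruct (regular_at_quotient F r D z0 Pr PD Dz0 FD) as [P [Q [U [HU [Uz [_ H]]]]]].
    exists P, Q, U. repeat split; [exact HU|now exists z0|now apply H|now apply H].
  - exists Z. split; [exact ND|]. split.
    + intros z Hz. apply regular_at_quotient with r D; auto.
    + intros a Ha. destruct (HZ a Ha) as [M [KD LD]].
      destruct (blow_of_sq_le f r D a M KD (Cf a) f0 Pr (proj1 LD) bound) as [Kr BR].
      assert (Q := quotient_blow D r F a FD M KD Kr).
      split.
      * intros v.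
        apply regular_at_quotient with (fun w => Kr (fst w, (1, snd w))) (fun w => KD (fst w, (1, snd w))).
        { apply (pol3_triple Kr _ fst (fun _ => 1) snd (proj1 BR)); polyfun_tac. }
        { apply (pol3_triple KD _ fst (fun _ => 1) snd (proj1 (proj1 LD))); polyfun_tac. }
        { simpl. apply Rgt_not_eq, LD. intros E. injection E. lra. }
        { intros z Hz. rewrite <- (Q (1, snd z) LD BR (CF a)); [|intros E; injection E; lra|exact Hz].
          unfold ray. simpl. now rewrite Rmult_1_r. }
      * intros u.
        apply regular_at_quotient with (fun w => Kr (snd w, (fst w, 1))) (fun w => KD (snd w, (fst w, 1))).
        { apply (pol3_triple Kr _ snd fst (fun _ => 1) (proj1 BR)); polyfun_tac. }
        { apply (pol3_triple KD _ snd fst (fun _ => 1) (proj1 (proj1 LD))); polyfun_tac. }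
        { simpl. apply Rgt_not_eq, LD. intros E. injection E. lra. }
        { intros z Hz. rewrite <- (Q (fst z, 1) LD BR (CF a)); [|intros E; injection E; lra|exact Hz].
          unfold ray. simpl. rewrite Rmult_1_r. now rewrite (Rmult_comm (snd z)). }
Qed.

Lemma cont_eq_at g h D a M KD : cont_at g a -> cont_at h a -> lpd D a M KD ->
  (forall z, D z <> 0 -> g z = h z) -> g a = h a.
Proof.
  intros Cg Ch LD H.
  destruct (lpd_ray_nonzero D a M KD (1, 0) LD) as [d [d0 Hd]]; [intros E; injection E; lra|].
  assert (E : g (ray a 0 (1, 0)) - h (ray a 0 (1, 0)) = 0).
  { apply (continuity_eq0 (fun s => g (ray a s (1, 0)) - h (ray a s (1, 0))) d); [|exact d0|].
    - apply continuity_pt_minus; apply continuity_ray; now rewrite ray_0.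
    - intros s Hs. rewrite (H (ray a s (1, 0))); [ring|]. now apply (Hd s Hs). }
  rewrite ray_0 in E. lra.
Qed.

Lemma cont_at_sum_sq fs z : (forall g, In g fs -> cont_at g z) -> cont_at (sum_sq_funs fs) z.
Proof.
  induction fs as [|g fs IH]; intros H; [exact (pol2_continuous _ (pf_const _ 0) z)|].
  assert (Cg : cont_at g z) by (apply H; now left).
  apply (cont_at_add (fun w => g w ^ 2) (sum_sq_funs fs)).
  - apply cont_at_mult; [exact Cg|]. apply cont_at_mult; [exact Cg|].
    exact (pol2_continuous _ (pf_const _ 1) z).
  - apply IH. intros g' Hg. apply H. now right.
Qed.

Theorem corrected_sum_of_squares f q ps qs Z m K :
  continuous2 f -> (forall z, 0 <= f z) -> pol2 q -> Forall pol2 ps -> Forall pol2 qs ->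
  (forall z, q z = sum_sq_funs qs z) -> (forall z, f z * q z = sum_sq_funs ps z) ->
  NoDup Z -> (forall z, q z = 0 -> In z Z) -> (forall a, In a Z -> lpd q a (m a) (K a)) ->
  forall L, NoDup L -> (forall a, In a L <-> q a = 0 /\ f a <> 0) ->
  exists fs rs, Forall R0_1 fs /\ (forall z, f z = sum_sq_funs fs z) /\ Forall pol2 rs /\
    Forall2 (fun fi ri => forall z, den q K L z <> 0 -> fi z = ri z / den q K L z) fs rs.
Proof.
  intros Cf f0 Pq Pps Pqs Eq Ep NDZ qZ HZ L NDL HL.
  assert (LZ : forall a, In a L -> lpd q a (m a) (K a)) by (intros a Ha; apply HZ, qZ, HL, Ha).
  destruct (iterated_correction q m K f (prod_funs ps qs) Cf f0) with (L := L) as [rs [Pr [H G]]].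
  { now apply prod_funs_pol2. }
  { intros z. rewrite sum_sq_prod, <- Ep, <- Eq. ring. }
  { exact NDL. }
  { intros a Ha. split; [now apply LZ|now apply HL]. }
  set (D := den q K L) in *.
  assert (PD : pol2 D) by (now apply den_pol2 with m).
  assert (DZ : forall z, D z = 0 -> In z Z).
  { intros z Hz. destruct (classic (In z L)) as [Iz|Nz]; [apply qZ, HL, Iz|].
    pose proof (lead_prod_pos q m K L z LZ Nz). apply qZ.
    unfold D, den in Hz. apply Rmult_integral in Hz. destruct Hz; [assumption|lra]. }
  assert (LD : forall a, In a Z -> exists M KD, lpd D a M KD).
  { intros a Ha. exact (den_lpd q m K L LZ a (m a) (K a) (HZ a Ha)). }
  assert (ND : exists z, D z <> 0).
  { destruct (Req_dec (D (0, 0)) 0) as [E|E]; [|now exists (0, 0)].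
    destruct (LD _ (DZ _ E)) as [M [KD H']].
    destruct (lpd_ray_nonzero D _ M KD (1, 0) H') as [d [d0 Hd]]; [intros E'; injection E'; lra|].
    exists (ray (0, 0) (d / 2) (1, 0)). apply Hd. rewrite Rabs_right; lra. }
  assert (bound : forall r, In r rs -> forall z, r z ^ 2 <= f z * D z ^ 2).
  { intros r Ir z. rewrite H. now apply sum_sq_member. }
  assert (HF : forall r, In r rs -> exists F, (forall z, D z <> 0 -> F z = r z / D z) /\ continuous2 F).
  { intros r Ir.
    assert (P : pol2 r) by (now apply (proj1 (Forall_forall _ _) Pr)).
    (* The value at a zero of [D] is prescribed: 0 where [f] vanishes, otherwise the ratio of
       leading forms given by the correction. *)
    assert (HF : forall z, exists y, (D z <> 0 -> y = r z / D z) /\ (D z = 0 -> f z = 0 -> y = 0) /\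
      (D z = 0 -> f z <> 0 -> exists M KD Kr, lpd D z M KD /\ blow r z M Kr /\
         forall w, Kr (0, w) = y * KD (0, w))).
    { intros z. destruct (Req_dec (D z) 0) as [E|E].
      - destruct (Req_dec (f z) 0) as [Ef|Ef].
        + exists 0. repeat split; [contradiction|contradiction].
        + assert (Iz : In z L).
          { apply NNPP. intros Nz. pose proof (lead_prod_pos q m K L z LZ Nz).
            apply Nz, HL. split; [|exact Ef].
            unfold D, den in E. apply Rmult_integral in E. destruct E; [assumption|lra]. }
          destruct (G z Iz) as [M [KD [L1 Gr]]]. destruct (Gr r Ir) as [Kr [c [BR Ec]]].
          exists c. repeat split; [contradiction|contradiction|]. intros _ _. now exists M, KD, Kr.
      - exists (r z / D z). repeat split; intros; contradiction. }
    exists (fun z => proj1_sig (constructive_indefinite_description _ (HF z))).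
    set (F := fun z => proj1_sig (constructive_indefinite_description _ (HF z))).
    assert (FP := fun z => proj2_sig (constructive_indefinite_description _ (HF z))).
    fold F. assert (FD : forall z, D z <> 0 -> F z = r z / D z) by (intros z; apply FP).
    split; [exact FD|]. intros a. change (cont_at F a).
    destruct (FP a) as [_ [F0 Fc]]. fold (F a) in F0, Fc.
    destruct (Req_dec (D a) 0) as [E|E]; [|now apply quotient_cont_regular with D r].
    destruct (LD a (DZ a E)) as [M [KD LDa]].
    destruct (Req_dec (f a) 0) as [Ef|Ef].
    - apply quotient_cont_zero with f D r M KD; auto. exact (Cf a).
    - destruct (Fc E Ef) as [M' [KD' [Kr [L1 [BR Ec]]]]].
      now apply quotient_cont_good with D r M' KD' Kr (F a). }
  assert (HFs : exists fs, Forall2 (fun fi ri => (forall z, D z <> 0 -> fi z = ri z / D z) /\ continuous2 fi) fs rs).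
  { clear - HF. induction rs as [|r rs IH]; [exists []; constructor|].
    destruct (HF r) as [F HFr]; [now left|].
    destruct IH as [fs Hfs]; [intros; apply HF; now right|].
    exists (F :: fs). now constructor. }
  destruct HFs as [fs Hfs]. exists fs, rs.
  assert (Cfs : forall g, In g fs -> continuous2 g).
  { clear - Hfs. induction Hfs as [|g r fs rs [_ C] _ IH]; intros g' []; subst; auto. }
  split; [|split; [|split]].
  - assert (Q : forall F r, In r rs -> (forall z, D z <> 0 -> F z = r z / D z) -> continuous2 F -> R0_1 F).
    { intros F r Ir FD CF. apply quotient_R0_1 with f D r Z; auto.
      now apply (proj1 (Forall_forall _ _) Pr). }
    clear - Q Hfs. induction Hfs as [|g r fs rs [FD C] _ IH]; constructor.
    + apply Q with r; auto. now left.
    + apply IH. intros; apply Q with r0; auto. now right.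
  - assert (E : forall z, D z <> 0 -> f z = sum_sq_funs fs z).
    { intros z Dz. assert (D2 : D z ^ 2 <> 0) by now apply pow_nonzero.
      apply Rmult_eq_reg_r with (D z ^ 2); [|exact D2]. rewrite H.
      clear - Hfs Dz. induction Hfs as [|g r fs rs [FD C] _ IH]; simpl; [ring|].
      simpl in IH. rewrite IH, FD by exact Dz. field. exact Dz. }
    intros z. destruct (Req_dec (D z) 0) as [Dz|Dz]; [|now apply E].
    destruct (LD z (DZ z Dz)) as [M [KD LDz]].
    apply cont_eq_at with D M KD; auto.
    + exact (Cf z).
    + apply cont_at_sum_sq. intros g Hg. exact (Cfs g Hg z).
  - exact Pr.
  - clear - Hfs. induction Hfs as [|g r fs rs [FD C] _ IH]; constructor; auto.
Qed.

(** * Denominators from the blowing-up *)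

Lemma continuous2_comp f g h : continuous2 f -> pol2 g -> pol2 h -> continuous2 (fun w => f (g w, h w)).
Proof.
  intros Cf Pg Ph z eps He. destruct (Cf (g z, h z) eps He) as [d [d0 H]].
  destruct (pol2_continuous g Pg z d d0) as [d1 [d10 H1]].
  destruct (pol2_continuous h Ph z d d0) as [d2 [d20 H2]].
  exists (Rmin d1 d2). split; [now apply Rmin_glb_lt|]. intros w w1 w2.
  assert (l := Rmin_l d1 d2). assert (r := Rmin_r d1 d2).
  apply H; simpl; [apply H1|apply H2]; lra.
Qed.

(** The non-zero set of [E] is dense, and the continuous [g * Q - P] would be non-zero on a
    neighbourhood if it were so at one point. *)
Lemma dense_identity g P Q E : continuous2 g -> pol2 P -> pol2 Q -> pol2 E -> (exists w, E w <> 0) ->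
  (forall z, E z <> 0 -> g z * Q z = P z) -> forall z, g z * Q z = P z.
Proof.
  intros Cg HP HQ HE Ew H z. apply NNPP. intros N.
  assert (C : cont_at (fun w => g w * Q w - P w) z).
  { apply cont_at_sub; [apply cont_at_mult; [exact (Cg z)|exact (pol2_continuous Q HQ z)]|].
    exact (pol2_continuous P HP z). }
  destruct (cont_at_nonzero _ z C) as [d [d0 Hd]]; [lra|].
  destruct (Bridge.pol2_nonzero_dense HE Ew z d0) as [z' [h1 h2 h3]].
  apply (Hd z' h1 h2). rewrite H by exact h3. ring.
Qed.

Lemma rsum_polyfun {X} (V : (X -> R) -> Prop) n (F : nat -> X -> R) :
  (forall i, polyfun V (F i)) -> polyfun V (fun x => rsum n (fun i => F i x)).
Proof.
  intros H. unfold rsum. induction n as [|n IH]; simpl; [apply H|].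
  now apply (pf_add V (fun x => sum_f_R0 (fun i => F i x) n)).
Qed.

Lemma pol2_ev P : pol2 (ev P).
Proof.
  unfold ev. apply (rsum_polyfun _ (pdeg P) (fun i z => rsum (pdeg P) (fun j => pcoef P i j * fst z ^ i * snd z ^ j))).
  intros i. apply (rsum_polyfun _ (pdeg P) (fun j z => pcoef P i j * fst z ^ i * snd z ^ j)).
  intros j. polyfun_tac.
Qed.

Lemma zopen_witness U w : zopen U -> U w -> exists E, pol2 E /\ E w <> 0 /\ forall z, E z <> 0 -> U z.
Proof.
  intros [F HF] Uw. destruct (classic (forall P, F P -> ev P w = 0)) as [H|H].
  - exfalso. now apply (proj2 (HF w) H).
  - apply not_all_ex_not in H. destruct H as [P H]. apply imply_to_and in H. destruct H as [FP Pw].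
    exists (ev P). split; [apply pol2_ev|]. split; [exact Pw|]. intros z Pz. apply NNPP. intros N.
    apply Pz. now apply HF.
Qed.

Definition multiplier (f Q : R2 -> R) : Prop := pol2 Q /\ exists P, pol2 P /\ forall z, f z * Q z = P z.

Lemma regular_at_multiplier g w : continuous2 g -> regular_at g w -> exists Q, multiplier g Q /\ Q w <> 0.
Proof.
  intros Cg [P [Q [U [HU [Uw [Qw H]]]]]]. exists (ev Q). split; [|exact Qw].
  split; [apply pol2_ev|]. exists (ev P). split; [apply pol2_ev|].
  destruct (zopen_witness U w HU Uw) as [E [PE [Ew HE]]].
  apply dense_identity with E; auto using pol2_ev; [now exists w|].
  intros z Ez. destruct (H z (HE z Ez)) as [Qz ->]. field. exact Qz.
Qed.

Lemma pol2_div_fst P a : pol2 P -> (forall y, P (a, y) = 0) ->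
  exists P', pol2 P' /\ forall z, P z = (fst z - a) * P' z.
Proof.
  intros HP H0. destruct (pol3_div (fun p => P (a + fst p, snd (snd p)))) as [K [PK EK]].
  { apply (pol2_pair P _ (fun p : R * R2 => a + fst p) (fun p => snd (snd p)) HP); polyfun_tac. }
  exists (fun z => K (fst z - a, (0, snd z))). split.
  - apply (pol3_triple K _ (fun z => fst z - a) (fun _ => 0) snd PK); polyfun_tac.
  - intros [x y]. simpl. specialize (EK (x - a) (0, y)). simpl in EK.
    rewrite Rplus_0_r, H0, Rplus_0_l in EK.
    transitivity (P (a + (x - a), y)); [f_equal; f_equal; ring|exact EK].
Qed.

(** The ideal of multipliers is saturated: if [f (x - a) Q] is a polynomial, it vanishes on [x = a]
    and is divisible by [x - a]. Its common zeros lie in [S], as regularity at a point yields a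
    multiplier that is non-zero there. *)
Lemma multiplier_base f S : Defs.R0 f -> (forall z, ~ In z S -> regular_at f z) ->
  exists Q, multiplier f Q /\ forall z, Q z = 0 -> In z S.
Proof.
  intros [Cf [P0 [Q0 [U [HU [[z0 Uz0] H0]]]]]] HS.
  destruct (@Bridge.saturated_ideal_common_zeros (multiplier f)) as [Q IQ HQ].
  - intros P [HP _]. exact HP.
  - intros P Q [HP [T [HT E]]] EQ. split; [now apply pf_ext with P|].
    exists T. split; [exact HT|]. intros z. now rewrite <- EQ.
  - intros P Q [HP [T [HT E]]] [HQ [T' [HT' E']]]. split; [now apply pf_add|].
    exists (fun z => T z + T' z). split; [now apply pf_add|]. intros z. rewrite <- E, <- E'. ring.
  - intros A P HA [HP [T [HT E]]]. split; [now apply pf_mul|].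
    exists (fun z => A z * T z). split; [now apply pf_mul|]. intros z. rewrite <- E. ring.
  - intros a Q HQ [_ [T [HT E]]]. split; [exact HQ|].
    destruct (pol2_div_fst T a HT) as [T' [HT' E']].
    { intros y. rewrite <- E. simpl. ring. }
    exists T'. split; [exact HT'|].
    apply dense_identity with (fun z => fst z - a); auto.
    + polyfun_tac.
    + exists (a + 1, 0). simpl. lra.
    + intros z Hz. apply Rmult_eq_reg_l with (fst z - a); [|exact Hz].
      rewrite <- E', <- E. ring.
  - destruct (regular_at_multiplier f z0 Cf) as [Q [IQ Qz]].
    { exists P0, Q0, U. split; [exact HU|]. split; [exact Uz0|]. split; [now apply H0|exact H0]. }
    now exists Q; [|exists z0].
  - exists Q. split; [exact IQ|]. intros z Qz. apply NNPP. intros N.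
    destruct (regular_at_multiplier f z Cf (HS z N)) as [Q' [IQ' Qz']].
    apply Qz'. now apply HQ.
Qed.

(** [Q'] is [x^N Q(x, y / x)]. All large [N] are allowed, so that one exponent can serve both a
    multiplier and its product with the function. *)
Lemma homogenize Q : pol2 Q -> exists N0, forall N, (N0 <= N)%nat ->
  exists Q' K, pol2 Q' /\ blow Q' (0, 0) N K /\ forall u v, Q' (u, u * v) = u ^ N * Q (u, v).
Proof.
  intros HQ. induction HQ as [c|v [-> | ->]|f g _ [N1 H1] _ [N2 H2]|f g _ [N1 H1] _ [N2 H2]|f g _ [N1 H1] E].
  - exists 0%nat. intros N _. exists (fun z => c * fst z ^ N), (fun p => c * fst (snd p) ^ N).
    split; [polyfun_tac|]. split; [split; [polyfun_tac|]|].
    + intros s w. unfold ray. simpl. rewrite Rplus_0_l, Rpow_mult_distr. ring.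
    + intros u v. simpl. ring.
  - exists 0%nat. intros N _. exists (fun z => fst z ^ S N), (fun p => fst p * fst (snd p) ^ S N).
    split; [polyfun_tac|]. split; [split; [polyfun_tac|]|].
    + intros s w. unfold ray. simpl. rewrite Rplus_0_l, Rpow_mult_distr. ring.
    + intros u v. simpl. ring.
  - exists 1%nat. intros [|N] HN; [lia|].
    exists (fun z => fst z ^ N * snd z), (fun p => fst (snd p) ^ N * snd (snd p)).
    split; [polyfun_tac|]. split; [split; [polyfun_tac|]|].
    + intros s w. unfold ray. simpl. rewrite !Rplus_0_l, Rpow_mult_distr. ring.
    + intros u v. simpl. ring.
  - exists (max N1 N2). intros N HN.
    destruct (H1 N) as [Q1 [K1 [P1 [B1 E1]]]]; [lia|]. destruct (H2 N) as [Q2 [K2 [P2 [B2 E2]]]]; [lia|].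
    exists (fun z => Q1 z + Q2 z), (fun p => K1 p + K2 p).
    split; [now apply pf_add|]. split; [now apply blow_add|]. intros u v. rewrite E1, E2. ring.
  - exists (N1 + N2)%nat. intros N HN.
    destruct (H1 N1) as [Q1 [K1 [P1 [B1 E1]]]]; [lia|]. destruct (H2 (N - N1)%nat) as [Q2 [K2 [P2 [B2 E2]]]]; [lia|].
    exists (fun z => Q1 z * Q2 z), (fun p => K1 p * K2 p).
    replace N with (N1 + (N - N1))%nat by lia.
    split; [now apply pf_mul|]. split.
    + replace (N1 + (N - N1) - N1)%nat with (N - N1)%nat in * by lia. now apply blow_mul.
    + intros u v. rewrite pow_add, E1, E2. ring.
  - exists N1. intros N HN. destruct (H1 N HN) as [Q1 [K1 [P1 [B1 E1]]]]. exists Q1, K1.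
    split; [exact P1|]. split; [exact B1|]. intros u v. now rewrite E1, E.
Qed.

Definition has_direction f a w := exists Q N K, multiplier f Q /\ blow Q a N K /\ K (0, w) <> 0.

(** Homogenisation carries a multiplier of the chart down to the plane; its form of degree [N] takes
    the value [Q (0, v)] in the direction [(1, v)]. *)
Lemma chart_direction f a v Q : continuous2 f ->
  multiplier (fun w => f (fst a + fst w, snd a + fst w * snd w)) Q -> Q (0, v) <> 0 ->
  has_direction f a (1, v).
Proof.
  intros Cf [PQ [P [PP E]]] Qv.
  destruct (homogenize Q PQ) as [N1 H1]. destruct (homogenize P PP) as [N2 H2].
  destruct (H1 (N1 + N2)%nat) as [Q' [KQ [PQ' [BQ EQ]]]]; [lia|].
  destruct (H2 (N1 + N2)%nat) as [P' [KP [PP' [BP EP]]]]; [lia|].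
  set (N := (N1 + N2)%nat) in *.
  assert (I : forall z, f (fst a + fst z, snd a + snd z) * Q' z = P' z).
  { apply dense_identity with fst; auto using pol2_fst.
    - apply (continuous2_comp f (fun z => fst a + fst z) (fun z => snd a + snd z) Cf); polyfun_tac.
    - exists (1, 0). simpl. lra.
    - intros [x y] Hx. simpl in *. replace y with (x * (y / x)) by (field; exact Hx).
      rewrite EQ, EP, <- E. simpl. ring. }
  exists (fun z => Q' (fst z - fst a, snd z - snd a)), N, KQ. split; [|split].
  - split; [apply (pol2_pair Q' _ (fun z => fst z - fst a) (fun z => snd z - snd a) PQ'); polyfun_tac|].
    exists (fun z => P' (fst z - fst a, snd z - snd a)).
    split; [apply (pol2_pair P' _ (fun z => fst z - fst a) (fun z => snd z - snd a) PP'); polyfun_tac|].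
    intros [x y]. rewrite <- I. simpl.
    replace (fst a + (x - fst a)) with x by ring. now replace (snd a + (y - snd a)) with y by ring.
  - split; [apply BQ|]. intros s w. rewrite <- (proj2 BQ). f_equal. unfold ray. simpl. f_equal; ring.
  - intros K0. apply Qv.
    change (KQ (0, (1, v)) = 0) in K0.
    assert (h0 : KQ (0, (1, v)) - Q (0, v) = 0); [|lra].
    apply (continuity_eq0 (fun s => KQ (s, (1, v)) - Q (s, v)) 1); [|lra|].
    + apply continuity_pt_minus; [apply pol3_slice_continuity, BQ|].
      apply (pol1_continuity (fun s => Q (s, v))).
      apply (pol2_pair Q _ (fun s => s) (fun _ => v) PQ); [now apply pf_var|apply pf_const].
    + intros s [s0 _]. assert (sn : s <> 0) by (intros ->; rewrite Rabs_R0 in s0; lra).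
      assert (pn : s ^ N <> 0) by now apply pow_nonzero.
      apply Rmult_eq_reg_l with (s ^ N); [|exact pn].
      rewrite Rmult_0_r, Rmult_minus_distr_l, <- (proj2 BQ), <- EQ. unfold ray. simpl.
      rewrite !Rplus_0_l, Rmult_1_r. ring.
Qed.

Definition swap (z : R2) : R2 := (snd z, fst z).

Lemma pol2_swap Q : pol2 Q -> pol2 (fun z => Q (swap z)).
Proof. intros H. apply (pol2_pair Q _ snd fst H); [apply pol2_snd|apply pol2_fst]. Qed.

Lemma multiplier_swap f Q : multiplier f Q -> multiplier (fun z => f (swap z)) (fun z => Q (swap z)).
Proof.
  intros [HQ [P [HP E]]]. split; [now apply pol2_swap|].
  exists (fun z => P (swap z)). split; [now apply pol2_swap|]. intros z. apply E.
Qed.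

Lemma swap_direction f a w : has_direction (fun z => f (swap z)) (swap a) (swap w) -> has_direction f a w.
Proof.
  intros [Q [N [K [I [[PK EK] HK]]]]].
  exists (fun z => Q (swap z)), N, (fun p => K (fst p, swap (snd p))). split; [|split; [split|exact HK]].
  - apply multiplier_swap in I. destruct I as [PQ [P [PP E]]]. split; [exact PQ|].
    exists P. split; [exact PP|]. intros z. rewrite <- E. unfold swap. simpl. now rewrite <- surjective_pairing.
  - apply (pol3_triple K _ fst (fun p => snd (snd p)) (fun p => fst (snd p)) PK); polyfun_tac.
  - intros s u. rewrite <- EK. reflexivity.
Qed.

Lemma blowup_directions f S a : continuous2 f -> regular_after_blowup S f -> In a S ->
  forall w, w <> (0, 0) -> has_direction f a w.
Proof.
  intros Cf [_ H] Ha [x y] Hw. destruct (H a Ha) as [C1 C2].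
  destruct (Req_dec x 0) as [->|x0].
  - assert (y0 : y <> 0) by (intros ->; now apply Hw).
    assert (D : has_direction f a (0, 1)).
    { apply swap_direction. specialize (C2 0). apply regular_at_multiplier in C2.
      2:{ apply (continuous2_comp f (fun w => fst a + fst w * snd w) (fun w => snd a + snd w) Cf); polyfun_tac. }
      destruct C2 as [Q [I Q0]]. apply multiplier_swap in I.
      apply (chart_direction (fun z => f (swap z)) (swap a) 0 (fun z => Q (swap z))); [| |exact Q0].
      - apply (continuous2_comp f snd fst Cf); [apply pol2_snd|apply pol2_fst].
      - destruct I as [PQ [P [PP E]]]. split; [exact PQ|]. exists P. split; [exact PP|].
        intros z. rewrite <- E. unfold swap. simpl. now rewrite (Rmult_comm (fst z)). }
    destruct D as [Q [N [K [I [B K0]]]]]. exists Q, N, K. split; [exact I|]. split; [exact B|].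
    replace (0, y) with (y * fst (0, 1), y * snd (0, 1)) by (simpl; f_equal; ring).
    rewrite (blow_homogeneous Q a N K B). apply Rmult_integral_contrapositive_currified; [now apply pow_nonzero|exact K0].
  - specialize (C1 (y / x)). apply regular_at_multiplier in C1.
    2:{ apply (continuous2_comp f (fun w => fst a + fst w) (fun w => snd a + fst w * snd w) Cf); polyfun_tac. }
    destruct C1 as [Q [I Q0]]. destruct (chart_direction f a (y / x) Q Cf I Q0) as [Q' [N [K [I' [B K0]]]]].
    exists Q', N, K. split; [exact I'|]. split; [exact B|].
    replace (x, y) with (x * fst (1, y / x), x * snd (1, y / x)) by (simpl; f_equal; field; exact x0).
    rewrite (blow_homogeneous Q' a N K B). apply Rmult_integral_contrapositive_currified; [now apply pow_nonzero|exact K0].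
Qed.

Definition dist2 (a z : R2) : R := (fst z - fst a) ^ 2 + (snd z - snd a) ^ 2.

Lemma dist2_pol2 a k : pol2 (fun z => dist2 a z ^ k).
Proof. apply pf_pow. unfold dist2. polyfun_tac. Qed.

Lemma dist2_nonneg a z : 0 <= dist2 a z.
Proof. unfold dist2. pose proof (pow2_ge_0 (fst z - fst a)). pose proof (pow2_ge_0 (snd z - snd a)). lra. Qed.

Lemma dist2_pos a z : z <> a -> 0 < dist2 a z.
Proof.
  intros H. destruct (dist2_nonneg a z) as [P|E]; [exact P|exfalso]. apply H. unfold dist2 in E.
  pose proof (pow2_ge_0 (fst z - fst a)). pose proof (pow2_ge_0 (snd z - snd a)).
  assert (E1 : (fst z - fst a) ^ 2 = 0) by lra. assert (E2 : (snd z - snd a) ^ 2 = 0) by lra.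
  rewrite <- Rsqr_pow2 in E1, E2. apply Rsqr_0_uniq in E1. apply Rsqr_0_uniq in E2.
  destruct z, a. simpl in *. f_equal; lra.
Qed.

Lemma dist2_blow a k : blow (fun z => dist2 a z ^ k) a (2 * k) (fun p => (fst (snd p) ^ 2 + snd (snd p) ^ 2) ^ k).
Proof.
  split; [polyfun_tac|]. intros s w. unfold dist2, ray. rewrite pow_mult, <- Rpow_mult_distr. f_equal. simpl. ring.
Qed.

Lemma multiplier_mul f A Q : pol2 A -> multiplier f Q -> multiplier f (fun z => A z * Q z).
Proof.
  intros HA [HQ [P [HP E]]]. split; [now apply pf_mul|].
  exists (fun z => A z * P z). split; [now apply pf_mul|]. intros z. rewrite <- E. ring.
Qed.

Lemma multiplier_add f Q Q' : multiplier f Q -> multiplier f Q' -> multiplier f (fun z => Q z + Q' z).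
Proof.
  intros [HQ [P [HP E]]] [HQ' [P' [HP' E']]]. split; [now apply pf_add|].
  exists (fun z => P z + P' z). split; [now apply pf_add|]. intros z. rewrite <- E, <- E'. ring.
Qed.

(** The squares of the multipliers have different orders at [a]. Powers of [dist2 a], whose leading
    form is definite, bring them to a common order; the forms are then non-negative and cannot
    cancel in the sum. *)
Lemma combine_directions f a (T : list ((R2 -> R) * (nat * (R * R2 -> R)))) :
  (forall t, In t T -> multiplier f (fst t) /\ blow (fst t) a (fst (snd t)) (snd (snd t))) ->
  exists q M K, multiplier f q /\ (forall z, 0 <= q z) /\ blow q a (2 * M) K /\ (forall w : R2, 0 <= K (0, w)) /\
    forall t, In t T -> forall w : R2, w <> (0, 0) -> snd (snd t) (0, w) <> 0 -> 0 < K (0, w).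
Proof.
  induction T as [|[Q [N KQ]] T IH]; intros H.
  { exists (fun _ => 0), 0%nat, (fun _ => 0). split; [|split; [|split; [|split]]].
    - split; [apply pf_const|]. exists (fun _ => 0). split; [apply pf_const|intros; ring].
    - intros; lra.
    - split; [apply pf_const|intros; ring].
    - intros; lra.
    - intros t []. }
  destruct IH as [q [M [K [I [q0 [B [K0 HT]]]]]]]; [intros; apply H; now right|].
  destruct (H (Q, (N, KQ))) as [IQ BQ]; [now left|]. simpl in IQ, BQ.
  set (rho := fun w : R2 => fst w ^ 2 + snd w ^ 2).
  assert (rho_pos : forall w, w <> (0, 0) -> 0 < rho w).
  { intros w Hw. replace (rho w) with (dist2 (0, 0) w) by (unfold rho, dist2; simpl; ring). now apply dist2_pos. }
  assert (rho0 : forall w, 0 <= rho w).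
  { intros w. replace (rho w) with (dist2 (0, 0) w) by (unfold rho, dist2; simpl; ring). apply dist2_nonneg. }
  exists (fun z => dist2 a z ^ N * q z + (dist2 a z ^ M * Q z) * Q z), (N + M)%nat,
    (fun p => rho (snd p) ^ N * K p + (rho (snd p) ^ M * KQ p) * KQ p).
  split; [|split; [|split; [|split]]].
  - apply multiplier_add; apply multiplier_mul; auto using dist2_pol2.
    apply pf_mul; [apply dist2_pol2|apply IQ].
  - intros z. assert (h1 := pow_le _ N (dist2_nonneg a z)). assert (h2 := pow_le _ M (dist2_nonneg a z)).
    specialize (q0 z). pose proof (Rmult_le_pos _ _ h1 q0). pose proof (Rmult_le_pos _ _ h2 (pow2_ge_0 (Q z))). nra.
  - apply blow_add.
    + apply blow_cast with (2 * N + 2 * M)%nat; [lia|]. apply (blow_mul (fun z => dist2 a z ^ N)); [apply dist2_blow|exact B].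
    + apply blow_cast with (2 * M + N + N)%nat; [lia|].
      apply (blow_mul (fun z => dist2 a z ^ M * Q z) Q); [|exact BQ].
      apply (blow_mul (fun z => dist2 a z ^ M)); [apply dist2_blow|exact BQ].
  - intros w. simpl snd. assert (h1 := pow_le _ N (rho0 w)). assert (h2 := pow_le _ M (rho0 w)).
    specialize (K0 w). pose proof (Rmult_le_pos _ _ h1 K0).
    pose proof (Rmult_le_pos _ _ h2 (pow2_ge_0 (KQ (0, w)))). nra.
  - intros t Ht w Hw Kw. simpl snd.
    assert (P1 : 0 < rho w ^ N) by (apply pow_lt; auto).
    assert (P2 : 0 < rho w ^ M) by (apply pow_lt; auto).
    destruct Ht as [<-|Ht].
    + simpl in Kw. assert (0 < KQ (0, w) ^ 2) by (rewrite <- Rsqr_pow2; now apply Rlt_0_sqr).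
      specialize (K0 w).
      assert (0 <= rho w ^ N * K (0, w)) by (apply Rmult_le_pos; lra).
      assert (0 < rho w ^ M * KQ (0, w) ^ 2) by (apply Rmult_lt_0_compat; lra). nra.
    + specialize (HT t Ht w Hw Kw).
      assert (0 < rho w ^ N * K (0, w)) by (apply Rmult_lt_0_compat; lra).
      assert (0 <= rho w ^ M * KQ (0, w) ^ 2) by (apply Rmult_le_pos; [lra|apply pow2_ge_0]). nra.
Qed.

(** A leading form that does not vanish in the direction [(1, 0)] vanishes in finitely many
    directions only, so finitely many multipliers suffice. *)
Lemma lpd_multiplier f a : (forall w, w <> (0, 0) -> has_direction f a w) ->
  exists q m K, multiplier f q /\ (forall z, 0 <= q z) /\ lpd q a m K.
Proof.
  intros H.
  assert (n1 : forall v, ((1, v) : R2) <> (0, 0)) by (intros v E; injection E; lra).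
  assert (n2 : ((0, 1) : R2) <> (0, 0)) by (intros E; injection E; lra).
  destruct (H (1, 0) (n1 0)) as [Q1 [N1 [K1 [I1 [B1 H1]]]]].
  destruct (H (0, 1) n2) as [Q2 [N2 [K2 [I2 [B2 H2]]]]].
  assert (P1 : pol1 (fun v => K1 (0, (1, v)))).
  { apply (pol3_triple K1 _ (fun _ => 0) (fun _ => 1) (fun v => v) (proj1 B1));
      [apply pf_const|apply pf_const|now apply pf_var]. }
  destruct (Bridge.pol1_zeros_list P1) as [vs Hvs]; [now exists 0|].
  assert (HT : exists T : list ((R2 -> R) * (nat * (R * R2 -> R))),
    (forall t, In t T -> multiplier f (fst t) /\ blow (fst t) a (fst (snd t)) (snd (snd t))) /\
    forall v, In v vs -> exists t, In t T /\ snd (snd t) (0, (1, v)) <> 0).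
  { clear Hvs. induction vs as [|v vs [T [HT1 HT2]]].
    - exists []. split; [intros t []|intros v []].
    - destruct (H (1, v) (n1 v)) as [Q [N [K [I [B HK]]]]].
      exists ((Q, (N, K)) :: T). split.
      + intros t [<-|Ht]; [now split|now apply HT1].
      + intros v' [<-|Hv]; [exists (Q, (N, K)); split; [now left|exact HK]|].
        destruct (HT2 v' Hv) as [t [It Kt]]. exists t. split; [now right|exact Kt]. }
  destruct HT as [T [HT1 HT2]].
  destruct (combine_directions f a ((Q1, (N1, K1)) :: (Q2, (N2, K2)) :: T)) as [q [M [K [I [q0 [B [K0 HK]]]]]]].
  { intros t [<-|[<-|Ht]]; [now split|now split|now apply HT1]. }
  exists q, (2 * M)%nat, K. split; [exact I|]. split; [exact q0|]. split; [exact B|].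
  assert (H1v : forall v, 0 < K (0, (1, v))).
  { intros v. destruct (Req_dec (K1 (0, (1, v))) 0) as [E|E].
    - destruct (HT2 v (Hvs v E)) as [t [It Kt]]. apply (HK t); [now right; right|apply n1|exact Kt].
    - apply (HK (Q1, (N1, K1))); [now left|apply n1|exact E]. }
  intros [x y] Hw. destruct (Req_dec x 0) as [->|x0].
  - apply (HK (Q2, (N2, K2))); [now right; left|exact Hw|]. simpl.
    replace (0, y) with (y * fst (0, 1), y * snd (0, 1)) by (simpl; f_equal; ring).
    rewrite (blow_homogeneous Q2 a N2 K2 B2). apply Rmult_integral_contrapositive_currified; [|exact H2].
    apply pow_nonzero. intros ->. now apply Hw.
  - replace (x, y) with (x * fst (1, y / x), x * snd (1, y / x)) by (simpl; f_equal; field; exact x0).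
    rewrite (blow_homogeneous q a _ K B). apply Rmult_lt_0_compat; [|apply H1v].
    rewrite pow_mult. apply pow_lt. rewrite <- Rsqr_pow2. now apply Rlt_0_sqr.
Qed.

Lemma lpd_add_higher g h a m K k K' : lpd g a m K -> blow h a (m + S k) K' ->
  exists K'', lpd (fun z => g z + h z) a m K''.
Proof.
  intros [B P] Bh. destruct (blow_lower h a m k K' Bh) as [K1 [B1 Z1]].
  exists (fun p => K p + K1 p). split; [now apply blow_add|].
  intros w Hw. rewrite Z1, Rplus_0_r. now apply P.
Qed.

(** [T] is a product of powers of the [dist2 b], high enough that a term multiplied by [T] does not
    disturb the leading forms of [q] on [l]. *)
Lemma high_order_factor q (l : list R2) a : (forall b, In b l -> exists m K, lpd q b m K) -> ~ In a l ->
  exists T, pol2 T /\ (forall z, 0 <= T z) /\ 0 < T a /\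
    forall b, In b l -> exists m K KT, lpd q b m K /\ blow T b (S m) KT.
Proof.
  induction l as [|b l IH]; intros H Ha.
  { exists (fun _ => 1). split; [apply pf_const|]. split; [intros; lra|]. split; [lra|intros b []]. }
  destruct IH as [T [PT [T0 [Ta HT]]]]; [intros; apply H; now right|intros I; apply Ha; now right|].
  destruct (H b) as [m [K L]]; [now left|].
  exists (fun z => T z * dist2 b z ^ S m). split; [apply pf_mul; [exact PT|apply dist2_pol2]|].
  split; [|split].
  - intros z. apply Rmult_le_pos; [apply T0|apply pow_le, dist2_nonneg].
  - apply Rmult_lt_0_compat; [exact Ta|]. apply pow_lt, dist2_pos. intros ->. apply Ha. now left.
  - intros b' [<-|Hb'].
    + assert (BB := blow_mul _ _ _ _ _ _ _ (blow_0 T b PT) (dist2_blow b (S m))).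
      assert (E : (0 + 2 * S m)%nat = (S m + S m)%nat) by lia.
      destruct (blow_lower _ b (S m) m _ (blow_cast _ _ _ _ _ E BB)) as [K' [B' _]].
      now exists m, K, K'.
    + destruct (HT b' Hb') as [m' [K' [KT [L' BT]]]]. exists m', K'.
      assert (BB := blow_mul _ _ _ _ _ _ _ BT (blow_0 _ b' (dist2_pol2 b (S m)))).
      rewrite Nat.add_0_r in BB. eexists. split; [exact L'|exact BB].
Qed.

Lemma lpd_denominator f S : Defs.R0 f -> regular_after_blowup S f ->
  forall l, NoDup l -> incl l S -> exists q, multiplier f q /\ (forall z, 0 <= q z) /\
    (forall z, q z = 0 -> In z S) /\ forall a, In a l -> exists m K, lpd q a m K.
Proof.
  intros R0f HS. induction l as [|a l IH]; intros ND Hl.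
  { destruct (multiplier_base f S R0f (proj1 HS)) as [Q [I Z]].
    exists (fun z => Q z * Q z). split; [apply multiplier_mul; [apply I|exact I]|].
    split; [intros z; nra|]. split; [|intros a []].
    intros z E. apply Z. apply Rmult_integral in E. tauto. }
  inversion ND as [|? ? Na ND']; subst.
  assert (Sa : In a S) by (apply Hl; now left).
  destruct IH as [q [I [q0 [Z L]]]]; [exact ND'|intros b Hb; apply Hl; now right|].
  destruct (lpd_multiplier f a) as [qa [n [Ka [Ia [qa0 La]]]]].
  { apply blowup_directions with S; auto. apply R0f. }
  destruct (high_order_factor q l a L Na) as [T [PT [T0 [Ta HT]]]].
  assert (Pq : pol2 q) by apply I. assert (Pqa : pol2 qa) by apply Ia.
  (* At [a] the first term has order [n] and the second at least [2 n + 2]; on [l] the factor [T]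
     gives the first term the larger order. Both terms are non-negative, so a zero other than [a] is
     a zero of [q]. *)
  exists (fun z => T z * qa z + dist2 a z ^ Datatypes.S n * q z).
  split; [apply multiplier_add; apply multiplier_mul; auto using dist2_pol2|].
  assert (h1 : forall z, 0 <= T z * qa z) by (intros z; apply Rmult_le_pos; auto).
  assert (h2 : forall z, 0 <= dist2 a z ^ Datatypes.S n * q z).
  { intros z. apply Rmult_le_pos; auto. apply pow_le, dist2_nonneg. }
  split; [intros z; specialize (h1 z); specialize (h2 z); lra|]. split.
  - intros z E. specialize (h1 z). specialize (h2 z).
    assert (E2 : dist2 a z ^ Datatypes.S n * q z = 0) by lra.
    destruct (classic (z = a)) as [->|ne]; [exact Sa|]. apply Z.
    apply Rmult_integral in E2. destruct E2 as [E2|E2]; [|exact E2].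
    pose proof (pow_lt _ (Datatypes.S n) (dist2_pos a z ne)). lra.
  - intros b [<-|Hb].
    + assert (L1 := lpd_mul _ _ _ _ _ _ _ (lpd_0 T a PT Ta) La).
      assert (B1 := blow_mul _ _ _ _ _ _ _ (dist2_blow a (Datatypes.S n)) (blow_0 q a Pq)).
      assert (E : (2 * Datatypes.S n + 0)%nat = (0 + n + Datatypes.S (n + 1))%nat) by lia.
      destruct (lpd_add_higher _ _ _ _ _ _ _ L1 (blow_cast _ _ _ _ _ E B1)) as [K HK].
      now exists (0 + n)%nat, K.
    + destruct (HT b Hb) as [m [K [KT [Lb BT]]]].
      assert (ne : b <> a) by (intros ->; contradiction).
      assert (pa : 0 < dist2 a b ^ Datatypes.S n) by (apply pow_lt, dist2_pos; auto).
      assert (L1 := lpd_mul _ _ _ _ _ _ _ (lpd_0 _ b (dist2_pol2 a (Datatypes.S n)) pa) Lb).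
      assert (B1 := blow_mul _ _ _ _ _ _ _ BT (blow_0 qa b Pqa)).
      assert (E : (Datatypes.S m + 0)%nat = (0 + m + 1)%nat) by lia.
      destruct (lpd_add_higher _ _ _ _ _ _ _ L1 (blow_cast _ _ _ _ _ E B1)) as [K' HK].
      exists (0 + m)%nat, K'. apply lpd_ext with (1 := HK). intros z. ring.
Qed.

Lemma filter_list (Z : list R2) (P : R2 -> Prop) : NoDup Z ->
  exists L, NoDup L /\ forall a, In a L <-> In a Z /\ P a.
Proof.
  induction Z as [|a Z IH]; intros ND.
  { exists []. split; [constructor|]. simpl. tauto. }
  inversion ND as [|? ? Na ND']; subst. destruct (IH ND') as [L [NL HL]].
  destruct (classic (P a)) as [Pa|Pa].
  - exists (a :: L). split; [constructor; [|exact NL]; rewrite HL; tauto|].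
    intros b. simpl. rewrite HL. split; [intros [->|]; tauto|tauto].
  - exists L. split; [exact NL|]. intros b. simpl. rewrite HL.
    split; [tauto|]. intros [[->|] ?]; tauto.
Qed.

Theorem R0_1_sum_of_squares f : R0_1 f -> (forall z, 0 <= f z) ->
  exists fs : list (R2 -> R), Forall R0_1 fs /\ forall z, f z = sum_sq_funs fs z.
Proof.
  intros [R0f [S [NS HS]]] f0. assert (Cf := proj1 R0f).
  destruct (lpd_denominator f S R0f HS S NS (incl_refl S)) as [q [[Pq [P [PP E]]] [q0 [Z L]]]].
  destruct (Bridge.psd_pol2_sum_sq (F := fun z => P z * q z)) as [c [rs [Pc c0 Prs Ec]]].
  { now apply pf_mul. }
  { intros z. rewrite <- E. specialize (f0 z). specialize (q0 z). apply Rmult_le_pos; [now apply Rmult_le_pos|lra]. }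
  (* As [f d^2 = c^2 P q] is a sum of squares and [d^2] a single square, the construction applies
     with denominator [d^2]. *)
  set (d := fun z => q z * c z).
  assert (Pd : pol2 d) by now apply pf_mul.
  set (D := fun z => d z * d z).
  assert (DZ : forall z, D z = 0 -> In z S).
  { intros z Hz. apply Z. unfold D, d in Hz. specialize (c0 z).
    apply Rmult_integral in Hz. destruct Hz as [Hz|Hz]; apply Rmult_integral in Hz; tauto. }
  assert (LD : forall a, exists mK : nat * (R * R2 -> R), In a S -> lpd D a (fst mK) (snd mK)).
  { intros a. destruct (classic (In a S)) as [Ia|Na]; [|exists (0%nat, fun _ => 0); contradiction].
    destruct (L a Ia) as [m [K La]].
    assert (C : 0 < c a * c a) by (specialize (c0 a); apply Rsqr_pos_lt in c0; exact c0).
    assert (L1 := lpd_mul _ _ _ _ _ _ _ (lpd_mul _ _ _ _ _ _ _ La La) (lpd_0 _ a (pf_mul _ _ _ Pc Pc) C)).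
    eexists (_, _). intros _. apply lpd_ext with (1 := L1). intros z. unfold D, d. ring. }
  set (mK := fun a => proj1_sig (constructive_indefinite_description _ (LD a))).
  assert (HmK := fun a => proj2_sig (constructive_indefinite_description _ (LD a))).
  destruct (filter_list S (fun a => D a = 0 /\ f a <> 0) NS) as [L' [NL HL]].
  destruct (corrected_sum_of_squares f D rs [d] S (fun a => fst (mK a)) (fun a => snd (mK a))) with (L := L')
    as [fs [_ [Hfs [Efs _]]]]; auto.
  - now apply pf_mul.
  - intros z. unfold D. simpl. ring.
  - intros z. rewrite <- Ec, <- E. unfold D, d. ring.
  - intros a. rewrite HL. split; [tauto|]. intros H. split; [apply DZ; tauto|exact H].
  - now exists fs.
Qed.

(** * Taylor expansions and the theorem *)

Lemma rsum_ext n f g : (forall i, (i <= n)%nat -> f i = g i) -> rsum n f = rsum n g.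
Proof. intros H. unfold rsum. now apply sum_eq. Qed.

Lemma rsum_scal n c f : rsum n (fun i => c * f i) = c * rsum n f.
Proof. unfold rsum. induction n as [|n IH]; simpl; [reflexivity|]. rewrite IH. ring. Qed.

Lemma rsum_plus n f g : rsum n (fun i => f i + g i) = rsum n f + rsum n g.
Proof. unfold rsum. induction n as [|n IH]; simpl; [reflexivity|]. rewrite IH. ring. Qed.

Lemma rsum_swap n k F : rsum n (fun i => rsum k (fun j => F i j)) = rsum k (fun j => rsum n (fun i => F i j)).
Proof.
  induction n as [|n IH]; [reflexivity|].
  change (rsum n (fun i => rsum k (fun j => F i j)) + rsum k (fun j => F (S n) j) =
    rsum k (fun j => rsum n (fun i => F i j) + F (S n) j)).
  now rewrite IH, rsum_plus.
Qed.

Lemma rsum_extend n k f : (forall i, (n < i)%nat -> f i = 0) -> (n <= k)%nat -> rsum k f = rsum n f.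
Proof.
  intros H L. induction L as [|k L IH]; [reflexivity|].
  change (rsum k f + f (S k) = rsum n f). rewrite IH, H; [ring|lia].
Qed.

Lemma rsum_mul n c F G : c * rsum n F * rsum n G = rsum n (fun k => rsum n (fun l => c * F k * G l)).
Proof.
  rewrite (rsum_ext n (fun k => rsum n _) (fun k => (c * rsum n G) * F k)).
  - rewrite rsum_scal. ring.
  - intros k _. rewrite rsum_scal. ring.
Qed.

Definition taylor_coef (c : R) (i k : nat) : R := if Nat.leb k i then C i k * c ^ (i - k) else 0.

Lemma taylor_monomial n i c x : (i <= n)%nat -> (c + x) ^ i = rsum n (fun k => taylor_coef c i k * x ^ k).
Proof.
  intros L. rewrite (rsum_extend i n).
  - rewrite Rplus_comm, binomial. apply sum_eq. intros k Hk. unfold taylor_coef.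
    destruct (Nat.leb_spec k i); [ring|lia].
  - intros k Hk. unfold taylor_coef. destruct (Nat.leb_spec k i); [lia|ring].
  - exact L.
Qed.

Lemma shiftc_taylor q a k l : shiftc q a k l =
  rsum (pdeg q) (fun i => rsum (pdeg q) (fun j =>
    pcoef q i j * taylor_coef (fst a) i k * taylor_coef (snd a) j l)).
Proof.
  apply rsum_ext; intros i _; apply rsum_ext; intros j _. unfold taylor_coef.
  destruct (Nat.leb k i), (Nat.leb l j); simpl; ring.
Qed.

Lemma ev_taylor q a x y : ev q (fst a + x, snd a + y) =
  rsum (pdeg q) (fun k => rsum (pdeg q) (fun l => shiftc q a k l * x ^ k * y ^ l)).
Proof.
  set (n := pdeg q). unfold ev. fold n. simpl fst. simpl snd.
  transitivity (rsum n (fun i => rsum n (fun j => rsum n (fun k => rsum n (fun l =>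
    pcoef q i j * taylor_coef (fst a) i k * taylor_coef (snd a) j l * x ^ k * y ^ l))))).
  - apply rsum_ext; intros i Hi; apply rsum_ext; intros j Hj.
    rewrite (taylor_monomial n i (fst a) x Hi), (taylor_monomial n j (snd a) y Hj).
    rewrite rsum_mul. apply rsum_ext; intros k _; apply rsum_ext; intros l _. ring.
  - rewrite (rsum_ext n _ (fun i => rsum n (fun k => rsum n (fun j => rsum n (fun l =>
      pcoef q i j * taylor_coef (fst a) i k * taylor_coef (snd a) j l * x ^ k * y ^ l)))))
      by (intros; apply rsum_swap).
    rewrite rsum_swap. apply rsum_ext; intros k _.
    rewrite (rsum_ext n _ (fun i => rsum n (fun l => rsum n (fun j =>
      pcoef q i j * taylor_coef (fst a) i k * taylor_coef (snd a) j l * x ^ k * y ^ l))))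
      by (intros; apply rsum_swap).
    rewrite rsum_swap. apply rsum_ext; intros l _.
    rewrite shiftc_taylor. fold n.
    rewrite Rmult_assoc, Rmult_comm, <- rsum_scal. apply rsum_ext; intros i _.
    rewrite <- rsum_scal. apply rsum_ext; intros j _. ring.
Qed.

(** The Taylor expansion at [a + s w] divided by [s^m]. Terms of degree below [m] get the value 0,
    since the exponent [k + l - m] would be truncated for them. *)
Definition taylor_blow (q : poly2) (a : R2) (m : nat) (p : R * R2) : R :=
  rsum (pdeg q) (fun k => rsum (pdeg q) (fun l =>
    if Nat.ltb (k + l) m then 0
    else shiftc q a k l * fst p ^ (k + l - m) * fst (snd p) ^ k * snd (snd p) ^ l)).

Lemma taylor_blow_blow q a m : lowest_deg q a m -> blow (ev q) a m (taylor_blow q a m).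
Proof.
  intros [_ H]. split.
  - unfold taylor_blow.
    apply (rsum_polyfun _ (pdeg q) (fun k p => rsum (pdeg q) (fun l =>
      if Nat.ltb (k + l) m then 0
      else shiftc q a k l * fst p ^ (k + l - m) * fst (snd p) ^ k * snd (snd p) ^ l))).
    intros k. apply (rsum_polyfun _ (pdeg q) (fun l p => if Nat.ltb (k + l) m then 0
      else shiftc q a k l * fst p ^ (k + l - m) * fst (snd p) ^ k * snd (snd p) ^ l)).
    intros l. destruct (Nat.ltb (k + l) m); polyfun_tac.
  - intros s w. unfold ray. rewrite ev_taylor. unfold taylor_blow.
    rewrite <- rsum_scal. apply rsum_ext; intros k Hk. rewrite <- rsum_scal. apply rsum_ext; intros l Hl.
    destruct (Nat.ltb_spec (k + l) m) as [L|L].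
    + rewrite H by assumption. ring.
    + simpl. rewrite !Rpow_mult_distr.
      replace (s ^ m * (shiftc q a k l * s ^ (k + l - m) * fst w ^ k * snd w ^ l))
        with (shiftc q a k l * (s ^ m * s ^ (k + l - m)) * fst w ^ k * snd w ^ l) by ring.
      rewrite <- pow_add. replace (m + (k + l - m))%nat with (k + l)%nat by lia. rewrite pow_add. ring.
Qed.

Lemma hcomp_taylor_blow q a m z : hcomp q a m z = taylor_blow q a m (0, (fst z - fst a, snd z - snd a)).
Proof.
  apply rsum_ext; intros k _; apply rsum_ext; intros l _. simpl.
  destruct (Nat.ltb_spec (k + l) m); destruct (Nat.eqb_spec (k + l) m) as [E|E]; try lia; try reflexivity.
  - rewrite E, Nat.sub_diag. simpl. ring.
  - rewrite pow_i by lia. ring.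
Qed.

Lemma loc_pos_def_lpd q a m : lowest_deg q a m -> (forall z, z <> a -> 0 < hcomp q a m z) ->
  lpd (ev q) a m (taylor_blow q a m).
Proof.
  intros L P. split; [now apply taylor_blow_blow|]. intros [x y] Hw.
  specialize (P (fst a + x, snd a + y)). rewrite hcomp_taylor_blow in P. simpl in P.
  replace (fst a + x - fst a) with x in P by ring. replace (snd a + y - snd a) with y in P by ring.
  apply P. intros E. apply Hw. rewrite (surjective_pairing a) in E. injection E as E1 E2. f_equal; lra.
Qed.

Lemma is_sos_funs P : is_sos P -> exists ps, Forall pol2 ps /\ forall z, ev P z = sum_sq_funs ps z.
Proof.
  intros [gs H]. exists (map ev gs). split.
  - apply Forall_forall. intros g Hg. apply in_map_iff in Hg. destruct Hg as [g' [<- _]]. apply pol2_ev.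
  - intros z. rewrite H. clear. induction gs as [|g gs IH]; simpl in *; [reflexivity|]. now rewrite IH.
Qed.

Lemma poly2_list rs : Forall pol2 rs -> exists Rs, Forall2 (fun (r : R2 -> R) P => forall z, ev P z = r z) rs Rs.
Proof.
  induction 1 as [|r rs Pr _ [Rs H]]; [exists []; constructor|].
  destruct (Bridge.pol2_is_poly2 Pr) as [P HP]. exists (P :: Rs). now constructor.
Qed.

Theorem R0_1_common_denominator (f : R2 -> R) (p q : poly2) :
  R0_1 f -> (forall z, 0 <= f z) -> is_sos p -> is_sos q -> (forall a, loc_pos_def q a) ->
  (forall z, ev q z <> 0 -> f z = ev p z / ev q z) ->
  exists L : list R2, NoDup L /\
    (forall a, In a L <-> (ev q a = 0 /\ f a <> 0)) /\
    exists ms : R2 -> nat, (forall a, In a L -> lowest_deg q a (ms a)) /\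
    let D := fun z => ev q z * fold_right (fun a acc => hcomp q a (ms a) z * acc) 1 L in
    exists (fs : list (R2 -> R)) (rs : list poly2),
      Forall R0_1 fs /\ (forall z, f z = sum_sq_funs fs z) /\
      Forall2 (fun fi ri => forall z, D z <> 0 -> fi z = ev ri z / D z) fs rs.
Proof.
  intros [[Cf _] _] f0 Sp Sq LP Hf.
  set (ms := fun a => proj1_sig (constructive_indefinite_description _ (LP a))).
  assert (Hms := fun a => proj2_sig (constructive_indefinite_description _ (LP a))).
  assert (LQ : forall a, lpd (ev q) a (ms a) (taylor_blow q a (ms a))).
  { intros a. apply loc_pos_def_lpd; apply (Hms a). }
  destruct (Bridge.isolated_zeros_list (pol2_ev q)) as [Z [NZ HZ]].
  { intros a _. exact (lpd_nonzero_near _ _ _ _ (LQ a)). }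
  destruct (filter_list Z (fun a => ev q a = 0 /\ f a <> 0) NZ) as [L [NL HL]].
  assert (HL' : forall a, In a L <-> ev q a = 0 /\ f a <> 0).
  { intros a. rewrite HL. split; [tauto|]. intros H. split; [apply HZ; tauto|exact H]. }
  exists L. split; [exact NL|]. split; [exact HL'|].
  exists ms. split; [intros a _; apply (Hms a)|]. intros D.
  destruct (is_sos_funs p Sp) as [ps [Pps Eps]]. destruct (is_sos_funs q Sq) as [qs [Pqs Eqs]].
  destruct (corrected_sum_of_squares f (ev q) ps qs Z ms (fun a => taylor_blow q a (ms a)))
    with (L := L) as [fs [rs [Hfs [Efs [Prs Hrs]]]]]; auto using pol2_ev.
  (* At a zero of [q] the identity [f q = p] is not part of the hypothesis; it follows by continuity
     along a ray. *)
  { intros z. rewrite <- Eps. destruct (Req_dec (ev q z) 0) as [E|E].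
    - apply (cont_eq_at (fun z => f z * ev q z) (ev p) (ev q) z (ms z) (taylor_blow q z (ms z))); [| |apply LQ|].
      + apply cont_at_mult; [exact (Cf z)|exact (pol2_continuous _ (pol2_ev q) z)].
      + exact (pol2_continuous _ (pol2_ev p) z).
      + intros w Hw. rewrite Hf by exact Hw. field. exact Hw.
    - rewrite Hf by exact E. field. exact E. }
  destruct (poly2_list rs Prs) as [Rs HRs]. exists fs, Rs.
  split; [exact Hfs|]. split; [exact Efs|].
  assert (ED : forall z, den (ev q) (fun a => taylor_blow q a (ms a)) L z = D z).
  { intros z. unfold den, D, lead_prod. f_equal. clear. induction L as [|a L IH]; simpl; [reflexivity|].
    rewrite IH. f_equal. symmetry. apply hcomp_taylor_blow. }
  clear - Hrs HRs ED. revert Rs HRs. induction Hrs as [|fi ri fs rs H _ IH]; intros Rs HRs.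
  - inversion HRs; subst. constructor.
  - inversion HRs as [|? P ? Rs' HP HRs']; subst. constructor; [|now apply IH].
    intros z Dz. rewrite HP, <- ED. apply H. now rewrite ED.
Qed.

Theorem theorem6p9 :
  (forall f : R2 -> R, R0_1 f -> (forall z, 0 <= f z) ->
     exists fs : list (R2 -> R), Forall R0_1 fs /\ forall z, f z = sum_sq_funs fs z)
  /\
  (forall (f : R2 -> R) (p q : poly2),
     R0_1 f -> (forall z, 0 <= f z) ->
     is_sos p -> is_sos q -> (forall a, loc_pos_def q a) ->
     (forall z, ev q z <> 0 -> f z = ev p z / ev q z) ->
     exists L : list R2, NoDup L /\
       (forall a, In a L <-> (ev q a = 0 /\ f a <> 0)) /\
       exists ms : R2 -> nat, (forall a, In a L -> lowest_deg q a (ms a)) /\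
       let D := fun z => ev q z * fold_right (fun a acc => hcomp q a (ms a) z * acc) 1 L in
       exists (fs : list (R2 -> R)) (rs : list poly2),
         Forall R0_1 fs /\ (forall z, f z = sum_sq_funs fs z) /\
         Forall2 (fun fi ri => forall z, D z <> 0 -> fi z = ev ri z / D z) fs rs).
Proof. split; [exact R0_1_sum_of_squares|exact R0_1_common_denominator]. Qed.
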